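(* Let $G$ be a finite simple graph such that $\overline{G}$ is bipartite. Then $$\mu(I_{\mathcal{Q}_G})=\begin{cases}0 & \text{if } \overline{G} \text{ is empty (i.e., } G \text{ is complete)},\\ k & \text{if } \overline{G} \text{ has a cycle},\\ 2 & \text{otherwise,}\end{cases}$$ where $2k$ is the maximum length of induced cycles of $\overline{G}$. Moreover, the following conditions are equivalent: (i) $\mu(I_{\mathcal{Q}_G})\leq 2$, i.e., $I_{\mathcal{Q}_G}$ is generated by quadratic binomials; (ii) $K[\mathcal{Q}_G]$ is Koszul; (iii) $I_{\mathcal{Q}_G}$ has a quadratic Gröbner basis; (iv) the length of any induced cycle of $\overline{G}$ is $4$.
   Context: $G$ is a graph on $[n]=\{1,\dots,n\}$; $\overline{G}$ is its complement, and $\overline{G}$ is empty if it has no edges. A subset $W\subset[n]$ is stable if no two distinct elements of $W$ form an edge of $G$ (the empty set and singletons are stable). With $\rho(W)=\sum_{j\in W}\mathbf{e}_j$, the stable set polytope $\mathcal{Q}_G\subset\mathbb{R}^n$ is the convex hull of the $\rho(W)$ for $W$ stable in $G$. Let $K$ be a field. For an integral convex polytope $\mathcal{P}\subset\mathbb{R}^n$ with $\mathcal{P}\cap\mathbb{Z}^n=\{\mathbf{a}_1,\dots,\mathbf{a}_m\}$, the toric ring $K[\mathcal{P}]$ is the $K$-subalgebra of $K[x_1^{\pm1},\dots,x_n^{\pm1},t]$ generated by the $X^{\mathbf{a}_i}t$ (where $X^{\mathbf{a}}=x_1^{a_1}\cdots x_n^{a_n}$), graded by $\deg X^{\mathbf{a}_i}t=1$,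 and the toric ideal $I_{\mathcal{P}}$ is the kernel of the surjection $K[y_1,\dots,y_m]\to K[\mathcal{P}]$, $y_i\mapsto X^{\mathbf{a}_i}t$. For a toric ideal $I$, $\mu(I)$ is the maximum degree of binomials in a minimal set of binomial generators of $I$, with $\mu(\{0\})=0$. Having a quadratic Gröbner basis means having one with respect to some monomial order (the zero ideal is regarded as satisfying this trivially, as it also counts as generated by quadratic binomials). *)

(* Defs.v *)
From HB Require Import structures.
From mathcomp Require Import all_boot all_order all_algebra.
From mathcomp Require Import boolp classical_sets reals.
From mathcomp Require Import mpoly.

Set Implicit Arguments.
Unset Strict Implicit.
Unset Printing Implicit Defensive.

Import Order.TTheory GRing.Theory Num.Theory.

Local Open Scope classical_set_scope.
Local Open Scope ring_scope.

Section Graphs.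
Variable n : nat.
Implicit Types (e : rel 'I_n) (s : seq 'I_n).

Definition compl_graph e : rel 'I_n := [rel x y | (x != y) && ~~ e x y].

Definition edgeless e : Prop := forall x y, ~~ e x y.

Definition bipartite e : Prop :=
  exists c : 'I_n -> bool, forall x y, e x y -> c x != c y.

Definition graph_cycle e s : bool := (2 < size s)%N && ucycleb e s.

Definition has_cycle e : Prop := exists s, graph_cycle e s.

Definition induced_cycle e s : bool :=
  graph_cycle e s &&
  [forall x in s, forall y in s,
     e x y ==> ((y == next s x) || (x == next s y))].

Definition max_induced_cycle_length e (l : nat) : Prop :=
  (exists2 s, induced_cycle e s & size s = l) /\
  (forall s, induced_cycle e s -> (size s <= l)%N).

Definition stable e (W : {set 'I_n}) : bool :=
  [forall x in W, forall y in W, (x != y) ==> ~~ e x y].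

End Graphs.

Section Polytopes.
Variables (R : realType) (n : nat).

Definition convex_hull (S : set 'rV[R]_n) : set 'rV[R]_n :=
  [set v | exists (k : nat) (w : 'I_k -> R) (p : 'I_k -> 'rV[R]_n),
     [/\ forall i, 0 <= w i, \sum_i w i = 1, forall i, S (p i)
       & v = \sum_i w i *: p i]].

Definition rho (W : {set 'I_n}) : 'rV[R]_n := \sum_(j in W) delta_mx 0 j.

Definition stable_set_polytope (e : rel 'I_n) : set 'rV[R]_n :=
  convex_hull [set rho W | W in [set W | stable e W]].

(* [a] lists each point of P `&` Z^n exactly once. *)
Definition lattice_enum (P : set 'rV[R]_n) (m : nat)
    (a : 'I_m -> 'rV[int]_n) : Prop :=
  injective a /\ range a = [set z | P (map_mx intr z)].

End Polytopes.

Arguments rho R {n} W.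
Arguments stable_set_polytope R {n} e.

Lemma lattice_enum_exists (R : realType) (n : nat) (e : rel 'I_n) :
  exists (m : nat) (a : 'I_m -> 'rV[int]_n),
    lattice_enum (stable_set_polytope R e) a.
Proof.
pose P := stable_set_polytope R e.
pose F (f : {ffun 'I_n -> bool}) : 'rV[int]_n := \row_j (f j)%:R.
pose s := undup [seq z <- [seq F f | f : {ffun 'I_n -> bool}]
                | `[< P (map_mx intr z) >]].
exists (size s), (tnth (in_tuple s)); split.
  by apply/tuple_uniqP; rewrite undup_uniq.
apply/seteqP; split=> z /=.
  case=> i _ <-.
  have : tnth (in_tuple s) i \in s by rewrite mem_tnth.
  by rewrite mem_undup mem_filter => /andP[/asboolP].
move=> Pz; suff /(tnthP (in_tuple s))[i ->] : z \in s by exists i.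
rewrite mem_undup mem_filter; apply/andP; split; first exact/asboolP.
have z01 j : 0 <= z 0 j <= 1.
  case: Pz => k [w [p [w0 w1 pS zE]]].
  have p01 i : 0 <= p i 0 j <= 1.
    case: (pS i) => W _ <-; rewrite /rho summxE.
    under eq_bigr do rewrite mxE eqxx /=.
    have [jW|jW] := boolP (j \in W).
      rewrite (bigD1 j) //= eqxx big1 ?addr0 ?ler01 ?lexx // => l /andP[_].
      by rewrite eq_sym => /negPf ->.
    rewrite big1 ?lexx ?ler01 // => l lW.
    by case: eqP jW => // ->; rewrite lW.
  have := congr1 (fun v : 'rV[R]_n => v 0 j) zE; rewrite mxE summxE => zjE.
  rewrite -(ler0z R) -(lerz1 R) zjE; apply/andP; split.
    apply: sumr_ge0 => i _; rewrite mxE mulr_ge0 //.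
    by case/andP: (p01 i).
  rewrite -w1; apply: ler_sum => i _; rewrite mxE ler_piMr //.
  by case/andP: (p01 i).
have -> : z = F [ffun j => z 0 j == 1]; last by rewrite map_f ?mem_enum.
apply/rowP => j; rewrite !mxE ffunE.
by move: (z01 j); case: (z 0 j) => [[|[|q]]|q].
Qed.

Section Ideals.
Variables (K : fieldType) (m : nat).
Local Notation S := {mpoly K[m]}.
Implicit Types (I F : set S) (B : seq S) (le : rel 'X_{1..m}).

Definition ideal_gen F : set S :=
  [set p | exists (k : nat) (c f : 'I_k -> S),
     (forall i, F (f i)) /\ p = \sum_i c i * f i].

(* Total degree; [msize] is one more than the degree. *)
Definition tdeg (p : S) : nat := (msize p).-1.

Definition binomial_poly (p : S) : Prop :=
  exists u v : 'X_{1..m}, u != v /\ p = 'X_[u] - 'X_[v].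

Definition min_binomial_gens I B : Prop :=
  [/\ forall f, f \in B -> binomial_poly f,
      ideal_gen [set` B] = I
    & forall B', {subset B' <= B} -> ideal_gen [set` B'] = I ->
        {subset B <= B'}].

(* mu(I) = d: a minimal set of binomial generators exists, and the maximum
   degree does not depend on the one chosen. The empty maximum is 0, which
   gives mu({0}) = 0. Inclusion-minimal generating sets of an ideal of a
   Noetherian ring are finite, hence finite sequences suffice. *)
Definition mu_is I (d : nat) : Prop :=
  (exists B, min_binomial_gens I B) /\
  (forall B, min_binomial_gens I B -> (\max_(f <- B) tdeg f)%N = d).

Definition gen_by_quadratic_binomials I : Prop :=
  exists B, (forall f, f \in B -> binomial_poly f /\ tdeg f = 2%N) /\
            ideal_gen [set` B] = I.

Definition monomial_order le : Prop :=
  [/\ total le, antisymmetric le, transitive le,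
      forall u, le 0%MM u
    & forall u v w, le u v -> le (u + w)%MM (v + w)%MM].

Definition lead_monomial le (f : S) (u : 'X_{1..m}) : Prop :=
  u \in msupp f /\ forall v, v \in msupp f -> le v u.

(* Zero polynomials have no leading monomial and contribute nothing. *)
Definition initial_ideal le F : set S :=
  ideal_gen [set 'X_[u] | u in [set u | exists2 f, F f & lead_monomial le f u]].

Definition groebner_basis le I B : Prop :=
  [set` B] `<=` I /\ initial_ideal le [set` B] = initial_ideal le I.

Definition has_quadratic_groebner_basis I : Prop :=
  exists le B, [/\ monomial_order le, groebner_basis le I B
                 & forall g, g \in B -> tdeg g = 2%N].

End Ideals.

Section Toric.
Variables (K : fieldType) (n m : nat) (a : 'I_m -> 'rV[int]_n).

(* The Laurent ring K[x_1^{+-1}, .., x_n^{+-1}, t] is viewed inside the field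
   K(x_1, .., x_n, t): the variable of index [lift ord_max j] is x_j, the one
   of index [ord_max] is t. *)
Local Notation L := {fraction {mpoly K[n.+1]}}.

Definition laurent_const (c : K) : L := tofrac c%:MP.

(* X^{a_i} t *)
Definition toric_gen (i : 'I_m) : L :=
  (\prod_j (tofrac 'X_(lift ord_max j) : L) ^ (a i 0 j)) * tofrac 'X_ord_max.

Definition toric_map (p : {mpoly K[m]}) : L := mmap laurent_const toric_gen p.

Definition toric_ideal : set {mpoly K[m]} := [set p | toric_map p = 0].

Definition toric_ring : set L := range toric_map.

(* Degree d component, for the grading with deg X^{a_i} t = 1. *)
Definition toric_ring_deg (d : nat) : set L :=
  [set toric_map p | p in [set p | p \is d.-homog]].

End Toric.

Arguments toric_ideal K {n m} a.
Arguments toric_ring K {n m} a.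
Arguments toric_ring_deg K {n m} a d.

Section Koszul.
(* A graded ring is given by its carrier [R] in an ambient ring and its
   homogeneous components [R_ d]. *)
Variables (A : comNzRingType) (R : set A) (R_ : nat -> set A).

(* R_+, the sum of the components of positive degree *)
Definition irrelevant_ideal : set A :=
  [set x | exists (N : nat) (c : nat -> A),
     (forall d, R_ d (c d)) /\ x = \sum_(1 <= d < N) c d].

Definition res_rank (b : nat -> nat) (i : nat) : nat :=
  if i is j.+1 then b j else 1%N.

Definition vec_over (k : nat) : set 'rV[A]_k := [set v | forall j, R (v 0 j)].

(* The residue field R / R_+ has a linear free resolution
     .. -> R(-2)^{b 1} -> R(-1)^{b 0} -> R -> R / R_+ -> 0,
   the maps acting on row vectors by right multiplication. Entries in degree 1
   are both the degree-0 condition on the maps and minimality. *)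
Definition koszul : Prop :=
  exists (b : nat -> nat)
         (D : forall i, 'M[A]_(res_rank b i.+1, res_rank b i)),
  [/\ forall i r c, R_ 1%N (D i r c),
      forall x : 'rV[A]_1, irrelevant_ideal (x 0 0) <->
        exists2 w, vec_over w & x = w *m D 0%N
    & forall i v, vec_over v ->
        (v *m D i = 0 <-> exists2 w, vec_over w & v = w *m D i.+1)].

End Koszul.

(* Main.v *)
(* Write H for the complement of G, with its two colour classes as rows and
   columns. The lattice points of the polytope are the cliques of H, that is the
   empty set, the vertices and the edges; adding to H a row adjacent to all
   columns and a column adjacent to all rows turns them into the edges of a
   bipartite graph H', and the toric ring into the edge ring of H'. Two monomials
   lie in the same fiber when, as multigraphs, they have the same vertex degrees.

   Two monomials in a fiber differ by alternating cycles of H', and a chord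
   splits such a cycle, so the binomials of degree at most k generate when no
   induced cycle is longer than 2k; the new vertices lie on no induced cycle
   longer than 4. Conversely the fiber of an induced cycle of length 2k consists
   of its two perfect matchings, which are coprime. Hence no proper divisor of
   either one occurs in an element of the ideal, so the binomial of the cycle is
   not generated in degrees below k and, for k > 2, its leading monomial has no
   quadratic leading divisor and its syzygy is no combination of linear ones.

   If all induced cycles of H have length 4, then every nonempty graph obtained
   from H by repeatedly deleting a bisimplicial edge again has a bisimplicial
   edge. Ordering the variables by this elimination, graded reverse lexicographic
   order makes every non-minimal monomial of a fiber divisible by a quadratic
   leading monomial. A quadratic Groebner basis yields a linear resolution of the
   residue field by iterating Schreyer's construction of syzygies. *)

Require Import Defs.
From mathcomp Require Import all_boot all_order all_algebra.
From mathcomp Require Import boolp classical_sets reals.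
From mathcomp Require Import mpoly ring zify.

Set Implicit Arguments.
Unset Strict Implicit.
Unset Printing Implicit Defensive.

Import Order.TTheory GRing.Theory Num.Theory.

Local Open Scope classical_set_scope.
Local Open Scope ring_scope.

(** * Ideals and fibers *)

(** The obstacle in the Koszul direction is that infinitely many syzygy modules over the quotient
    ring must be controlled at once. They are replaced by modules over the polynomial ring that
    contain every vector with entries in the ideal. At each stage the leading terms not coming from
    the ideal are single variables times basis vectors. Syzygies then arise in two ways only: from
    two leading variables on the same basis vector, or from a leading variable whose product with
    another variable is a leading monomial of the ideal. In both cases the syzygy again has a
    variable as leading coefficient, so the shape reproduces itself and every map of the resolution
    is linear. Monomial and module orders are stored as ranks in [nat], which makes division an
    induction on numbers and the Schreyer tie-break a piece of arithmetic. *)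

Section MonomialSupport.
Variables (K : fieldType) (m : nat).
Local Notation S := {mpoly K[m]}.
Implicit Types (f g c : S) (u v w : 'X_{1..m}).

Lemma mcoeffM_eq0 c g u :
  (forall p q, u = (p + q)%MM -> c@_p != 0 -> g@_q = 0) -> (c * g)@_u = 0.
Proof.
move=> h; rewrite mcoeffM big1 // => k /eqP uE.
by have [->|c0] := eqVneq c@_k.1 0; rewrite ?mul0r // (h _ _ uE c0) mulr0.
Qed.

Lemma mcoeffM_neq0 c g u : (c * g)@_u != 0 ->
  exists p q, [/\ u = (p + q)%MM, c@_p != 0 & g@_q != 0].
Proof.
move=> cg; apply: contrapT => h; case/eqP: cg; apply: mcoeffM_eq0 => p q uE c0.
by apply/eqP/negPn/negP => g0; apply: h; exists p, q.
Qed.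

Lemma mcoeff_binomial u v w : ('X_[u] - 'X_[v] : S)@_w = (u == w)%:R - (v == w)%:R.
Proof. by rewrite mcoeffB !mcoeffX. Qed.

Lemma mcoeff_binomial_l u v : u != v -> ('X_[u] - 'X_[v] : S)@_u = 1.
Proof. by move=> uv; rewrite mcoeff_binomial eqxx (eq_sym v) (negPf uv) subr0. Qed.

Lemma mcoeff_binomial_r u v : u != v -> ('X_[u] - 'X_[v] : S)@_v = -1.
Proof. by move=> uv; rewrite mcoeff_binomial eqxx (negPf uv) sub0r. Qed.

Lemma tdegX_sub u v : u != v -> tdeg ('X_[u] - 'X_[v] : S) = maxn (mdeg u) (mdeg v).
Proof.
move=> uv; rewrite /tdeg; set f : S := _ - _.
have fu : u \in msupp f.
  by rewrite mcoeff_msupp mcoeff_binomial_l // oner_eq0.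
have fv : v \in msupp f.
  by rewrite mcoeff_msupp mcoeff_binomial_r // oppr_eq0 oner_eq0.
have le1 := msize_mdeg_lt fu; have le2 := msize_mdeg_lt fv.
have := mmeasureD_le mdeg 'X_[K, u] (- 'X_[K, v]).
rewrite mmeasureN !msizeX -/f maxnSS => le3.
apply/eqP; rewrite eqn_leq; apply/andP; split;
  first by rewrite -ltnS prednK // (leq_ltn_trans _ le1).
have sz : ((msize f).-1.+1 = msize f)%N by rewrite prednK // (leq_ltn_trans _ le1).
by rewrite geq_max -(ltnS (mdeg u)) -(ltnS (mdeg v)) sz le1 le2.
Qed.

Lemma mdeg_le_tdeg f u : f@_u != 0 -> (mdeg u <= tdeg f)%N.
Proof.
rewrite -mcoeff_msupp => /msize_mdeg_lt fu.
by rewrite -ltnS /tdeg prednK // (leq_ltn_trans _ fu).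
Qed.

Lemma lem_exists u v : (u <= v)%MM -> exists w, v = (w + u)%MM.
Proof. by move=> uv; exists (v - u)%MM; rewrite submK. Qed.

End MonomialSupport.

Section IdealGen.
Variables (K : fieldType) (m : nat).
Local Notation S := {mpoly K[m]}.
Implicit Types (I F : set S) (B : seq S) (f g c : S).

Definition is_ideal I : Prop :=
  [/\ I 0, forall f g, I f -> I g -> I (f + g) & forall c f, I f -> I (c * f)].

Lemma ideal_opp I f : is_ideal I -> I f -> I (- f).
Proof. by case=> _ _ IM If; rewrite -mulN1r; apply: IM. Qed.

Lemma ideal_sub I f g : is_ideal I -> I f -> I g -> I (f - g).
Proof. by move=> II If Ig; case: (II) => _ ID _; apply: ID => //; apply: ideal_opp. Qed.

Lemma ideal_sum I (T : Type) (r : seq T) (P : pred T) (F : T -> S) : is_ideal I ->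
  (forall i, P i -> I (F i)) -> I (\sum_(i <- r | P i) F i).
Proof. by case=> I0 ID _ IF; elim/big_ind: _. Qed.

Lemma ideal_gen_ideal F : is_ideal (ideal_gen F).
Proof.
split.
- exists 0%N, (fun=> 0), (fun=> 0); split; first by case.
  by rewrite big_ord0.
- move=> f g [k1 [c1 [f1 [F1 ->]]]] [k2 [c2 [f2 [F2 ->]]]].
  exists (k1 + k2)%N, (fun i => match split i with inl j => c1 j | inr j => c2 j end),
    (fun i => match split i with inl j => f1 j | inr j => f2 j end); split.
    by move=> i; case: (split i).
  rewrite big_split_ord /=; congr (_ + _); apply: eq_bigr => i _.
    by rewrite -[lshift _ _]/(unsplit (inl i)) unsplitK.
  by rewrite -[rshift _ _]/(unsplit (inr i)) unsplitK.
- move=> c f [k1 [c1 [f1 [F1 ->]]]]; exists k1, (fun i => c * c1 i), f1; split=> //.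
  by rewrite mulr_sumr; apply: eq_bigr => i _; rewrite mulrA.
Qed.

Lemma ideal_gen_mem F f : F f -> ideal_gen F f.
Proof.
move=> Ff; exists 1%N, (fun=> 1), (fun=> f); split=> //.
by rewrite big_ord1 mul1r.
Qed.

Lemma ideal_gen_sub F I : is_ideal I -> F `<=` I -> ideal_gen F `<=` I.
Proof.
move=> II FI f [k [c [g [Fg ->]]]]; apply: ideal_sum => // i _.
by case: II => _ _; apply; apply: FI.
Qed.

Lemma ideal_genS F G : F `<=` G -> ideal_gen F `<=` ideal_gen G.
Proof.
move=> FG; apply: ideal_gen_sub; first exact: ideal_gen_ideal.
by move=> f /FG; apply: ideal_gen_mem.
Qed.

(** A multiple of [g] receives at [u] only contributions from coefficients of [g] at divisors of
    [u]. This turns restrictions on supports into obstructions to membership. *)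
Lemma ideal_gen_coeff0 F f u :
  (forall g q, F g -> (q <= u)%MM -> g@_q = 0) -> ideal_gen F f -> f@_u = 0.
Proof.
move=> h [k [c [g [Fg ->]]]]; rewrite raddf_sum big1 // => i _.
apply: mcoeffM_eq0 => p q uE _; apply: h => //.
by rewrite uE lem_addl.
Qed.

Lemma ideal_gen_monomial (M : set 'X_{1..m}) u :
  ideal_gen [set 'X_[K, v] | v in M] 'X_[u] -> exists2 v, M v & (v <= u)%MM.
Proof.
move=> h; apply: contrapT => no.
have /eqP : ('X_[K, u])@_u = 0.
  apply: (ideal_gen_coeff0 _ h) => _ q [v Mv <-] qu; rewrite mcoeffX.
  by case: eqP => // vq; case: no; exists v => //; rewrite vq.
by rewrite mcoeffX eqxx oner_eq0.
Qed.

End IdealGen.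

Section Fibered.
Variables (K : fieldType) (m : nat) (T : Type).
Local Notation S := {mpoly K[m]}.
Implicit Types (f g c : S) (u v w p q : 'X_{1..m}).

(* A toric ideal [I] whose grading by the affine semigroup is [phi]. Its
   elements have coefficient sum zero on each fiber of [phi]; [fib_supp] is the
   only consequence of this that is ever needed. *)
Record fibered (phi : 'X_{1..m} -> T) (I : set S) : Prop := Fibered {
  fib_ideal : is_ideal I;
  fib_add : forall u v w, phi (u + w)%MM = phi (v + w)%MM <-> phi u = phi v;
  fib_deg : forall u v, phi u = phi v -> mdeg u = mdeg v;
  fib_le1 : forall u v, phi u = phi v -> (mdeg u <= 1)%N -> u = v;
  fib_binom : forall u v, phi u = phi v -> I ('X_[u] - 'X_[v]);
  fib_supp : forall f u, I f -> f@_u != 0 ->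
    exists2 v, v != u & phi v = phi u /\ f@_v != 0 }.

Variables (phi : 'X_{1..m} -> T) (I : set S).
Hypothesis fibI : fibered phi I.

(** The coefficient at [u] is nonzero, so [fib_supp] supplies a second monomial of the fiber, and
    [v] is the only candidate. *)
Lemma fib_binomP u v : I ('X_[u] - 'X_[v]) -> phi u = phi v.
Proof.
have [->//|uv] := eqVneq u v.
move=> Iuv; have fu : ('X_[u] - 'X_[v] : S)@_u != 0.
  by rewrite mcoeff_binomial_l // oner_eq0.
have [w wu [<-]] := fib_supp fibI Iuv fu; rewrite mcoeff_binomial (eq_sym u) (negPf wu) sub0r
  oppr_eq0.
by case: (v =P w) => [->|]; rewrite ?eqxx.
Qed.

(* When the fiber of [u] consists of two coprime monomials, the fiber of a
   proper divisor of [u] is a singleton. *)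
Lemma two_fiber_coeff0 u v f p :
  (forall w, phi w = phi u -> w = u \/ w = v) ->
  (forall i, u i = 0%N \/ v i = 0%N) ->
  I f -> (p <= u)%MM -> p != u -> f@_p = 0.
Proof.
move=> fibu cop If pu neq; apply/eqP/negPn/negP => fp0.
have [q qp [pq _]] := fib_supp fibI If fp0.
have [r uE] := lem_exists pu.
have r0 : r != 0%MM by apply: contra_neq neq => r0; rewrite uE r0 add0m.
have [i ri] : exists i, r i != 0%N.
  apply: contrapT => no; case/eqP: r0; apply/mnmP => i; rewrite mnm0E.
  by apply/eqP/negPn/negP => ri; apply: no; exists i.
(* The companion [q] of [p], multiplied by the cofactor [r], lies in the fiber of [u]. If the
   product is [u], then [q = p]; if it is [v], then [u] and [v] share a variable of [r]. *)
have /fibu[E|E] : phi (q + r)%MM = phi u by rewrite uE (addmC r p); apply/(fib_add fibI).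
  by case/eqP: qp; apply: (@addIm _ r); rewrite E uE addmC.
case: (cop i); rewrite ?uE -?E mnmDE => /eqP; rewrite addn_eq0 (negPf ri) ?andbF //.
Qed.

Lemma fib_msize_gt1 u v : u != v -> phi u = phi v -> (1 < mdeg u)%N.
Proof.
move=> uv uvE; rewrite ltnNge; apply/negP => u1; case/eqP: uv.
exact: (fib_le1 fibI).
Qed.

(** Subtracting a multiple of ['X_[u] - 'X_[v]] with both monomials in the support of [f] removes
    [u] and creates no new monomial, so the support shrinks. Any [u] of the support would do; the
    leading one is merely at hand. *)
Lemma fib_gen B : B `<=` I ->
  (forall u v, phi u = phi v -> ideal_gen B ('X_[u] - 'X_[v])) -> ideal_gen B = I.
Proof.
move=> BI conn; have [_ ID IM] := fib_ideal fibI.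
have [_ GD GM] := ideal_gen_ideal B.
apply/seteqP; split=> [|f]; first exact: (ideal_gen_sub (fib_ideal fibI) BI).
have [k] := ubnP (size (msupp f)); elim: k f => // k IH f szf If.
have [->|f0] := eqVneq f 0; first by case: (ideal_gen_ideal B).
have fu : f@_(mlead f) != 0 by rewrite mleadc_eq0.
set u := mlead f in fu.
have [v vu [uv fv]] := fib_supp fibI If fu.
pose h : S := (f@_u)%:MP * ('X_[u] - 'X_[v]).
have -> : f = h + (f - h) by rewrite addrC subrK.
apply: GD; first by apply: GM; apply: conn.
have hE w : h@_w = f@_u * ((u == w)%:R - (v == w)%:R) by rewrite mcoeffCM mcoeff_binomial.
apply: IH; last first.
  by apply: (ideal_sub (fib_ideal fibI)) => //; apply: IM; apply: (fib_binom fibI).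
have sub : {subset msupp (f - h) <= rem u (msupp f)}.
  move=> w; rewrite mcoeff_msupp mcoeffB hE (rem_filter _ (msupp_uniq f)) mem_filter /=.
  have [->|wu] := eqVneq w u; first by rewrite (negPf vu) subr0 mulr1 subrr eqxx.
  rewrite /= mcoeff_msupp; apply: contra_neq => fw0.
  have -> : (v == w) = false by apply/negP => /eqP vw; rewrite vw fw0 eqxx in fv.
  by rewrite fw0 subr0 mulr0 subr0.
have uf : u \in msupp f by rewrite mcoeff_msupp.
apply: leq_ltn_trans (uniq_leq_size (msupp_uniq _) sub) _.
by rewrite size_rem // (leq_trans _ (szf : (_ <= k)%N)) // ltn_predL; case: (msupp f) uf.
Qed.

Lemma fib_binom_homog f : I f -> binomial_poly f ->
  exists u v, [/\ f = 'X_[u] - 'X_[v], u != v, phi u = phi v & tdeg f = mdeg u].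
Proof.
move=> If [u [v [uv fE]]]; have uvE : phi u = phi v by apply: fib_binomP; rewrite -fE.
exists u, v; split=> //; rewrite fE tdegX_sub //.
by rewrite -(fib_deg fibI uvE) maxnn.
Qed.

Lemma two_fiber_neq0 u v (B : seq S) : u != v -> phi u = phi v -> ideal_gen [set` B] = I ->
  exists2 b, b \in B & exists2 q, (q <= u)%MM & b@_q != 0.
Proof.
move=> uv uvE BI; apply: contrapT => no.
have : I ('X_[u] - 'X_[v]) by apply: (fib_binom fibI).
rewrite -BI => /(ideal_gen_coeff0 (u := u)) h.
have /eqP : ('X_[u] - 'X_[v] : S)@_u = 0.
  apply: h => g q /= gB qu; apply/eqP/negPn/negP => gq; apply: no.
  by exists g => //; exists q.
by rewrite mcoeff_binomial_l // oner_eq0.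
Qed.

End Fibered.

(** * Minimal binomial generators *)

Section MinimalGenerators.
Variables (K : fieldType) (m : nat).
Local Notation S := {mpoly K[m]}.
Implicit Types (I : set S) (B : seq S) (f g c : S).

(** A generating sublist of least length is taken. If a generating [B'] inside it missed [b],
    deleting all copies of [b] would leave a shorter list that still contains [B']. *)
Lemma min_binomial_gens_exists I B0 :
  (forall f, f \in B0 -> binomial_poly f) -> ideal_gen [set` B0] = I ->
  exists2 B, min_binomial_gens I B & {subset B <= B0}.
Proof.
move=> bin0 gen0.
pose P k := `[< exists B, [/\ {subset B <= B0}, ideal_gen [set` B] = I & size B = k] >].
have exP : exists k, P k by exists (size B0); apply/asboolP; exists B0; split.
case: (ex_minnP exP) => k /asboolP[B [BB0 Bgen szB]] kmin.
exists B => //; split=> //; first by move=> f /BB0; apply: bin0.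
move=> B' B'B B'gen b bB; apply/negPn/negP => bB'.
pose B1 := [seq x <- B | x != b].
suff /kmin : P (size B1).
  rewrite -szB size_filter leqNgt -(count_predC (fun x => x != b) B) -addn1 leq_add2l.
  by rewrite -has_count; case/negP; apply/hasP; exists b => //=; rewrite eqxx.
apply/asboolP; exists B1; split=> //; first by move=> x; rewrite mem_filter => /andP[_ /BB0].
apply/seteqP; split.
  rewrite -Bgen; apply: ideal_genS => x /=; rewrite mem_filter.
  by case/andP.
rewrite -B'gen; apply: ideal_genS => x /= xB'; rewrite mem_filter B'B // andbT.
by apply: contraNneq bB' => <-.
Qed.

(** Since [b] is homogeneous, each term of [c] contributes to the component either its whole product
    with [b] or nothing. *)
Lemma pihomog_ideal I c b d e : is_ideal I -> b \is e.-homog -> I b ->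
  I (pihomog mdeg d (c * b)).
Proof.
move=> II be Ib; rewrite [c]mpolyE mulr_suml raddf_sum.
apply: ideal_sum => // u _; rewrite /= -scalerAl linearZ /= -mul_mpolyC.
case: (II) => I0 _ IM; apply: (IM).
have hom : 'X_[u] * b \is (mdeg u + e).-homog by apply: dhomogM; rewrite ?dhomogX.
have [dE|dE] := eqVneq (mdeg u + e)%N d.
  by rewrite pihomog_dE -?dE //; apply: IM.
suff -> : pihomog mdeg d ('X_[u] * b) = 0 by [].
by rewrite (pihomog_ne0 _ hom) // eq_sym.
Qed.

(** An element of [B0] is written through [B] and projected to its own degree, which is at most [k];
    multiples of generators of degree above [k] vanish. So these generators are redundant in any
    homogeneous [B]. *)
Lemma gens_low_degree I B0 B k :
  (forall f, f \in B0 -> f \is (tdeg f).-homog /\ (tdeg f <= k)%N) ->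
  (forall f, f \in B -> f \is (tdeg f).-homog) ->
  ideal_gen [set` B0] = I -> ideal_gen [set` B] = I ->
  ideal_gen [set` [seq b <- B | (tdeg b <= k)%N]] = I.
Proof.
move=> hom0 hom gen0 gen; set B' := filter _ _.
have B'I : is_ideal (ideal_gen [set` B']) by apply: ideal_gen_ideal.
apply/seteqP; split.
  rewrite -gen; apply: ideal_genS => x /=; rewrite mem_filter.
  by case/andP.
rewrite -gen0; apply: ideal_gen_sub => // f /= fB0.
have [fh fk] := hom0 _ fB0.
have : ideal_gen [set` B] f by rewrite gen -gen0; apply: ideal_gen_mem.
case=> l [c [b [bB fE]]].
rewrite -(pihomog_dE fh) [f in pihomog _ _ f]fE raddf_sum; apply: ideal_sum => // i _.
have /= bi := bB i; have bh := hom _ bi.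
have [bk|bk] := leqP (tdeg (b i)) k.
  by apply: (pihomog_ideal _ _ _ bh) => //; apply: ideal_gen_mem => /=; rewrite mem_filter bk.
suff -> : pihomog mdeg (tdeg f) (c i * b i) = 0 by case: B'I.
apply/mpolyP => u; rewrite mcoeff0; apply/eqP/negPn/negP => u0.
have uh : u \in msupp (pihomog mdeg (tdeg f) (c i * b i)) by rewrite mcoeff_msupp.
have ud := dhomog_mf (pihomogP mdeg (tdeg f) (c i * b i)) uh.
move: u0; rewrite /pihomog raddf_sum /=.
case/eqP; apply: big1 => w /eqP wd; rewrite mcoeffZ mcoeffX.
have [wu|] := eqVneq w u; last by rewrite mulr0.
suff -> : (c i * b i)@_w = 0 by rewrite mul0r.
apply: mcoeffM_eq0 => p q pq _; apply/eqP; rewrite mcoeff_eq0; apply/negP => qb.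
have := dhomog_mf bh qb => qd; move: bk; rewrite ltnNge => /negP; apply.
by rewrite (leq_trans _ fk) // -wd pq mdegD -qd leq_addl.
Qed.

End MinimalGenerators.

Section FiberedMu.
Variables (K : fieldType) (m : nat) (T : Type).
Local Notation S := {mpoly K[m]}.
Variables (phi : 'X_{1..m} -> T) (I : set S).
Hypothesis fibI : fibered phi I.
Implicit Types (B : seq S) (u v p q : 'X_{1..m}).

Lemma fib_gens_homog B f : (forall f, f \in B -> binomial_poly f) ->
  [set` B] `<=` I -> f \in B -> f \is (tdeg f).-homog.
Proof.
move=> bin BI fB; have [u [v [-> uv uvE ->]]] := fib_binom_homog fibI (BI _ fB) (bin _ fB).
by apply: rpredB; rewrite dhomogX // (fib_deg fibI uvE).
Qed.

(** By [gens_low_degree] a single generating set [B0] bounds the degrees in all minimal ones, which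
    is why the maximum does not depend on the choice. The guard [0 < k] is needed because for
    [k = 0] there may be no generator at all. *)
Lemma mu_isP B0 k : (forall f, f \in B0 -> binomial_poly f /\ (tdeg f <= k)%N) ->
  ideal_gen [set` B0] = I ->
  (forall B, ideal_gen [set` B] = I -> (0 < k)%N -> exists2 b, b \in B & (k <= tdeg b)%N) ->
  mu_is I k.
Proof.
move=> bin0 gen0 low; split.
  have [B mB _] := min_binomial_gens_exists (fun f fB => (bin0 f fB).1) gen0.
  by exists B.
move=> B [bin gen Bmin]; apply/eqP; rewrite eqn_leq; apply/andP; split.
  have homB f : f \in B -> f \is (tdeg f).-homog.
    by apply: fib_gens_homog bin _ => x Bx; rewrite -gen; apply: ideal_gen_mem.
  have hom0 f : f \in B0 -> f \is (tdeg f).-homog /\ (tdeg f <= k)%N.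
    move=> fB; split; last by case: (bin0 f fB).
    apply: fib_gens_homog fB => [g /bin0[]//|].
    by move=> x Bx; rewrite -gen0; apply: ideal_gen_mem.
  have gen' := gens_low_degree hom0 homB gen0 gen.
  rewrite (big_nth 0) big_mkord; apply/bigmax_leqP => i _.
  have : B`_i \in B by rewrite mem_nth.
  move/(Bmin _ _ gen'); rewrite mem_filter => h.
  by case/andP: (h (fun x xf => mem_subseq (filter_subseq _ _) xf)).
case: k {bin0 gen0} low => // k /(_ B gen isT)[b bB kb].
by rewrite (leq_trans kb) // (big_rem b) //= leq_maxl.
Qed.

Lemma mu_is_unique J d d' : mu_is (m := m) (K := K) J d -> mu_is J d' -> d = d'.
Proof. by case=> [[B mB] E] [_ E']; rewrite -(E _ mB) -(E' _ mB). Qed.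

Variables (u v : 'X_{1..m}).
Hypothesis uv : u != v.
Hypothesis uvE : phi u = phi v.
Hypothesis fibu : forall w, phi w = phi u -> w = u \/ w = v.
Hypothesis cop : forall i, u i = 0%N \/ v i = 0%N.

Lemma two_fiber_mu_ge B : ideal_gen [set` B] = I -> exists2 b, b \in B & (mdeg u <= tdeg b)%N.
Proof.
move=> gen; have [b bB [q qu bq]] := two_fiber_neq0 fibI uv uvE gen.
exists b => //; have Ib : I b by rewrite -gen; apply: ideal_gen_mem.
have [E|neq] := eqVneq q u; first by rewrite -E mdeg_le_tdeg.
by case/eqP: bq; apply: (two_fiber_coeff0 fibI fibu cop).
Qed.

Lemma two_fiber_not_quadratic : (2 < mdeg u)%N -> ~ gen_by_quadratic_binomials I.
Proof.
move=> u2 [B [bin gen]]; have [b bB] := two_fiber_mu_ge gen.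
by case: (bin b bB) => _ ->; rewrite leqNgt u2.
Qed.

Lemma two_fiber_not_lead f p : I f -> (p <= u)%MM \/ (p <= v)%MM -> f@_p != 0 ->
  (mdeg u <= mdeg p)%N.
Proof.
move=> If [] le fp.
  have [->//|neq] := eqVneq p u.
  by case/eqP: fp; apply: (two_fiber_coeff0 fibI fibu cop).
have [->|neq] := eqVneq p v; first by rewrite (fib_deg fibI uvE).
have fibv w : phi w = phi v -> w = v \/ w = u by rewrite -uvE => /fibu[]; tauto.
case/eqP: fp; apply: (two_fiber_coeff0 fibI fibv) => // i.
by case: (cop i); tauto.
Qed.

Lemma two_fiber_not_gb : (2 < mdeg u)%N -> ~ has_quadratic_groebner_basis I.
Proof.
move=> u2 [le [B [[letot leanti letr _ _] [BI inE] B2]]].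
(* The order [le] is arbitrary, so either of the two monomials may lead; the remaining argument is
   symmetric in them. *)
have [w wuv lw] : exists2 w, w = u \/ w = v & lead_monomial le ('X_[u] - 'X_[v] : S) w.
  have supp w : w \in msupp ('X_[u] - 'X_[v] : S) = (w == u) || (w == v).
    rewrite mcoeff_msupp mcoeff_binomial !(eq_sym _ w).
    have [->|] := eqVneq w u; first by rewrite (negPf uv) subr0 oner_eq0.
    by have [] := eqVneq w v; rewrite ?sub0r ?oppr_eq0 ?oner_eq0 ?subrr ?eqxx.
  have lerefl w : le w w by have := letot w w; rewrite orbb.
  case/orP: (letot u v) => luv.
    exists v; first by right.
    by split=> [|x]; rewrite supp ?eqxx ?orbT // => /orP[]/eqP->.
  exists u; first by left.
  by split=> [|x]; rewrite supp ?eqxx // => /orP[]/eqP->.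
have : initial_ideal le I 'X_[w].
  apply: ideal_gen_mem; exists w => //=; exists ('X_[u] - 'X_[v]) => //.
  exact: (fib_binom fibI).
rewrite -inE => /ideal_gen_monomial[p /= [g gB [gp _]]] pw.
rewrite mcoeff_msupp in gp.
have : (mdeg u <= mdeg p)%N.
  apply: (two_fiber_not_lead (BI _ gB)) => //.
  by case: wuv pw => ->; tauto.
by have := mdeg_le_tdeg gp; rewrite (B2 _ gB) => p2 /leq_trans/(_ p2); rewrite leqNgt u2.
Qed.

End FiberedMu.

(** * Linear resolutions from quadratic Groebner bases *)

Section GroebnerSyzygies.
Variables (K : fieldType) (m : nat).
Local Notation S := {mpoly K[m]}.
Variables (I : set S) (bad : rel 'I_m) (rk0 : 'X_{1..m} -> nat).
Implicit Types (u v w : 'X_{1..m}) (f : S).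

Definition std_monomial w : bool :=
  [forall g, forall h, bad g h ==> ~~ (U_(g) + U_(h) <= w)%MM].

Hypothesis idI : is_ideal I.
Hypothesis I_const : forall f, I f -> f@_0%MM = 0.
Hypothesis bad_straight : forall g h, bad g h -> exists q,
  [/\ (rk0 q < rk0 (U_(g) + U_(h))%MM)%N, mdeg q = 2%N & I ('X_[U_(g) + U_(h)] - 'X_[q])].
Hypothesis lead_not_std : forall f w, I f -> f@_w != 0 ->
  (forall u, f@_u != 0 -> (rk0 u <= rk0 w)%N) -> ~~ std_monomial w.
Hypothesis bad_sym : forall g h, bad g h = bad h g.
Hypothesis rk0_inj : injective rk0.
Hypothesis rk0_add : forall w u v, (rk0 u < rk0 v)%N -> (rk0 (w + u)%MM < rk0 (w + v)%MM)%N.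

Definition vec_in p (x : 'rV[S]_p) : Prop := forall s, I (x 0 s).

Lemma vec_in0 p : vec_in (0 : 'rV[S]_p).
Proof. by move=> s; rewrite mxE; case: idI. Qed.

Lemma vec_inD p (x y : 'rV[S]_p) : vec_in x -> vec_in y -> vec_in (x + y).
Proof. by move=> Ix Iy s; rewrite mxE; case: idI => _ ID _; apply: ID. Qed.

Lemma vec_inZ p c (x : 'rV[S]_p) : vec_in x -> vec_in (c *: x).
Proof. by move=> Ix s; rewrite mxE; case: idI => _ _ IM; apply: IM. Qed.

Lemma vec_inM p q (x : 'rV[S]_p) (A : 'M[S]_(p, q)) : vec_in x -> vec_in (x *m A).
Proof.
move=> Ix s; rewrite mxE; apply: ideal_sum => // i _.
by rewrite mulrC; case: idI => _ _ IM; apply: IM.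
Qed.

(* A Groebner basis of the submodule [U] of the free module of rank [p] for the
   module order given by [rk]: besides the elements of [I], one element with
   leading term [X_g e_s] and linear entries for each [g] in [E s]. *)
Record linear_groebner p (U : 'rV[S]_p -> Prop) (rk : 'X_{1..m} -> 'I_p -> nat)
    (E : 'I_p -> {set 'I_m}) : Prop := LinearGroebner {
  lgD : forall x y, U x -> U y -> U (x + y);
  lgZ : forall c x, U x -> U (c *: x);
  lgI : forall x, vec_in x -> U x;
  lg_gen : forall s g, g \in E s -> exists2 x : 'rV[S]_p, U x &
    (x 0 s)@_(U_(g)%MM) = 1 /\ forall w t, (x 0 t)@_w != 0 ->
    mdeg w = 1%N /\ ((w, t) = (U_(g)%MM, s) \/ (rk w t < rk U_(g)%MM s)%N);
  lg_std : forall x, U x -> (forall w t, (x 0 t)@_w != 0 ->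
    std_monomial w /\ forall g, g \in E t -> w g = 0%N) -> x = 0;
  lg_inj : forall u v s t, rk u s = rk v t -> u = v /\ s = t;
  lg_add : forall u v w s t, (rk u s < rk v t)%N -> (rk (w + u)%MM s < rk (w + v)%MM t)%N;
  lg_rk0 : forall u v s, (rk0 u < rk0 v)%N -> (rk u s < rk v s)%N }.

Lemma mcoeffZX_neq0 (a : K) w f v : ((a *: 'X_[w]) * f)@_v != 0 ->
  exists2 u, v = (w + u)%MM & f@_u != 0.
Proof.
case/mcoeffM_neq0 => p [q [-> h fq]]; exists q => //; congr (_ + _)%MM.
by move: h; rewrite mcoeffZ mcoeffX; case: (w =P p) => [->|_] //; rewrite mulr0 eqxx.
Qed.

Lemma mcoeffZXM (a : K) w f u : ((a *: 'X_[w]) * f)@_(w + u)%MM = a * f@_u.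
Proof. by rewrite -scalerAl mcoeffZ (mulrC 'X_[w]) mcoeffMX. Qed.

Lemma delta_entry p (z : S) (s t : 'I_p) : (z *: delta_mx 0 s : 'rV[S]_p) 0 t = if t == s then
  z else 0.
Proof. by rewrite !mxE eqxx /=; case: eqP; rewrite ?mulr1 ?mulr0. Qed.

Section Division.
Variables (p : nat) (U : 'rV[S]_p -> Prop) (rk : 'X_{1..m} -> 'I_p -> nat).
Variable E : 'I_p -> {set 'I_m}.
Hypothesis lgU : linear_groebner U rk E.
Variables (p' : nat) (row_of : 'I_p' -> 'I_p) (var_of : 'I_p' -> 'I_m) (D : 'M[S]_(p', p)).
Hypothesis index_onto : forall s g, g \in E s -> exists i, row_of i = s /\ var_of i = g.
Hypothesis D_lead : forall i, (D i (row_of i))@_(U_(var_of i)%MM) = 1.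
Hypothesis D_terms : forall i w t, (D i t)@_w != 0 -> mdeg w = 1%N /\
  ((w, t) = (U_(var_of i)%MM, row_of i) \/ (rk w t < rk U_(var_of i)%MM (row_of i))%N).

Definition std_vec (x : 'rV[S]_p) : Prop := forall w t, (x 0 t)@_w != 0 ->
  std_monomial w /\ forall g, g \in E t -> w g = 0%N.

(** [Q] controls degrees: [predT] imposes nothing, while [pred1 2] forces the quotient to be linear.
    The successor accounts for the linear entries of the rows of [D]. *)
Definition quotient_below (N : nat) (Q : pred nat) (c : 'rV[S]_p') : Prop :=
  forall w i, (c 0 i)@_w != 0 ->
    (rk (w + U_(var_of i))%MM (row_of i) < N)%N /\ Q (mdeg w).+1.

(** A nonstandard term is lowered by a binomial of [I]; a term divisible by a leading variable of
    its component is cancelled by a multiple of a row of [D]; any other term goes to the remainder.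
    In each case [x] collects the term and the lower ones produced by cancelling it. *)
Lemma divide_term w s (a : K) : exists x c r,
  [/\ vec_in (x - c *m D - r), std_vec r,
      quotient_below (rk w s).+1 (pred1 (mdeg w)) c,
      (x 0 s)@_w = a & forall v t, (x 0 t)@_v != 0 -> mdeg v = mdeg w /\
        ((v, t) = (w, s) \/ (rk v t < rk w s)%N)].
Proof.
have below0 N Q : quotient_below N Q 0 by move=> v i; rewrite mxE mcoeff0 eqxx.
have std0 : std_vec 0 by move=> v i; rewrite mxE mcoeff0 eqxx.
have [stdw|] := boolP (std_monomial w); last first.
  rewrite negb_forall => /existsP[g]; rewrite negb_forall => /existsP[h].
  rewrite negb_imply negbK => /andP[gh /lem_exists[w0 wE]].
  have [q [rq dq Iq]] := bad_straight gh.
  have rqw : (rk0 (w0 + q)%MM < rk0 w)%N by rewrite wE rk0_add.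
  have wq : (w0 + q == w)%MM = false by apply/eqP => E'; rewrite E' ltnn in rqw.
  pose x : 'rV[S]_p := (a *: ('X_[w] - 'X_[w0 + q])) *: delta_mx 0 s.
  exists x, 0, 0; split=> //.
  - rewrite mul0mx !subr0 => t; rewrite delta_entry.
    case: idI => I0 _ IM; case: eqP => // _.
    rewrite -mul_mpolyC wE !mpolyXD -mulrBr; do 2 apply: (IM).
    by rewrite -mpolyXD.
  - by rewrite delta_entry eqxx mcoeffZ mcoeff_binomial eqxx wq subr0 mulr1.
  - move=> v t; rewrite delta_entry; case: (t =P s) => [->|]; last by rewrite mcoeff0 eqxx.
    rewrite mcoeffZ mcoeff_binomial; case: (eqVneq w v) => [<-|_]; first by split=> //; left.
    case: (w0 + q =P v)%MM => [<-|_]; last by rewrite subrr mulr0 eqxx.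
    move=> _; split; first by rewrite wE !mdegD dq !mdeg1.
    by right; apply: (lg_rk0 lgU).
have [/existsP[g /andP[gE wg]]|no] := boolP [exists g, (g \in E s) && (w g != 0%N)].
  have [w0 wE] : exists w0, w = (w0 + U_(g))%MM by apply: lem_exists; rewrite lep1mP.
  have [i [is_ ig]] := index_onto gE.
  exists ((a *: 'X_[w0]) *: row i D), ((a *: 'X_[w0]) *: delta_mx 0 i), 0; split=> //.
  - by rewrite -scalemxAl -rowE subrr subr0; apply: vec_in0.
  - move=> v j; rewrite delta_entry; case: (j =P i) => [->|]; last by rewrite mcoeff0 eqxx.
    rewrite mcoeffZ mcoeffX; case: (w0 =P v) => [<- _|]; last by rewrite mulr0 eqxx.
    by rewrite is_ ig -wE ltnSn /= wE mdegD mdeg1 addn1.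
  - by rewrite !mxE wE mcoeffZXM -is_ -ig D_lead mulr1.
  - move=> v t; rewrite !mxE => /mcoeffZX_neq0[u -> /D_terms[du ut]].
    rewrite wE !mdegD du mdeg1; split=> //; case: ut => [[-> ->]|]; rewrite is_ ig.
      by left.
    by right; apply: (lg_add lgU).
have rE : forall g, g \in E s -> w g = 0%N.
  move=> g gE; apply/eqP/negPn/negP => wg.
  by case/negP: no; apply/existsP; exists g; rewrite gE.
have terms v t : (((a *: 'X_[w]) *: delta_mx 0 s : 'rV[S]_p) 0 t)@_v != 0 -> v = w /\ t = s.
  rewrite delta_entry; case: (t =P s) => [->|]; last by rewrite mcoeff0 eqxx.
  by rewrite mcoeffZ mcoeffX; case: (w =P v) => [<-|]; rewrite ?mulr0 ?eqxx.
exists ((a *: 'X_[w]) *: delta_mx 0 s), 0, ((a *: 'X_[w]) *: delta_mx 0 s); split=> //.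
- by rewrite mul0mx subr0 subrr; apply: vec_in0.
- by move=> v t /terms[-> ->].
- by rewrite delta_entry eqxx mcoeffZ mcoeffX eqxx mulr1.
- by move=> v t /terms[-> ->]; split=> //; left.
Qed.

Lemma quotient_belowD N Q c c' :
  quotient_below N Q c -> quotient_below N Q c' -> quotient_below N Q (c + c').
Proof.
move=> bc bc' w i; rewrite mxE mcoeffD.
have [->|/bc //] := eqVneq (c 0 i)@_w 0.
by rewrite add0r => /bc'.
Qed.

Lemma divide N (Q : pred nat) (x : 'rV[S]_p) :
  (forall w s, (x 0 s)@_w != 0 -> (rk w s < N)%N /\ Q (mdeg w)) ->
  exists c r, [/\ vec_in (x - c *m D - r), std_vec r & quotient_below N Q c].
Proof.
have sub N1 N2 (c : 'rV[S]_p') : (N1 <= N2)%N -> quotient_below N1 Q c -> quotient_below N2 Q c.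
  by move=> N12 h w i /h[h1 h2]; split=> //; apply: leq_trans h1 _.
elim: N x => [|N IH] x xN.
  exists 0, 0; split=> [|w t|w t]; rewrite ?mxE ?mcoeff0 ?eqxx //.
  rewrite mul0mx !subr0 => s; suff -> : x 0 s = 0 by case: idI.
  by apply/mpolyP => w; rewrite mcoeff0; apply/eqP/negPn/negP => /xN[].
have [[w [s [xws rws]]]|no] := pselect (exists w s, (x 0 s)@_w != 0 /\ rk w s = N); last first.
  have [|c [r [h1 h2 h3]]] := IH x.
    move=> w s xws; have [h ?] := xN _ _ xws; split=> //.
    rewrite ltn_neqAle -ltnS h andbT; apply/eqP => E'.
    by apply: no; exists w, s.
  by exists c, r; split=> //; apply: sub h3.
have [x0 [c0 [r0 [h1 h2 h3 x0w x0t]]]] := divide_term w s (x 0 s)@_w.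
have Qw := (xN _ _ xws).2.
have [|c [r [k1 k2 k3]]] := IH (x - x0).
  move=> v t; rewrite !mxE mcoeffB => vt.
  have neq : (v, t) <> (w, s) by case=> E1 E2; case/eqP: vt; rewrite E1 E2 x0w subrr.
  have [xE|] := eqVneq (x0 0 t)@_v 0.
    move: vt; rewrite xE subr0 => /xN[h ?]; split=> //.
    rewrite ltn_neqAle -ltnS h andbT; apply/eqP => E'; apply: neq.
    by have [-> ->] : v = w /\ t = s by apply: (lg_inj lgU); rewrite rws.
  by move=> /x0t[-> []] => [/neq|]; rewrite -?rws.
exists (c0 + c), (r0 + r); split.
- have -> : x - (c0 + c) *m D - (r0 + r) = (x0 - c0 *m D - r0) + (x - x0 - c *m D - r).
    by rewrite mulmxDl; apply/rowP => t; rewrite !mxE; ring.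
  exact: vec_inD.
- move=> v t; rewrite mxE mcoeffD; have [->|/h2 //] := eqVneq (r0 0 t)@_v 0.
  by rewrite add0r => /k2.
- apply: quotient_belowD; last exact: sub k3.
  move=> v i /h3[]; rewrite rws => ? /= /eqP ->; split=> //.
Qed.

End Division.

(** A bad pair dividing the product but not [w] must involve [g], and then its other member divides
    [w] or is [g] itself; [wbad] excludes both. *)
Lemma std_monomial_addU w g : std_monomial w ->
  (forall h, bad h g -> w h = 0%N) -> std_monomial (w + U_(g))%MM.
Proof.
move=> stdw wbad; apply/forallP => a; apply/forallP => b; apply/implyP => ab.
apply/negP => /mnm_lepP le.
have [ag|ag] := eqVneq a g.
  have wb : w b = 0%N by apply: wbad; rewrite bad_sym -ag.
  have := le b; rewrite !mnmDE !mnm1E wb eqxx ag add0n.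
  by have [gb|] := eqVneq g b; rewrite ?addn0 // -gb.
have [bg|bg] := eqVneq b g.
  have wa : w a = 0%N by apply: wbad; rewrite -bg.
  by have := le a; rewrite !mnmDE !mnm1E wa eqxx add0n (eq_sym g) (negPf ag).
move/forallP: stdw => /(_ a)/forallP/(_ b)/implyP/(_ ab)/negP; apply.
apply/mnm_lepP => k; have := le k; rewrite !mnmDE !mnm1E.
have [<-|] := eqVneq g k; last by rewrite addn0.
by rewrite (negPf ag) (negPf bg).
Qed.

Lemma vec_max p (x : 'rV[S]_p) (r : 'X_{1..m} -> 'I_p -> nat) : x <> 0 ->
  exists w i, (x 0 i)@_w != 0 /\ forall v j, (x 0 j)@_v != 0 -> (r v j <= r w i)%N.
Proof.
move=> x0.
pose P k := `[< exists w i, (x 0 i)@_w != 0 /\ r w i = k >].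
have exP : exists k, P k.
  apply: contrapT => no; apply: x0; apply/rowP => i; apply/mpolyP => w.
  rewrite mxE mcoeff0; apply/eqP/negPn/negP => xwi; apply: no.
  by exists (r w i); apply/asboolP; exists w, i.
pose N := (\max_(i < p) \max_(w <- msupp (x 0%R i)) r w i)%N.
have PN k : P k -> (k <= N)%N.
  case/asboolP => w [i [xwi <-]]; rewrite /N.
  rewrite (bigD1 i) //= leq_max; apply/orP; left.
  by rewrite -mcoeff_msupp in xwi; rewrite (big_rem w) //= leq_maxl.
case: (ex_maxnP exP PN) => k /asboolP[w [i [xwi <-]]] kmax.
exists w, i; split=> // v j xvj; apply: kmax.
by apply/asboolP; exists v, j.
Qed.

(* Schreyer's construction: the elements given by [lg_gen] generate [U] modulo
   [I], and their syzygies again have a linear Groebner basis. *)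
Lemma linear_groebner_next p (U : 'rV[S]_p -> Prop) rk E : linear_groebner U rk E ->
  exists p' (D : 'M[S]_(p', p)) (U' : 'rV[S]_p' -> Prop) rk' E',
  [/\ linear_groebner U' rk' E', forall i t, D i t \is 1.-homog,
      forall x, U x <-> exists c, vec_in (x - c *m D)
    & forall v : 'rV[S]_p', U' v <-> vec_in (v *m D)].
Proof.
move=> lgU.
pose idx := {x : 'I_p * 'I_m | x.2 \in E x.1}.
pose p' := #|{: idx}|.
pose row_of (i : 'I_p') := (val (enum_val i)).1.
pose var_of (i : 'I_p') := (val (enum_val i)).2.
have index_inj i j : row_of i = row_of j -> var_of i = var_of j -> i = j.
  rewrite /row_of /var_of => E1 E2; apply: enum_val_inj; apply: val_inj.
  by case: (val (enum_val i)) (val (enum_val j)) E1 E2 => [? ?] [? ?] /= -> ->.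
have index_onto s g : g \in E s -> exists i, row_of i = s /\ var_of i = g.
  move=> gE; exists (enum_rank (exist _ (s, g) gE : idx)).
  by rewrite /row_of /var_of enum_rankK.
have index_mem i : var_of i \in E (row_of i) by exact: (valP (enum_val i)).
have /choice[D0 D0P] i : exists x : 'rV[S]_p, U x /\
    ((x 0 (row_of i))@_(U_(var_of i)%MM) = 1 /\ forall w t, (x 0 t)@_w != 0 ->
    mdeg w = 1%N /\ ((w, t) = (U_(var_of i)%MM, row_of i) \/ (rk w t < rk U_(var_of i)%MM
      (row_of i))%N)).
  by have [x Ux h] := lg_gen lgU (index_mem i); exists x.
pose D := \matrix_(i < p') D0 i.
have rD i : row i D = D0 i by rewrite rowK.
have DE i t : D i t = D0 i 0 t by rewrite /D mxE.
have D_in i : U (row i D) by rewrite rD; case: (D0P i).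
have D_lead i : (D i (row_of i))@_(U_(var_of i)%MM) = 1 by rewrite DE; case: (D0P i) => _ [].
have D_terms i w t : (D i t)@_w != 0 -> mdeg w = 1%N /\
    ((w, t) = (U_(var_of i)%MM, row_of i) \/ (rk w t < rk U_(var_of i)%MM (row_of i))%N).
  by rewrite DE; case: (D0P i) => _ [_]; apply.
have U_comb (c : 'rV[S]_p') : U (c *m D).
  rewrite mulmx_sum_row; elim/big_ind: _ => //.
  - by apply: (lgI lgU); apply: vec_in0.
  - exact: (lgD lgU).
  - by move=> i _; apply: (lgZ lgU).
have U_sub x y : U x -> U y -> U (x - y).
  by move=> Ux Uy; apply: (lgD lgU) => //; rewrite -scaleN1r; apply: (lgZ lgU).
have divU N (Q : pred nat) (x : 'rV[S]_p) : U x ->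
    (forall w s, (x 0 s)@_w != 0 -> (rk w s < N)%N /\ Q (mdeg w)) ->
    exists2 c, vec_in (x - c *m D) & quotient_below rk row_of var_of N Q c.
  move=> Ux xN; have [c [r [h1 h2 h3]]] :=
    divide lgU index_onto D_lead D_terms xN.
  exists c => //; suff r0 : r = 0 by move: h1; rewrite r0 subr0.
  apply: (lg_std lgU) h2; have -> : r = (x - c *m D) - (x - c *m D - r) by rewrite subKr.
  by apply: (U_sub); [apply: U_sub => //| apply: (lgI lgU)].
pose U' (v : 'rV[S]_p') := vec_in (v *m D).
(* Schreyer's order: the leading term of ['X_w] times row [i] is compared first. The factor [m]
   leaves room for the tie-break [var_of i], which is smaller than [m]. *)
pose rk' w i := (rk (w + U_(var_of i))%MM (row_of i) * m + var_of i)%N.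
(* The two sources of syzygies led by basis vector [i]: another leading variable of the same
   component, with the smaller index so that the tie-break makes [i] lead, and a variable forming a
   bad pair with [var_of i]. *)
pose E' i : {set 'I_m} := finset (fun g : 'I_m =>
  (g \in E (row_of i)) && (g < var_of i)%N || bad g (var_of i)).
have rk'_lt u v i j : (rk (u + U_(var_of i))%MM (row_of i) < rk (v + U_(var_of j))%MM (row_of
  j))%N ->
    (rk' u i < rk' v j)%N.
  move=> h; rewrite /rk'; apply: (@leq_trans ((rk (u + U_(var_of i))%MM (row_of i)).+1 * m)%N).
    by rewrite mulSn addnC ltn_add2r.
  by rewrite (leq_trans _ (leq_addr _ _)) // leq_mul2r h orbT.
have rk'_cases u v i j : (rk' u i <= rk' v j)%N ->
    (rk (u + U_(var_of i))%MM (row_of i) < rk (v + U_(var_of j))%MM (row_of j))%N \/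
    [/\ (u + U_(var_of i))%MM = (v + U_(var_of j))%MM, row_of i = row_of j & (var_of i <=
      var_of j)%N].
  move=> h; have [|/rk'_lt|E0] := ltngtP; first by left.
    by rewrite ltnNge h.
  right; have [E1 E2] := lg_inj lgU E0; split=> //.
  by move: h; rewrite /rk' E0 leq_add2l.
exists p', D, U', rk', E'; split=> //; last first.
- move=> x; split=> [Ux|[c /(lgI lgU) h]]; last first.
    by rewrite -(subrK (c *m D) x); apply: (lgD lgU).
  pose N := (\max_(s < p) \max_(w <- msupp (x 0%R s)) (rk w s).+1)%N.
  have [|c h _] := divU N predT x Ux; last by exists c.
  move=> w s ws; split=> //; rewrite /N.
  rewrite (bigD1 s) //= leq_max; apply/orP; left.
  by rewrite -mcoeff_msupp in ws; rewrite (big_rem w) //= leq_maxl.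
- by move=> i t; apply/dhomogP => w; rewrite mcoeff_msupp => /D_terms[].
split.
- by move=> x y; rewrite /U' mulmxDl; apply: vec_inD.
- by move=> c x; rewrite /U' -scalemxAl; apply: vec_inZ.
- by move=> x; apply: vec_inM.
- move=> i h; rewrite inE.
  set s := row_of i; set g := var_of i; set N := rk (U_(h) + U_(g))%MM s.
  (* Both sources produce a candidate [z] whose image is, modulo [I], a quadratic [y] of rank below
     [N]. Dividing [y] gives a linear correction of smaller rank, and subtracting it from [z] gives
     the required syzygy. *)
  have finish (z : 'rV[S]_p') (y : 'rV[S]_p) : vec_in (z *m D - y) ->
      (z 0 i)@_(U_(h)%MM) = 1 ->
      (forall w j, (z 0 j)@_w != 0 -> mdeg w = 1%N /\
        ((w, j) = (U_(h)%MM, i) \/ (rk' w j < rk' U_(h)%MM i)%N)) ->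
      (forall w t, (y 0 t)@_w != 0 -> (rk w t < N)%N /\ mdeg w == 2%N) ->
      exists2 x, U' x & (x 0 i)@_(U_(h)%MM) = 1 /\
      forall w t, (x 0 t)@_w != 0 -> mdeg w = 1%N /\
      ((w, t) = (U_(h)%MM, i) \/ (rk' w t < rk' U_(h)%MM i)%N).
    move=> zy z1 zt yt.
    have Uy : U y.
      have -> : y = z *m D - (z *m D - y) by rewrite subKr.
      by apply: U_sub => //; apply: (lgI lgU).
    have [c yc ct] := divU N (pred1 2%N) y Uy yt.
    have {}ct w j : (c 0 j)@_w != 0 -> mdeg w = 1%N /\ (rk' w j < rk' U_(h)%MM i)%N.
      by move=> /ct[lt0 /eqP[->]]; split=> //; apply: rk'_lt.
    exists (z - c); first last.
      split=> [|w t].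
        rewrite !mxE mcoeffB z1; have [->|/ct[_]] := eqVneq (c 0 i)@_(U_(h)%MM) 0.
          by rewrite subr0.
        by rewrite ltnn.
      rewrite !mxE mcoeffB; have [->|/ct[-> lt0] _] := eqVneq (c 0 t)@_w 0.
        by rewrite subr0 => /zt.
      by split=> //; right.
    rewrite /U' mulmxBl; have -> : z *m D - c *m D = (z *m D - y) + (y - c *m D).
      by rewrite addrA subrK.
    exact: vec_inD.
  have Xrow a j t : ('X_a *: row j D) 0 t = 'X_a * D j t by rewrite !mxE.
  have Xterms a j t w : ('X_a * D j t)@_w != 0 -> mdeg w = 2%N /\
      ((w, t) = (U_(a) + U_(var_of j), row_of j)%MM \/
       (rk w t < rk (U_(a) + U_(var_of j))%MM (row_of j))%N).
    rewrite -[X in X * _]scale1r => /mcoeffZX_neq0[u -> /D_terms[du ut]].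
    rewrite mdegD mdeg1 du; split=> //; case: ut => [[-> ->]|]; first by left.
    by right; apply: (lg_add lgU).
  have Xlead a j : ('X_a * D j (row_of j))@_(U_(a) + U_(var_of j))%MM = 1.
    by rewrite -[X in X * _]scale1r mcoeffZXM D_lead mulr1.
  case/orP => [/andP[hE hg]|hg].
    have [i2 [i2s i2h]] := index_onto _ _ hE.
    have ii2 : (i == i2) = false.
      by apply/eqP => E0; move: hg; rewrite -i2h -E0 ltnn.
    pose z : 'rV[S]_p' := 'X_h *: delta_mx 0 i - 'X_g *: delta_mx 0 i2.
    have zE j : z 0 j = (if j == i then 'X_h else 0) - (if j == i2 then 'X_g else 0).
      by rewrite -!delta_entry !mxE.
    have zD : z *m D = 'X_h *: row i D - 'X_g *: row i2 D.
      by rewrite mulmxBl -!scalemxAl -!rowE.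
    have L1 : ('X_h * D i s)@_(U_(h) + U_(g))%MM = 1 := Xlead h i.
    have L2 : ('X_g * D i2 s)@_(U_(h) + U_(g))%MM = 1.
      by rewrite addmC -i2h -i2s; apply: Xlead.
    apply: (finish z (z *m D)).
    - by rewrite subrr; apply: vec_in0.
    - by rewrite zE eqxx ii2 subr0 mcoeffX eqxx.
    - move=> w j; rewrite zE; have [->|ji] := eqVneq j i.
        rewrite ii2 subr0 mcoeffX; case: (_ =P w) => [<- _|]; last by rewrite eqxx.
        by rewrite mdeg1; split=> //; left.
      rewrite sub0r mcoeffN oppr_eq0; have [->|] := eqVneq j i2; last by rewrite mcoeff0 eqxx.
      rewrite mcoeffX; case: (_ =P w) => [<- _|]; last by rewrite eqxx.
      rewrite mdeg1; split=> //; right.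
      by rewrite /rk' i2s i2h addmC ltn_add2l.
    - move=> w t; have -> : (z *m D) 0 t = 'X_h * D i t - 'X_g * D i2 t by rewrite zD !mxE.
      rewrite mcoeffB.
      have [[-> ->]|neq] := pselect ((w, t) = (U_(h) + U_(g), s)%MM).
        by rewrite L1 L2 subrr eqxx.
      have [->|/Xterms[dw] + _] := eqVneq ('X_h * D i t)@_w 0.
        rewrite sub0r oppr_eq0 => /Xterms[dw]; rewrite i2s i2h addmC => -[/neq//|lt0].
        by rewrite dw.
      by case=> [/neq//|lt0]; rewrite dw.
  have [q [rq dq Iq]] := bad_straight hg.
  pose y : 'rV[S]_p := 'X_h *: row i D - ('X_[U_(h) + U_(g)] - 'X_[q]) *: delta_mx 0 s.
  apply: (finish ('X_h *: delta_mx 0 i) y).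
  - rewrite -scalemxAl -rowE /y subKr => t; rewrite delta_entry.
    by case: eqP => // _; case: idI.
  - by rewrite delta_entry eqxx mcoeffX eqxx.
  - move=> w j; rewrite delta_entry; case: (j =P i) => [->|]; last by rewrite mcoeff0 eqxx.
    rewrite mcoeffX; case: (_ =P w) => [<- _|]; last by rewrite eqxx.
    by rewrite mdeg1; split=> //; left.
  - have L1 : ('X_h * D i s)@_(U_(h) + U_(g))%MM = 1 := Xlead h i.
    have qhg : (q == U_(h) + U_(g))%MM = false by apply/eqP => E0; rewrite E0 ltnn in rq.
    move=> w t.
    have -> : y 0 t = 'X_h * D i t - (if t == s then 'X_[U_(h) + U_(g)] - 'X_[q] else 0).
      by rewrite -delta_entry !mxE.
    rewrite mcoeffB.
    have [[-> ->]|neq] := pselect ((w, t) = (U_(h) + U_(g), s)%MM).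
      by rewrite L1 eqxx mcoeff_binomial eqxx qhg subr0 subrr eqxx.
    have [->|/Xterms[dw] + _] := eqVneq ('X_h * D i t)@_w 0; last first.
      by case=> [/neq//|lt0]; rewrite dw.
    rewrite sub0r oppr_eq0; case: (t =P s) => [ts|]; last by rewrite mcoeff0 eqxx.
    rewrite mcoeff_binomial; case: (_ =P w) => [wE|_]; first by case: neq; rewrite -wE ts.
    case: (q =P w) => [<- _|]; last by rewrite subrr eqxx.
    by rewrite dq ts; split=> //; apply: (lg_rk0 lgU).
- move=> x Ux stdx; apply: contrapT => x0.
  pose r w i := rk (w + U_(var_of i))%MM (row_of i).
  (* Among the terms of [x], one is chosen whose product with its row has maximal leading term. It
     is the only one: of two competitors with different variables, the one with the larger variable
     would be divisible by the smaller, which lies in its [E']. So the product survives as leading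
     monomial of an entry in [I] although it is standard. *)
  have [w [i [xwi rmax]]] : exists w i, (x 0 i)@_w != 0 /\
      forall v j, (x 0 j)@_v != 0 -> (r v j <= r w i)%N by exact: vec_max.
  set s := row_of i; set g := var_of i.
  have [stdw wE] := stdx _ _ xwi.
  have stdwg : std_monomial (w + U_(g))%MM.
    by apply: std_monomial_addU => // h hg; apply: wE; rewrite inE hg orbT.
  have uniq v j : (x 0 j)@_v != 0 -> (v + U_(var_of j))%MM = (w + U_(g))%MM ->
      row_of j = s -> v = w /\ j = i.
    move=> xvj E1 E2; have [_ vE] := stdx _ _ xvj.
    have [lt0|lt0|E3] := ltngtP (var_of j) g.
    + have := congr1 (fun u : 'X_{1..m} => u (var_of j)) E1.
      rewrite !mnmDE !mnm1E eqxx wE; first by rewrite (gtn_eqF lt0 : (g == _) = false) addn1.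
      by rewrite inE lt0 -/s -E2 index_mem.
    + have := congr1 (fun u : 'X_{1..m} => u g) E1.
      rewrite !mnmDE !mnm1E eqxx vE; first by rewrite (gtn_eqF lt0 : (var_of j == _) = false) addn1.
      by rewrite inE lt0 E2 /s index_mem.
    have {}E3 : var_of j = g by apply: val_inj.
    by move: E1; rewrite E3 => /addIm ->; split=> //; apply: index_inj.
  have terms v j : (x 0 j * D j s)@_v != 0 -> exists p q, [/\ v = (p + q)%MM, (x 0 j)@_p != 0,
      (D j s)@_q != 0 & (q, s) = (U_(var_of j)%MM, row_of j) \/ (rk v s < r w i)%N].
    case/mcoeffM_neq0 => a [b [-> xa Db]]; exists a, b; split=> //.
    have [_ [|lt0]] := D_terms _ _ _ Db; first by left.
    by right; rewrite (leq_trans _ (rmax _ _ xa)) //; apply: (lg_add lgU).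
  suff : ~~ std_monomial (w + U_(g))%MM by rewrite stdwg.
  apply: (lead_not_std (Ux s)).
    rewrite mxE raddf_sum (bigD1 i) //= big1 ?addr0 => [|j ji]; last first.
      apply/eqP/negPn/negP => h; have [a [b [E1 xa Db]]] := terms _ _ h.
      case=> [[E2 E3]|]; last by rewrite ltnn.
      by case: (uniq a j xa); rewrite -?E2 ?E1 // => _ /eqP; rewrite (negPf ji).
    pose D' := D i s - 'X_g.
    have -> : D i s = 'X_g + D' by rewrite addrC subrK.
    rewrite mulrDr mcoeffD addmC mcoeffMX.
    suff -> : (x 0 i * D')@_(U_(g) + w)%MM = 0 by rewrite addr0.
    apply: mcoeffM_eq0 => a b E1 xa; rewrite mcoeffB mcoeffX.
    have [<-|neq] := eqVneq U_(g)%MM b; first by rewrite D_lead subrr.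
    rewrite subr0; apply/eqP/negPn/negP => Db.
    have [_ [/(congr1 fst)/= E2|lt0]] := D_terms _ _ _ Db; first by case/eqP: neq.
    have := rmax _ _ xa; rewrite leqNgt => /negP; apply.
    by rewrite /r addmC E1; apply: (lg_add lgU).
  move=> u; rewrite mxE raddf_sum /= => u0.
  have [j uj] : exists j, (x 0 j * D j s)@_u != 0.
    apply: contrapT => no; case/eqP: u0; apply: big1 => j _.
    by apply/eqP/negPn/negP => h; apply: no; exists j.
  have [a [b [E1 xa Db h]]] := terms _ _ uj.
  rewrite leqNgt; apply/negP => /(lg_rk0 lgU s).
  case: h => [[E2 E3]|lt0]; last by rewrite ltnNge (ltnW lt0).
  rewrite ltnNge => /negP; apply; rewrite E1 E2 {1}E3; exact: rmax.
- move=> u v i j E0; have := rk'_cases u v i j; rewrite E0 leqnn => /(_ isT).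
  have := rk'_cases v u j i; rewrite E0 leqnn => /(_ isT).
  case=> [lt1|[E1 E2 le1]] [lt2|[E3 E4 le2]].
  + by have := ltn_trans lt1 lt2; rewrite ltnn.
  + by move: lt1; rewrite E3 E4 ltnn.
  + by move: lt2; rewrite E1 E2 ltnn.
  have {}E3 : var_of i = var_of j by apply: val_inj; apply/eqP; rewrite eqn_leq le1 le2.
  by move: E1; rewrite E3 => /addIm ->; rewrite (index_inj i j).
- move=> u v w i j lt0; have := rk'_cases u v i j (ltnW lt0).
  case=> [lt1|[E1 E2 le1]].
    by apply: rk'_lt; rewrite -!addmA; apply: (lg_add lgU).
  by move: lt0; rewrite /rk' -!addmA E1 E2 !ltn_add2l.
- move=> u v i lt0; apply: rk'_lt; apply: (lg_rk0 lgU).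
  by rewrite ![(_ + U_(_))%MM]addmC; apply: rk0_add.
Qed.


(** Stage zero is the ideal of polynomials without constant term, a lift of the irrelevant ideal.
    Every variable leads, so a reduced element could only be a constant. *)
Lemma linear_groebner_base :
  linear_groebner (fun x : 'rV[S]_1 => (x 0 0)@_0%MM = 0) (fun u _ => rk0 u)
    (fun=> [set: 'I_m]%SET).
Proof.
split=> /=.
- by move=> x y x0 y0; rewrite mxE mcoeffD x0 y0 addr0.
- move=> c x x0; rewrite mxE; apply: mcoeffM_eq0 => p q /esym/eqP.
  by rewrite mnmD_eq0 => /andP[_ /eqP->].
- by move=> x /(_ 0)/I_const.
- move=> s g _; exists ('X_g *: delta_mx 0 0).
    by rewrite delta_entry eqxx mcoeffX mnm1_eq0.
  split; first by rewrite delta_entry !ord1 eqxx mcoeffX eqxx.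
  move=> w t; rewrite delta_entry !ord1 eqxx mcoeffX; case: (_ =P w) => [<- _|];
    last by rewrite eqxx.
  by rewrite mdeg1; split=> //; left.
- move=> x x0 stdx; apply/rowP => s; rewrite mxE ord1; apply/mpolyP => w.
  rewrite mcoeff0; apply/eqP/negPn/negP => xw; have [_ w0] := stdx _ _ xw.
  case/eqP: xw; suff -> : w = 0%MM by [].
  by apply/mnmP => i; rewrite mnm0E w0 // inE.
- by move=> u v s t /rk0_inj; rewrite !ord1.
- by move=> u v w s t; apply: rk0_add.
- by [].
Qed.

(** Rank, module, order and leading sets all change from one stage to the next; bundling them allows
    the resolution to be defined by recursion. *)
Record groebner_stage := GroebnerStage {
  stage_rank : nat;
  stage_mod : 'rV[S]_stage_rank -> Prop;
  stage_rk : 'X_{1..m} -> 'I_stage_rank -> nat;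
  stage_lead : 'I_stage_rank -> {set 'I_m};
  stageP : linear_groebner stage_mod stage_rk stage_lead }.

Lemma groebner_stage_next (st : groebner_stage) :
  {st' : groebner_stage & {D : 'M[S]_(stage_rank st', stage_rank st) |
    [/\ forall i t, D i t \is 1.-homog,
      forall x, stage_mod x <-> exists c, vec_in (x - c *m D)
    & forall v : 'rV_(stage_rank st'), stage_mod v <-> vec_in (v *m D)]}}.
Proof.
suff /cid[st' /cid[D h]] : exists st' (D : 'M[S]_(stage_rank st', stage_rank st)),
    [/\ forall i t, D i t \is 1.-homog,
      forall x, stage_mod x <-> exists c, vec_in (x - c *m D)
    & forall v : 'rV_(stage_rank st'), stage_mod v <-> vec_in (v *m D)].
  by exists st', D.
have [p' [D [U' [rk' [E' [lg' h1 h2 h3]]]]]] := linear_groebner_next (stageP st).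
by exists (GroebnerStage lg'), D.
Qed.

Fixpoint groebner_stages (k : nat) : groebner_stage :=
  if k is k'.+1 then projT1 (groebner_stage_next (groebner_stages k'))
  else GroebnerStage linear_groebner_base.

Definition stage_map k :
    'M[S]_(stage_rank (groebner_stages k.+1), stage_rank (groebner_stages k)) :=
  sval (projT2 (groebner_stage_next (groebner_stages k))).

Lemma stage_mapP k : [/\ forall i t, stage_map k i t \is 1.-homog,
    forall x, @stage_mod (groebner_stages k) x <-> exists c, vec_in (x - c *m stage_map k)
  & forall y, @stage_mod (groebner_stages k.+1) y <-> vec_in (y *m stage_map k)].
Proof. exact: (svalP (projT2 (groebner_stage_next (groebner_stages k)))). Qed.

Section Koszul.
Variables (A : comNzRingType) (psi : {rmorphism S -> A}).
Hypothesis kerI : forall f, I f <-> psi f = 0.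
Let R : set A := range psi.
Let R_ (d : nat) : set A := [set psi p | p in [set p | p \is d.-homog]].

Lemma irrelevant_lift (x : A) :
  irrelevant_ideal R_ x <-> exists2 f : S, f@_0%MM = 0 & psi f = x.
Proof.
split=> [[N [c [cR ->]]]|[f f0 <-]].
  have /choice[g gP] d : exists f : S, f \is d.-homog /\ psi f = c d.
    by have [f fd <-] := cR d; exists f.
  exists (\sum_(1 <= d < N) g d); last first.
    by rewrite rmorph_sum; apply: eq_bigr => d _; case: (gP d).
  rewrite raddf_sum big_nat big1 // => d /andP[d1 _].
  have [gd _] := gP d; apply: (dhomog_nemf_coeff gd).
  by rewrite -[X in X != _]/(mdeg _) mdeg0; case: d d1 {gd}.
exists (msize f), (fun d => psi (pihomog mdeg d f)); split.
  by move=> d; exists (pihomog mdeg d f) => //=; apply: pihomogP.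
rewrite -rmorph_sum; congr (psi _); have fE := pihomog_partitionE (leqnn (msize f)).
rewrite [LHS]fE {fE}.
have : pihomog mdeg 0 f = 0.
  rewrite pihomogE; apply: big1 => w; rewrite mdeg_eq0 => /eqP->.
  by rewrite f0 scale0r.
case: (msize f) => [|N] h; first by rewrite big_ord0 big_geq.
by rewrite big_ord_recl h add0r big_add1 /= big_mkord.
Qed.

Lemma koszul_of_groebner : koszul R R_.
Proof.
pose b i := stage_rank (groebner_stages i.+1).
(* The case distinction is for typing only: [res_rank b i] agrees with the rank of stage [i] by
   computation once [i] is a constructor. *)
pose D i : 'M[A]_(res_rank b i.+1, res_rank b i) :=
  match i return 'M[A]_(res_rank b i.+1, res_rank b i) with
  | 0%N => map_mx psi (stage_map 0)
  | j.+1 => map_mx psi (stage_map j.+1) end.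
have lift_vec k (v : 'rV[A]_k) : vec_over R v -> exists V : 'rV[S]_k, map_mx psi V = v.
  move=> vR; have /choice[g gP] j : exists f : S, psi f = v 0 j.
    by have [f _ <-] := vR j; exists f.
  by exists (\row_j g j); apply/rowP => j; rewrite !mxE gP.
have vecP k (V : 'rV[S]_k) : vec_in V <-> map_mx psi V = 0.
  split=> [IV|V0 s].
    by apply/rowP => j; rewrite !mxE; apply/kerI.
  by apply/kerI; have := congr1 (fun M : 'rV[A]_k => M 0 s) V0; rewrite !mxE.
have exact i (v : 'rV[A]_(stage_rank (groebner_stages i.+1))) : vec_over R v ->
    (v *m map_mx psi (stage_map i) = 0 <->
      exists2 w, vec_over R w & v = w *m map_mx psi (stage_map i.+1)).
  case: (stage_mapP i) => _ _ ker; case: (stage_mapP i.+1) => _ im _.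
  case/lift_vec => V <-; rewrite -map_mxM; split=> [/vecP/ker/im[c]|[w /lift_vec[c <-]]].
    move/vecP; rewrite map_mxB map_mxM => /subr0_eq ->; exists (map_mx psi c) => //.
    by move=> j; rewrite mxE; exists (c 0 j).
  rewrite -map_mxM => E; apply/vecP/ker/im; exists c; apply/vecP.
  by rewrite map_mxB E subrr.
exists b, D; split.
- have homR i r c : R_ 1%N ((map_mx psi (stage_map i)) r c).
    by case: (stage_mapP i) => h _ _; rewrite mxE; exists (stage_map i r c) => //=; apply: h.
  by case=> [|i]; apply: homR.
- move=> x; rewrite irrelevant_lift; case: (stage_mapP 0) => _ im _.
  split=> [[f f0 fx]|[w /lift_vec[c <-] ->]].
    have /im[c /vecP] : @stage_mod (groebner_stages 0) (const_mx f) by rewrite /= mxE.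
    rewrite map_mxB map_mxM => /subr0_eq E; exists (map_mx psi c).
      by move=> j; rewrite mxE; exists (c 0 j).
    by rewrite -E; apply/rowP => j; rewrite !mxE ord1 -fx.
  have h : @stage_mod (groebner_stages 0) (c *m stage_map 0).
    by apply/im; exists c; rewrite subrr; apply: vec_in0.
  exists ((c *m stage_map 0) 0 0); first exact: h.
  have -> : map_mx psi c *m D 0%N = map_mx psi (c *m stage_map 0) by rewrite map_mxM.
  by rewrite [RHS]mxE.
- by case=> [|i] v; apply: exact.
Qed.

End Koszul.
End GroebnerSyzygies.

(** * Fibers of bipartite edge rings *)

Section RevLex.
Variables (m : nat) (key : 'I_m -> nat).
Hypothesis key_inj : injective key.
Implicit Types (u v w : 'X_{1..m}).

(* The graded reverse lexicographic order in which variables with small keys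
   are small. *)
Definition revlex_lt u v : bool :=
  (mdeg u < mdeg v)%N || (mdeg u == mdeg v) &&
  [exists k, (v k < u k)%N && [forall j, (key j < key k)%N ==> (u j == v j)]].

Definition revlex_le u v : bool := (u == v) || revlex_lt u v.

Lemma revlex_ltP u v : reflect ((mdeg u < mdeg v)%N \/ mdeg u = mdeg v /\
  exists k, (v k < u k)%N /\ forall j, (key j < key k)%N -> u j = v j) (revlex_lt u v).
Proof.
apply: (iffP orP) => -[]; [by left| |by left|].
  case/andP => /eqP uv /existsP[k /andP[vuk /forallP h]]; right; split=> //.
  by exists k; split=> // j jk; apply/eqP; move/implyP: (h j); apply.
move=> [uv [k [vuk h]]]; right; rewrite uv eqxx; apply/existsP; exists k.
by rewrite vuk; apply/forallP => j; apply/implyP => /h/eqP.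
Qed.

Lemma revlex_ltnn u : revlex_lt u u = false.
Proof. by apply/revlex_ltP => -[|[_ [k []]]]; rewrite ltnn. Qed.

Lemma revlex_lt_trans u v w : revlex_lt u v -> revlex_lt v w -> revlex_lt u w.
Proof.
move=> /revlex_ltP[uv|[uv [k [ku kE]]]] /revlex_ltP[vw|[vw [l [lv lE]]]]; apply/revlex_ltP.
- by left; apply: ltn_trans uv vw.
- by left; rewrite -vw.
- by left; rewrite uv.
right; split; first by rewrite uv.
have [kl|lk|/key_inj kl] := ltngtP (key k) (key l).
- exists k; split=> [|j jk]; first by rewrite -(lE k kl).
  by rewrite (kE j jk) (lE j (ltn_trans jk kl)).
- exists l; split=> [|j jl]; first by rewrite (kE l lk).
  by rewrite (kE j (ltn_trans jl lk)) (lE j jl).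
- exists k; split=> [|j jk]; first by apply: ltn_trans ku; rewrite kl.
  by rewrite (kE j jk) lE // -kl.
Qed.

Lemma revlex_first_diff u v : u <> v ->
  exists k, u k <> v k /\ forall j, (key j < key k)%N -> u j = v j.
Proof.
move=> uv; have [k0 k0P] : exists k, u k != v k.
  by apply: contrapT => no; apply: uv; apply/mnmP => k; apply/eqP/negPn/negP => h; apply: no;
    exists k.
case: (@arg_minnP _ k0 (fun k => u k != v k) key k0P) => k /eqP uk kmin; exists k; split=> // j jk.
by apply/eqP/negPn/negP => /kmin; rewrite leqNgt jk.
Qed.

Lemma revlex_lt_total u v : u <> v -> revlex_lt u v || revlex_lt v u.
Proof.
move=> uv; have [lt0|lt0|uvd] := ltngtP (mdeg u) (mdeg v).
- by apply/orP; left; apply/revlex_ltP; left.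
- by apply/orP; right; apply/revlex_ltP; left.
have [k [uk kE]] := revlex_first_diff uv.
apply/orP; have [lt0|lt0|//] := ltngtP (u k) (v k).
  right; apply/revlex_ltP; right; split=> //; exists k; split=> // j jk.
  by rewrite kE.
by left; apply/revlex_ltP; right; split=> //; exists k.
Qed.

Lemma revlex_lt_add w u v : revlex_lt u v -> revlex_lt (w + u)%MM (w + v)%MM.
Proof.
case/revlex_ltP => [uv|[uv [k [vu kE]]]]; apply/revlex_ltP; rewrite !mdegD.
  by left; rewrite ltn_add2l.
right; rewrite uv; split=> //; exists k; rewrite !mnmDE ltn_add2l vu; split=> // j jk.
by rewrite !mnmDE kE.
Qed.

Lemma revlex_monomial_order : monomial_order revlex_le.
Proof.
split.
- move=> u v; rewrite /revlex_le; have [//|/eqP uv] := eqVneq u v.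
  by have := revlex_lt_total uv; rewrite /=; case/orP => ->; rewrite ?orbT.
- move=> u v /andP[/orP[/eqP//|uv] /orP[/eqP//|vu]].
  by have := revlex_lt_trans uv vu; rewrite revlex_ltnn.
- move=> v u w /orP[/eqP->//|uv] /orP[/eqP<-|vw]; apply/orP; right=> //.
  exact: revlex_lt_trans uv vw.
- move=> u; rewrite /revlex_le; have [->//|u0] := eqVneq 0%MM u.
  by apply/revlex_ltP; left; rewrite mdeg0 lt0n mdeg_eq0 eq_sym.
- move=> u v w /orP[/eqP->|uv]; first by rewrite /revlex_le eqxx.
  by apply/orP; right; rewrite ![(_ + w)%MM]addmC; apply: revlex_lt_add.
Qed.

(** The order is graded, so only finitely many monomials precede [u]. Counting them gives the
    numerical rank required of [rk0]. *)
Definition revlex_below u : seq 'X_{1..m} :=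
  [seq v <- map val (enum {: 'X_{1..m < (mdeg u).+1}}) | revlex_lt v u].

Definition revlex_rank u : nat := size (revlex_below u).

Lemma mem_revlex_below u v : (v \in revlex_below u) = revlex_lt v u.
Proof.
rewrite mem_filter; have [vu|//] := boolP (revlex_lt v u).
have vd : (mdeg v < (mdeg u).+1)%N.
  by rewrite ltnS; case/revlex_ltP: vu => [/ltnW|[->]].
by apply/mapP; exists (BMultinom vd) => //; rewrite mem_enum.
Qed.

Lemma revlex_rank_lt u v : revlex_lt u v -> (revlex_rank u < revlex_rank v)%N.
Proof.
move=> uv; have : uniq (u :: revlex_below u).
  rewrite /= mem_revlex_below revlex_ltnn filter_uniq //.
  by rewrite map_inj_uniq ?enum_uniq //; apply: val_inj.
move/uniq_leq_size; apply=> w; rewrite inE !mem_revlex_below => /orP[/eqP->//|wu].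
exact: revlex_lt_trans wu uv.
Qed.

Lemma revlex_rankP u v : (revlex_rank u < revlex_rank v)%N = revlex_lt u v.
Proof.
apply/idP/idP => [h|]; last exact: revlex_rank_lt.
have [uv|/eqP uv] := eqVneq u v; first by rewrite uv ltnn in h.
by case/orP: (revlex_lt_total uv) => // /revlex_rank_lt; rewrite ltnNge (ltnW h).
Qed.

Lemma revlex_rank_inj : injective revlex_rank.
Proof.
move=> u v E; apply: contrapT => /revlex_lt_total/orP[]/revlex_rank_lt; rewrite E ltnn //.
Qed.

End RevLex.

Section BipartiteFibers.
Variables (m : nat) (X Y : finType) (ro : 'I_m -> X) (co : 'I_m -> Y).
Hypothesis ends_inj : forall i j, ro i = ro j -> co i = co j -> i = j.
Implicit Types (u v w : 'X_{1..m}).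

Definition row_deg u x : nat := (\sum_(i | ro i == x) u i)%N.
Definition col_deg u y : nat := (\sum_(i | co i == y) u i)%N.

Definition vertex_deg u : {ffun X -> nat} * {ffun Y -> nat} :=
  ([ffun x => row_deg u x], [ffun y => col_deg u y]).

Lemma vertex_degP u v : vertex_deg u = vertex_deg v <->
  (forall x, row_deg u x = row_deg v x) /\ (forall y, col_deg u y = col_deg v y).
Proof.
split=> [[/ffunP h1 /ffunP h2]|[h1 h2]].
  by split=> [x|y]; [move: (h1 x)|move: (h2 y)]; rewrite !ffunE.
by congr pair; apply/ffunP => z; rewrite !ffunE.
Qed.

Lemma row_degD u v x : row_deg (u + v)%MM x = (row_deg u x + row_deg v x)%N.
Proof. by rewrite /row_deg -big_split; apply: eq_bigr => i _; rewrite mnmDE. Qed.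

Lemma col_degD u v y : col_deg (u + v)%MM y = (col_deg u y + col_deg v y)%N.
Proof. by rewrite /col_deg -big_split; apply: eq_bigr => i _; rewrite mnmDE. Qed.

Lemma row_degU i x : row_deg U_(i)%MM x = (ro i == x).
Proof.
rewrite /row_deg; have [<-|ix] := eqVneq (ro i) x.
  rewrite (bigD1 i) //= mnm1E eqxx big1 // => j /andP[_ ji].
  by rewrite mnm1E eq_sym (negPf ji).
rewrite big1 // => j jx; rewrite mnm1E; case: eqP => // E0.
by rewrite E0 (eqP jx) eqxx in ix.
Qed.

Lemma col_degU i y : col_deg U_(i)%MM y = (co i == y).
Proof.
rewrite /col_deg; have [<-|ix] := eqVneq (co i) y.
  rewrite (bigD1 i) //= mnm1E eqxx big1 // => j /andP[_ ji].
  by rewrite mnm1E eq_sym (negPf ji).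
rewrite big1 // => j jx; rewrite mnm1E; case: eqP => // E0.
by rewrite E0 (eqP jx) eqxx in ix.
Qed.

Lemma row_deg_sum u : (\sum_x row_deg u x)%N = mdeg u.
Proof. by rewrite mdegE (partition_big ro predT). Qed.

Lemma vertex_deg_add u v w :
  vertex_deg (u + w)%MM = vertex_deg (v + w)%MM <-> vertex_deg u = vertex_deg v.
Proof.
rewrite !vertex_degP; split=> -[h1 h2]; split=> z.
- by have := h1 z; rewrite !row_degD => /eqP; rewrite eqn_add2r => /eqP.
- by have := h2 z; rewrite !col_degD => /eqP; rewrite eqn_add2r => /eqP.
- by rewrite !row_degD h1.
- by rewrite !col_degD h2.
Qed.

Lemma vertex_deg_mdeg u v : vertex_deg u = vertex_deg v -> mdeg u = mdeg v.
Proof.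
by move=> /vertex_degP[h _]; rewrite -!row_deg_sum; apply: eq_bigr => x _.
Qed.

Lemma vertex_deg_le1 u v : vertex_deg u = vertex_deg v -> (mdeg u <= 1)%N -> u = v.
Proof.
move=> uv; have uvd := vertex_deg_mdeg uv.
rewrite leq_eqVlt ltnS leqn0 => /orP[u1|u0]; last first.
  have v0 : mdeg v == 0%N by rewrite -uvd.
  by move: u0 v0; rewrite !mdeg_eq0 => /eqP-> /eqP->.
have v1 : mdeg v == 1%N by rewrite -uvd.
case/mdeg1P: u1 uv => i /eqP->; case/mdeg1P: v1 => j /eqP-> /vertex_degP[h1 h2].
congr mnm1; apply: ends_inj; apply/eqP.
  by have := h1 (ro j); rewrite !row_degU eqxx; case: eqP.
by have := h2 (co j); rewrite !col_degU eqxx; case: eqP.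
Qed.

(** A surplus of [v] at [e] must be balanced by a surplus of [u] elsewhere in the same row. *)
Lemma row_deg_gt u v e : (forall i, ro i = ro e -> (v i < u i)%N -> False) ->
  (u e < v e)%N -> row_deg u (ro e) = row_deg v (ro e) -> False.
Proof.
move=> h lt0; apply/eqP; rewrite neq_ltn /row_deg; apply/orP; left.
rewrite (bigD1 e) //= [X in (_ < X)%N](bigD1 e) //= -addSn leq_add //.
apply: leq_sum => i /andP[/eqP ie _]; rewrite leqNgt; apply/negP.
exact: h.
Qed.

Lemma col_deg_gt u v e : (forall i, co i = co e -> (v i < u i)%N -> False) ->
  (u e < v e)%N -> col_deg u (co e) = col_deg v (co e) -> False.
Proof.
move=> h lt0; apply/eqP; rewrite neq_ltn /col_deg; apply/orP; left.
rewrite (bigD1 e) //= [X in (_ < X)%N](bigD1 e) //= -addSn leq_add //.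
apply: leq_sum => i /andP[/eqP ie _]; rewrite leqNgt; apply/negP.
exact: h.
Qed.

Section PerfectElimination.
Variable key : 'I_m -> nat.
Hypothesis key_inj : injective key.

(** Three corners of a rectangle, with [f] in the row and [g] in the column of [e]. The hypothesis
    [corner_fill] says that [e] is bisimplicial once all edges with smaller keys have been
    deleted. *)
Definition corner e f g := [&& ro f == ro e, co g == co e, (key e < key f)%N & (key e < key g)%N].
Hypothesis corner_fill : forall e f g, corner e f g ->
  exists h, [/\ ro h = ro g, co h = co f & (key e < key h)%N].

Definition swappable f g := [exists e, corner e f g || corner e g f].

Lemma swappable_sym f g : swappable f g = swappable g f.
Proof. by apply: eq_existsb => e; rewrite orbC. Qed.

(** Exchanging the two diagonals of the rectangle keeps all vertex degrees. The new product contains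
    [e], the smallest variable involved, and is therefore smaller in the reverse lexicographic
    order. *)
Lemma corner_swap e f g : corner e f g -> exists h,
  [/\ vertex_deg (U_(f) + U_(g))%MM = vertex_deg (U_(e) + U_(h))%MM
    & revlex_lt key (U_(e) + U_(h))%MM (U_(f) + U_(g))%MM].
Proof.
move=> c; have [h [rh ch eh]] := corner_fill c.
case/and4P: c => /eqP fe /eqP ge ef eg; exists h; split.
  apply/vertex_degP; split=> z.
    by rewrite !row_degD !row_degU fe rh.
  by rewrite !col_degD !col_degU ge ch addnC.
apply/revlex_ltP; right; rewrite !mdegD !mdeg1; split=> //; exists e.
have neq i j : (key i < key j)%N -> (j == i) = false.
  by move=> ij; apply/eqP => E0; rewrite E0 ltnn in ij.
rewrite !mnmDE !mnm1E eqxx !neq //; split=> // j je; rewrite !mnmDE !mnm1E.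
by rewrite !neq // (ltn_trans je).
Qed.

Lemma swappable_straight f g : swappable f g -> exists q,
  [/\ vertex_deg (U_(f) + U_(g))%MM = vertex_deg q, mdeg q = 2%N
    & revlex_lt key q (U_(f) + U_(g))%MM].
Proof.
case/existsP => e /orP[]/corner_swap[h [h1 h2]]; exists (U_(e) + U_(h))%MM.
  by split=> //; rewrite mdegD !mdeg1.
by split; rewrite ?[(U_(f) + _)%MM]addmC //= mdegD !mdeg1.
Qed.

(** At the first variable [e] where they differ, [u] has the larger exponent. Equal degrees of the
    row and the column of [e] force variables [f] and [g] there in which [v] is larger; both come
    after [e], and they differ since the ends determine an edge. So ['X_f * 'X_g] divides [v]. *)
Lemma not_std_of_lt u v : vertex_deg u = vertex_deg v -> revlex_lt key u v ->
  ~~ std_monomial swappable v.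
Proof.
move=> uv /revlex_ltP[|[_ [e [vu eE]]]]; first by rewrite (vertex_deg_mdeg uv) ltnn.
have [h1 h2] := (vertex_degP _ _).1 uv.
have [f fe vf] : exists2 f, ro f = ro e & (u f < v f)%N.
  apply: contrapT => no; apply: (@row_deg_gt v u e) => // i ie lt0.
  by apply: no; exists i.
have [g ge vg] : exists2 g, co g = co e & (u g < v g)%N.
  apply: contrapT => no; apply: (@col_deg_gt v u e) => // i ie lt0.
  by apply: no; exists i.
have kf i : (u i < v i)%N -> (key e < key i)%N.
  move=> lt0; have [||/key_inj E0] := ltngtP (key e) (key i) => //.
    by move/eE=> E0; rewrite E0 ltnn in lt0.
  by move: lt0; rewrite -E0 ltnNge (ltnW vu).
have fg : f != g.
  by apply/eqP => E0; have := kf _ vf; rewrite (ends_inj fe) ?ltnn // E0.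
rewrite negb_forall; apply/existsP; exists f; rewrite negb_forall; apply/existsP; exists g.
rewrite negb_imply negbK; apply/andP; split.
  by apply/existsP; exists e; rewrite /corner fe ge !eqxx !kf.
apply/mnm_lepP => i; rewrite mnmDE !mnm1E.
have [<-|_] := eqVneq f i; first by rewrite eq_sym (negPf fg) (leq_ltn_trans _ vf).
by have [<-|_] := eqVneq g i; rewrite // (leq_ltn_trans _ vg).
Qed.

End PerfectElimination.
End BipartiteFibers.

Section PerfectEliminationConsequences.
Variables (K : fieldType) (m : nat) (X Y : finType) (ro : 'I_m -> X) (co : 'I_m -> Y).
Local Notation S := {mpoly K[m]}.
Variables (I : set S) (key : 'I_m -> nat).
Hypothesis ends_inj : forall i j, ro i = ro j -> co i = co j -> i = j.
Hypothesis fibI : fibered (vertex_deg ro co) I.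
Hypothesis key_inj : injective key.
Hypothesis corner_fill : forall e f g, corner ro co key e f g ->
  exists h, [/\ ro h = ro g, co h = co f & (key e < key h)%N].
Implicit Types (f g : S) (u v w : 'X_{1..m}).

(** The second monomial supplied by [fib_supp] is smaller than the maximal [w], so [w] is not
    minimal in its fiber. *)
Lemma peo_lead_not_std f w : I f -> f@_w != 0 ->
  (forall u, f@_u != 0 -> ~~ revlex_lt key w u) -> ~~ std_monomial (swappable ro co key) w.
Proof.
move=> If fw wmax; have [v /eqP vw [vE fv]] := fib_supp fibI If fw.
apply: (not_std_of_lt ends_inj key_inj vE).
by case/orP: (revlex_lt_total key vw) => // wv; have := wmax _ fv; rewrite wv.
Qed.

Lemma peo_groebner : has_quadratic_groebner_basis I.
Proof.
have /choice[q qP] (x : 'I_m * 'I_m) : exists q : 'X_{1..m}, swappable ro co key x.1 x.2 ->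
    [/\ vertex_deg ro co (U_(x.1) + U_(x.2))%MM = vertex_deg ro co q, mdeg q = 2%N
      & revlex_lt key q (U_(x.1) + U_(x.2))%MM].
  have [h|] := boolP (swappable ro co key x.1 x.2); last by exists 0%MM.
  by have [q qP] := swappable_straight corner_fill h; exists q.
pose B : seq S := [seq 'X_[U_(x.1) + U_(x.2)] - 'X_[q x]
  | x <- enum {: 'I_m * 'I_m} & swappable ro co key x.1 x.2].
have BP b : b \in B -> exists x, swappable ro co key x.1 x.2 /\ b = 'X_[U_(x.1) + U_(x.2)] -
  'X_[q x].
  by case/mapP => x; rewrite mem_filter => /andP[sx _] ->; exists x.
have neq x : swappable ro co key x.1 x.2 -> (U_(x.1) + U_(x.2))%MM != q x.
  by move=> /qP[_ _]; apply: contraTneq => <-; rewrite revlex_ltnn.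
have BI : [set` B] `<=` I.
  by move=> b /= /BP[x [sx ->]]; apply: (fib_binom fibI); case: (qP x sx).
exists (revlex_le key), B; split; first exact: revlex_monomial_order.
  split=> //; apply/seteqP; split.
    by apply: ideal_genS => _ [u [b bB bu] <-]; exists u => //; exists b => //; apply: BI.
  apply: ideal_gen_sub; first exact: ideal_gen_ideal.
  move=> _ [w [f If [fw wmax]] <-].
  have : ~~ std_monomial (swappable ro co key) w.
    apply: (peo_lead_not_std If); first by rewrite -mcoeff_msupp.
    move=> u; rewrite -mcoeff_msupp => /wmax /orP[/eqP->|uw]; first by rewrite revlex_ltnn.
    by apply/negP => /(revlex_lt_trans key_inj uw); rewrite revlex_ltnn.
  rewrite negb_forall => /existsP[g]; rewrite negb_forall => /existsP[h].
  rewrite negb_imply negbK => /andP[gh /lem_exists[w0 ->]].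
  rewrite mpolyXD; case: (ideal_gen_ideal [set 'X_[K, u] | u in
    [set u | exists2 f, [set` B] f & lead_monomial (revlex_le key) f u]]) => _ _; apply.
  apply: ideal_gen_mem; exists (U_(g) + U_(h))%MM => //=.
  have [_ _ lt0] := qP (g, h) gh.
  exists ('X_[U_(g) + U_(h)] - 'X_[q (g, h)]).
    by apply/mapP; exists (g, h) => //; rewrite mem_filter gh mem_enum.
  split=> [|v]; rewrite mcoeff_msupp.
    by rewrite mcoeff_binomial_l ?oner_eq0 //; apply: (neq (g, h)).
  rewrite mcoeff_binomial /revlex_le; have [<-|_] := eqVneq (U_(g) + U_(h))%MM v; first by [].
  have [<- _|_] := eqVneq (q (g, h)) v; last by rewrite subrr eqxx.
  by apply/orP; right.
move=> b /BP[x [sx ->]]; rewrite tdegX_sub ?neq //.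
by case: (qP x sx) => _ -> _; rewrite mdegD !mdeg1.
Qed.

Variables (A : comNzRingType) (psi : {rmorphism S -> A}).
Hypothesis kerI : forall f, I f <-> psi f = 0.

Lemma peo_koszul : koszul (range psi) (fun d => [set psi p | p in [set p | p \is d.-homog]]).
Proof.
apply: (koszul_of_groebner (bad := swappable ro co key) (rk0 := revlex_rank key)
  (fib_ideal fibI) _ _ _ _ _ _ kerI).
- move=> f If; apply/eqP/negPn/negP => f0; have [v v0 [vE _]] := fib_supp fibI If f0.
  by case/eqP: v0; symmetry; apply: (fib_le1 fibI); rewrite ?mdeg0.
- move=> g h gh; have [q [h1 h2 h3]] := swappable_straight corner_fill gh.
  by exists q; split=> //; [rewrite revlex_rankP | apply: (fib_binom fibI)].
- move=> f w If fw wmax; apply: (peo_lead_not_std If fw) => u /wmax.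
  by rewrite leqNgt revlex_rankP.
- exact: swappable_sym.
- exact: revlex_rank_inj.
- by move=> w u v; rewrite !revlex_rankP //; apply: revlex_lt_add.
Qed.

End PerfectEliminationConsequences.

(** * Failure of Koszulness from a coprime two-element fiber *)

Section NotKoszul.
Variables (K : fieldType) (m : nat) (T : Type).
Local Notation S := {mpoly K[m]}.
Variables (phi : 'X_{1..m} -> T) (I : set S).
Hypothesis fibI : fibered phi I.
Variables (A : comNzRingType) (psi : {rmorphism S -> A}).
Hypothesis kerI : forall f, I f <-> psi f = 0.
Variables (u v : 'X_{1..m}).
Hypothesis uv : u != v.
Hypothesis uvE : phi u = phi v.
Hypothesis fibu : forall w, phi w = phi u -> w = u \/ w = v.
Hypothesis cop : forall i, u i = 0%N \/ v i = 0%N.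
Hypothesis u_gt2 : (2 < mdeg u)%N.

(** Without a constant term, [c] leaves only proper divisors of [u] to [g], and these never occur in
    [I]. *)
Lemma two_fiber_mul0 (c g : S) : c@_0%MM = 0 -> I g -> (c * g)@_u = 0.
Proof.
move=> c0 Ig; apply: mcoeffM_eq0 => p q uE cp.
apply: (two_fiber_coeff0 fibI fibu cop) => //; first by rewrite uE lem_addl.
apply: contra_neq cp => qu; suff -> : p = 0%MM by [].
by apply: (@addIm _ q); rewrite add0m -uE.
Qed.

(* Lifting the first two maps of a linear resolution to polynomials writes
   [X^u - X^v] as a sum of products in which no factor from [I] can contribute
   to the coefficient of [X^u]. *)
Lemma two_fiber_not_koszul :
  ~ koszul (range psi) (fun d => [set psi p | p in [set p | p \is d.-homog]]).
Proof.
case=> b [D [Dlin Dirr Dexact]].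
have /choice[d0 d0P] r : exists f : S, f \is 1.-homog /\ psi f = D 0%N r 0.
  by have [f f1 <-] := Dlin 0%N r 0; exists f.
have /choice[d1 d1P] (qr : 'I_(b 1%N) * 'I_(b 0%N)) :
    exists f : S, f \is 1.-homog /\ psi f = D 1%N qr.1 qr.2.
  by have [f f1 <-] := Dlin 1%N qr.1 qr.2; exists f.
have homog1_0 (f : S) : f \is 1.-homog -> f@_0%MM = 0.
  by move=> /dhomog_nemf_coeff; apply; rewrite -[X in X != _]/(mdeg _) mdeg0.
have lift_vec k (x : 'rV[A]_k) : vec_over (range psi) x ->
    exists g : 'I_k -> S, forall j, psi (g j) = x 0 j.
  move=> xR; have /choice[g gP] j : exists f : S, psi f = x 0 j.
    by have [f _ <-] := xR j; exists f.
  by exists g.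
(* The first map hits every variable, so modulo [I] each variable is a combination of the linear
   forms [d0]. *)
have var_syz i : exists W : 'I_(b 0%N) -> S, I ('X_i - \sum_r W r * d0 r).
  have : irrelevant_ideal (fun d => [set psi p | p in [set p | p \is d.-homog]])
      ((const_mx (psi 'X_i) : 'rV[A]_1) 0 0).
    by apply/irrelevant_lift; exists 'X_i; rewrite ?mxE ?mcoeffX ?mnm1_eq0.
  case/Dirr => w /lift_vec[W WP] E; exists W; apply/kerI; rewrite rmorphB.
  have := congr1 (fun M : 'rV[A]_1 => M 0 0) E; rewrite !mxE => ->.
  rewrite rmorph_sum -sumrB big1 // => r _.
  by rewrite rmorphM WP; case: (d0P r) => _ ->; rewrite subrr.
have split_var (w : 'X_{1..m}) : (2 < mdeg w)%N -> exists i w0, w = (w0 + U_(i))%MM /\ w0 != 0%MM.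
  move=> w2; have [i wi] : exists i, w i != 0%N.
    apply: contrapT => no; suff w0 : w = 0%MM by rewrite w0 mdeg0 in w2.
    by apply/mnmP => i; rewrite mnm0E; apply/eqP/negPn/negP => wi; apply: no; exists i.
  have [w0 wE] : exists w0, w = (w0 + U_(i))%MM by apply: lem_exists; rewrite lep1mP.
  exists i, w0; split=> //; apply: contraTneq w2 => w00.
  by rewrite wE w00 mdegD mdeg0 mdeg1.
have [i1 [u0 [uE u00]]] := split_var _ u_gt2.
have [i2 [v0 [vE v00]]] : exists i w0, v = (w0 + U_(i))%MM /\ w0 != 0%MM.
  by apply: split_var; rewrite -(fib_deg fibI uvE).
have [W1 W1P] := var_syz i1; have [W2 W2P] := var_syz i2.
set g1 := _ - _ in W1P; set g2 := _ - _ in W2P.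
(* Splitting a variable off each monomial and expanding it through [d0] gives a vector [z] that [d0]
   sends to ['X_[u] - 'X_[v]] modulo [I]: a syzygy of [d0] over the quotient. *)
pose z r : S := 'X_[u0] * W1 r - 'X_[v0] * W2 r.
have zE : 'X_[u] - 'X_[v] = \sum_r z r * d0 r + 'X_[u0] * g1 - 'X_[v0] * g2.
  have -> : \sum_r z r * d0 r = 'X_[u0] * (\sum_r W1 r * d0 r) - 'X_[v0] * (\sum_r W2 r * d0 r).
    by rewrite !mulr_sumr -sumrB; apply: eq_bigr => r _; rewrite /z; ring.
  by rewrite /g1 /g2 uE vE !mpolyXD; ring.
have Iz : I (\sum_r z r * d0 r).
  have -> : \sum_r z r * d0 r = 'X_[u] - 'X_[v] - 'X_[u0] * g1 + 'X_[v0] * g2.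
    by rewrite zE; ring.
  have II := fib_ideal fibI; case: (II) => _ ID IM; apply: (ID); last exact: IM.
  by apply: (ideal_sub II); [apply: (fib_binom fibI) | apply: IM].
have vec_psi k (g : 'I_k -> S) : vec_over (range psi) (\row_j psi (g j)).
  by move=> j; rewrite mxE; exists (g j).
have [Om OmP] : exists Om : 'I_(b 1%N) -> S, forall r, I (z r - \sum_q Om q * d1 (q, r)).
  have /(Dexact 0%N _ (vec_psi _ z))[w /lift_vec[Om OmP] E] : (\row_r psi (z r)) *m D 0%N = 0.
    apply/rowP => j; rewrite !mxE ord1; move/kerI: Iz; rewrite rmorph_sum => Iz.
    rewrite -[RHS]Iz; apply: eq_bigr => r _; rewrite mxE rmorphM.
    by case: (d0P r) => _ ->.
  exists Om => r; apply/kerI; rewrite rmorphB rmorph_sum.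
  have := congr1 (fun M : 'rV[A]_(b 0%N) => M 0 r) E; rewrite !mxE => ->.
  rewrite -sumrB big1 // => q _; rewrite rmorphM OmP.
  by case: (d1P (q, r)) => _ /= ->; rewrite subrr.
have IQ q : I (\sum_r d1 (q, r) * d0 r).
  have Rrow : vec_over (range psi) (row q (D 1%N)).
    by move=> r; rewrite mxE; case: (d1P (q, r)) => _ /= <-; exists (d1 (q, r)).
  have /(Dexact 0%N _ Rrow) E : exists2 w, vec_over (range psi) w & row q (D 1%N) = w *m D 1%N.
    exists (delta_mx 0 q); last by rewrite -rowE.
    move=> r; rewrite mxE; case: (_ && _).
      by exists 1; rewrite ?rmorph1.
    by exists 0; rewrite ?rmorph0.
  apply/kerI; rewrite rmorph_sum.
  have := congr1 (fun M : 'rV[A]_1 => M 0 0) E; rewrite !mxE => {2}<-.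
  apply: eq_bigr => r _; rewrite mxE rmorphM.
  by case: (d1P (q, r)) => _ /= ->; case: (d0P r) => _ ->.
have := mcoeff_binomial_l K uv; rewrite zE.
(* Exactness has written [z] as [Om] times [d1] modulo [I]. This leaves elements of [I] multiplied
   by the linear forms [d0], and multiples of the quadrics [d1 * d0], which lie in [I] since the
   maps compose to zero. A degree 2 divisor of [u] is proper, so nothing reaches the coefficient at
   [u]. *)
have -> : \sum_r z r * d0 r = \sum_r d0 r * (z r - \sum_q Om q * d1 (q, r))
    + \sum_q Om q * (\sum_r d1 (q, r) * d0 r).
  have -> : \sum_q Om q * (\sum_r d1 (q, r) * d0 r) = \sum_r d0 r * (\sum_q Om q * d1 (q, r)).
    rewrite (eq_bigr (fun q => \sum_r Om q * (d1 (q, r) * d0 r))) => [|q _];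
      last by rewrite mulr_sumr.
    rewrite exchange_big; apply: eq_bigr => r _; rewrite mulr_sumr.
    by apply: eq_bigr => q _; ring.
  by rewrite -big_split; apply: eq_bigr => r _ /=; ring.
rewrite mcoeffB !mcoeffD !raddf_sum /= !(two_fiber_mul0 _ W1P, two_fiber_mul0 _ W2P); first last.
- by rewrite mcoeffX (negPf u00).
- by rewrite mcoeffX (negPf v00).
rewrite !big1 ?addr0 ?subr0 => [/eqP|q _|r _].
- by rewrite eq_sym oner_eq0.
- apply: mcoeffM_eq0 => p q' E _; apply/eqP/negPn/negP => Qq.
  have qd : mdeg q' = 2%N.
    have /dhomogP : \sum_r d1 (q, r) * d0 r \is 2.-homog.
      apply: rpred_sum => r _; rewrite (_ : 2%N = 1 + 1)%N //.
      by apply: dhomogM; [case: (d1P (q, r)) | case: (d0P r)].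
    by apply; rewrite mcoeff_msupp.
  case/eqP: Qq; apply: (two_fiber_coeff0 fibI fibu cop) => //; first by rewrite E lem_addl.
  by apply: contraTneq u_gt2 => <-; rewrite qd.
- by apply: two_fiber_mul0 => //; apply: homog1_0; case: (d0P r).
Qed.

End NotKoszul.

(** * The toric ring of the stable set polytope *)

Section ToricFibers.
Variables (K : fieldType) (n m : nat) (a : 'I_m -> 'rV[int]_n).
Variables (c : 'I_n -> bool) (ro co : 'I_m -> option 'I_n).
Hypothesis aE : forall i j, a i 0 j = ((ro i == Some j) + (co i == Some j))%N.
Hypothesis ro_side : forall i j, ro i = Some j -> c j.
Hypothesis co_side : forall i j, co i = Some j -> ~~ c j.
Hypothesis ends_inj : forall i j, ro i = ro j -> co i = co j -> i = j.
Local Notation S := {mpoly K[m]}.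
Local Notation L := {fraction {mpoly K[n.+1]}}.
Implicit Types (u v w : 'X_{1..m}).

Definition toric_rmorphism : {rmorphism S -> L} :=
  mmap (@tofrac {mpoly K[n.+1]} \o @mpolyC n.+1 K : {rmorphism K -> L}) (toric_gen K a).

Lemma toric_rmorphismE p : toric_rmorphism p = toric_map a p.
Proof. by []. Qed.

(** Lattice points have coordinates 0 and 1, so each generator is an ordinary monomial and the
    kernel can be computed in the polynomial ring, which embeds in its fraction field. *)
Definition gen_exponent i : 'X_{1..n.+1} :=
  (\sum_j U_(lift ord_max j) *+ ((ro i == Some j) + (co i == Some j))%N + U_(ord_max))%MM.

Definition toric_exponent u : 'X_{1..n.+1} := (\sum_i gen_exponent i *+ u i)%MM.

Lemma toric_genE i : toric_gen K a i = tofrac 'X_[gen_exponent i].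
Proof.
rewrite /toric_gen /gen_exponent mpolyXD tofracM; congr (_ * _).
rewrite -mprodXE rmorph_prod; apply: eq_bigr => j _.
by rewrite aE /= -mpolyXn tofracXn.
Qed.

Lemma toric_mapE (p : S) :
  toric_map a p = tofrac (\sum_(u <- msupp p) p@_u *: 'X_[toric_exponent u]).
Proof.
rewrite /toric_map /mmap rmorph_sum; apply: eq_bigr => u _.
rewrite /= -mul_mpolyC tofracM; congr (_ * _); rewrite /mmap1 /toric_exponent -mprodXE rmorph_prod.
by apply: eq_bigr => i _; rewrite toric_genE -mpolyXn /= tofracXn.
Qed.

Lemma gen_exponent_vertex i j :
  gen_exponent i (lift ord_max j) = ((ro i == Some j) + (co i == Some j))%N.
Proof.
rewrite mnmDE mnm_sumE mnm1E (negPf (neq_lift _ _)) addn0 (bigD1 j) //= mulmnE mnm1E eqxx mul1n.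
rewrite big1 ?addn0 // => k kj; rewrite mulmnE mnm1E (inj_eq (@lift_inj _ _)).
by rewrite (negPf kj) mul0n.
Qed.

Lemma gen_exponent_last i : gen_exponent i ord_max = 1%N.
Proof.
rewrite mnmDE mnm_sumE mnm1E eqxx big1 // => k _; rewrite mulmnE mnm1E.
by rewrite eq_sym (negPf (neq_lift _ _)) mul0n.
Qed.

Lemma toric_exponent_vertex u j :
  toric_exponent u (lift ord_max j) = (row_deg ro u (Some j) + col_deg co u (Some j))%N.
Proof.
rewrite mnm_sumE (eq_bigr (fun i => (if ro i == Some j then u i else 0) +
  (if co i == Some j then u i else 0))%N) => [|i _]; last first.
  rewrite mulmnE gen_exponent_vertex mulnDl.
  by case: eqP; case: eqP; rewrite /= ?mul1n ?mul0n.
by rewrite big_split /= -!big_mkcond.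
Qed.

Lemma toric_exponent_last u : toric_exponent u ord_max = mdeg u.
Proof.
by rewrite mnm_sumE mdegE; apply: eq_bigr => i _; rewrite mulmnE gen_exponent_last mul1n.
Qed.

Lemma row_deg_side u j : ~~ c j -> row_deg ro u (Some j) = 0%N.
Proof. by move=> cj; apply: big1 => i /eqP/ro_side; rewrite (negPf cj). Qed.

Lemma col_deg_side u j : c j -> col_deg co u (Some j) = 0%N.
Proof. by move=> cj; apply: big1 => i /eqP/co_side; rewrite cj. Qed.

Lemma deg_None (f g : option 'I_n -> nat) : (forall j, f (Some j) = g (Some j)) ->
  (\sum_x f x = \sum_x g x)%N -> forall x, f x = g x.
Proof.
move=> fg E [j|]; first exact: fg.
move: E; rewrite (bigD1 None) //= [in RHS](bigD1 None) //=.
rewrite (eq_bigr g); last by case=> // j _; apply: fg.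
by move/eqP; rewrite eqn_add2r => /eqP.
Qed.

(** Each vertex lies on one side only, so the exponent of its variable is its row or column degree.
    The degrees of the two added vertices are what remains of the total degree, the exponent of
    [t]. *)
Lemma toric_exponentP u v :
  toric_exponent u = toric_exponent v <-> vertex_deg ro co u = vertex_deg ro co v.
Proof.
split=> [E|E].
  have d : mdeg u = mdeg v by rewrite -!toric_exponent_last E.
  have vE j := congr1 (fun w : 'X_{1..n.+1} => w (lift ord_max j)) E.
  apply/vertex_degP; split; apply: deg_None.
  - move=> j; have [cj|cj] := boolP (c j); last by rewrite !row_deg_side.
    by have := vE j; rewrite /= !toric_exponent_vertex !col_deg_side // !addn0.
  - by rewrite !row_deg_sum.
  - move=> j; have [cj|cj] := boolP (c j); first by rewrite !col_deg_side.
    by have := vE j; rewrite /= !toric_exponent_vertex !row_deg_side.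
  - by have := d; rewrite !mdegE (partition_big co predT) // [in RHS](partition_big co predT).
have [h1 h2] := (vertex_degP _ _ _ _).1 E.
apply/mnmP => k; have [j ->|->] := unliftP ord_max k.
  by rewrite !toric_exponent_vertex h1 h2.
by rewrite !toric_exponent_last (vertex_deg_mdeg E).
Qed.

Lemma toric_ideal_fibered : fibered (vertex_deg ro co) (toric_ideal K a).
Proof.
have kerE p : toric_ideal K a p <-> toric_rmorphism p = 0 by [].
split.
- split; first by apply/kerE; rewrite rmorph0.
    by move=> f g /kerE f0 /kerE g0; apply/kerE; rewrite rmorphD f0 g0 addr0.
  by move=> d f /kerE f0; apply/kerE; rewrite rmorphM f0 mulr0.
- by move=> u v w; apply: vertex_deg_add.
- by move=> u v; apply: vertex_deg_mdeg.
- by move=> u v; apply: (vertex_deg_le1 ends_inj).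
- move=> u v /toric_exponentP E; apply/kerE; rewrite rmorphB !toric_rmorphismE !toric_mapE.
  by rewrite !msuppX !big_seq1 !mcoeffX !eqxx E subrr.
(* The coefficient of the image of [f] at the exponent of [u] is the sum of the coefficients of [f]
   over the fiber. If [u] were alone there, this sum would be its own coefficient. *)
move=> f u /kerE; rewrite toric_rmorphismE toric_mapE => /eqP.
rewrite tofrac_eq0 => /eqP E fu; apply: contrapT => no.
case/eqP: fu; have := congr1 (mcoeff (toric_exponent u)) E.
rewrite mcoeff0 raddf_sum /=; have [uf|] := boolP (u \in msupp f); last first.
  by rewrite mcoeff_msupp negbK => /eqP.
rewrite (bigD1_seq u) ?msupp_uniq //= mcoeffZ mcoeffX eqxx mulr1 big1 ?addr0 // => w wu.
rewrite mcoeffZ mcoeffX; case: eqP => [/toric_exponentP wE|_]; last by rewrite mulr0.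
have [-> |fw] := eqVneq f@_w 0; first by rewrite mul0r.
by case: no; exists w.
Qed.

End ToricFibers.

Section LatticePoints.
Variables (R : realType) (n : nat) (e : rel 'I_n) (c : 'I_n -> bool).
Hypothesis e_sym : ssrbool.symmetric e.
Hypothesis cP : forall x y, compl_graph e x y -> c x != c y.
Variables (m : nat) (a : 'I_m -> 'rV[int]_n).
Hypothesis enum_a : lattice_enum (stable_set_polytope R e) a.

Definition clique_point (W : {set 'I_n}) : 'rV[int]_n := \row_j (j \in W)%:Z.

Lemma rhoE (W : {set 'I_n}) j : (rho R W) 0 j = (j \in W)%:R.
Proof.
rewrite /rho summxE; under eq_bigr do rewrite mxE eqxx /=.
have [jW|jW] := boolP (j \in W).
  rewrite (bigD1 j) //= eqxx big1 ?addr0 // => l /andP[_].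
  by rewrite eq_sym => /negPf ->.
by rewrite big1 // => l lW; case: eqP jW => // ->; rewrite lW.
Qed.

(** A point of the hull has coordinates in [0, 1]. If [V i0] carries positive weight, coordinate [j]
    is positive for [j] in [V i0] and less than 1 otherwise; an integral point must then be the
    indicator of [V i0]. *)
Lemma lattice_pointP z : stable_set_polytope R e (map_mx intr z) <->
  exists2 W, stable e W & z = clique_point W.
Proof.
split=> [[k [w [p [w0 w1 pS zE]]]]|[W sW ->]]; last first.
  exists 1%N, (fun=> 1), (fun=> rho R W); split=> //.
  - by rewrite big_ord1.
  - by move=> _; exists W.
  by rewrite big_ord1 scale1r; apply/rowP => j; rewrite rhoE !mxE; case: (j \in W).
have /choice[V VP] i : exists W, stable e W /\ rho R W = p i.
  by case: (pS i) => W sW <-; exists W.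
have zj j : (z 0 j)%:~R = \sum_i w i * (j \in V i)%:R.
  have := congr1 (fun x : 'rV[R]_n => x 0 j) zE; rewrite mxE summxE => ->.
  by apply: eq_bigr => i _; case: (VP i) => _ <-; rewrite mxE rhoE.
have [i0 wi0] : exists i, 0 < w i.
  apply: contrapT => no; have := oner_neq0 R; rewrite -w1 big1 ?eqxx // => i _.
  by apply/eqP; rewrite eq_le w0 andbT leNgt; apply/negP => wi; apply: no; exists i.
exists (V i0); first by case: (VP i0).
apply/rowP => j; rewrite mxE.
have z0 : 0 <= z 0 j.
  by rewrite -(ler0z R) zj; apply: sumr_ge0 => i _; rewrite mulr_ge0 // ler0n.
have z1 : z 0 j <= 1.
  rewrite -(lerz1 R) zj -[leRHS]w1; apply: ler_sum => i _.
  by case: (j \in V i); rewrite /= ?mulr1 ?mulr0 ?lexx ?w0.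
have [jV|jV] := boolP (j \in V i0).
  suff : 0 < z 0 j by move: z0 z1; case: (z 0 j) => [[|[|k']]|].
  rewrite -(ltr0z R) zj (bigD1 i0) //= jV mulr1 ltr_wpDr //.
  by apply: sumr_ge0 => i _; rewrite mulr_ge0 // ler0n.
suff : z 0 j < 1 by move: z0 z1; case: (z 0 j) => [[|[|k']]|].
rewrite -(ltrz1 R) zj -[ltRHS]w1 (bigD1 i0) //= (negPf jV) mulr0 add0r [ltRHS](bigD1 i0) //=.
rewrite ltr_pwDl //; apply: ler_sum => i _.
by case: (j \in V i); rewrite /= ?mulr1 ?mulr0 ?lexx ?w0.
Qed.

(** The choice made by [pick] is forced: a clique of a bipartite graph has at most one vertex of
    each colour. *)
Definition row_end i : option 'I_n := [pick j | (a i 0 j == 1) && c j].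
Definition col_end i : option 'I_n := [pick j | (a i 0 j == 1) && ~~ c j].

Lemma stable_side W x y : stable e W -> x \in W -> y \in W -> c x = c y -> x = y.
Proof.
move=> sW xW yW cxy; apply/eqP/negPn/negP => xy.
have : compl_graph e x y.
  rewrite /compl_graph /= xy /=; move/forallP: sW => /(_ x); rewrite xW => /forallP/(_ y).
  by rewrite yW xy.
by move/cP; rewrite cxy eqxx.
Qed.

Lemma lattice_clique i : exists2 W, stable e W & a i = clique_point W.
Proof.
apply/lattice_pointP; case: enum_a => _ aE.
suff : range a (a i) by rewrite aE.
by exists i.
Qed.

Lemma clique_pointE W j : (clique_point W 0 j == 1) = (j \in W).
Proof. by rewrite mxE; case: (j \in W). Qed.

Lemma row_endP i j : row_end i = Some j <-> a i 0 j = 1 /\ c j.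
Proof.
have [W sW aW] := lattice_clique i.
rewrite /row_end aW; case: pickP => [k /andP[kW ck]|no]; split.
- by case=> <-; split=> //; apply/eqP.
- case=> /eqP jW cj; congr Some.
  by rewrite clique_pointE in kW; rewrite clique_pointE in jW; apply: (stable_side sW); rewrite ?ck.
- by [].
- by case=> /eqP jW cj; have := no j; rewrite jW cj.
Qed.

Lemma col_endP i j : col_end i = Some j <-> a i 0 j = 1 /\ ~~ c j.
Proof.
have [W sW aW] := lattice_clique i.
rewrite /col_end aW; case: pickP => [k /andP[kW ck]|no]; split.
- by case=> <-; split=> //; apply/eqP.
- case=> /eqP jW cj; congr Some.
  rewrite clique_pointE in kW; rewrite clique_pointE in jW; apply: (stable_side sW) => //.
  by rewrite (negPf ck) (negPf cj).
- by [].
- by case=> /eqP jW cj; have := no j; rewrite jW cj.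
Qed.

Lemma lattice_ends i j : a i 0 j = ((row_end i == Some j) + (col_end i == Some j))%N.
Proof.
have [W sW aW] := lattice_clique i.
have a01 : a i 0 j = Posz (nat_of_bool (a i 0 j == 1)) by rewrite aW mxE; case: (j \in W).
rewrite a01; case: (row_end i =P Some j) => [/row_endP[-> cj]|nr].
  by case: (col_end i =P Some j) => [/col_endP[_]|]; rewrite ?cj.
case: (col_end i =P Some j) => [/col_endP[-> cj]//|nc].
have [/eqP aij|//] := boolP (a i 0 j == 1).
have [cj|cj] := boolP (c j); first by case: nr; apply/row_endP.
by case: nc; apply/col_endP.
Qed.

Lemma row_end_side i j : row_end i = Some j -> c j.
Proof. by case/row_endP. Qed.

Lemma col_end_side i j : col_end i = Some j -> ~~ c j.
Proof. by case/col_endP. Qed.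

Lemma ends_inj i j : row_end i = row_end j -> col_end i = col_end j -> i = j.
Proof.
case: enum_a => a_inj _ rE cE; apply: a_inj; apply/rowP => k.
by rewrite !lattice_ends rE cE.
Qed.

(* Adjacency in the bipartite graph obtained from the complement of [e] by
   adding the row [None], adjacent to all columns, and the column [None],
   adjacent to all rows. *)
Definition cone_adj (r q : option 'I_n) : bool :=
  [&& if r is Some x then c x else true, if q is Some y then ~~ c y else true
    & match r, q with Some x, Some y => compl_graph e x y | _, _ => true end].

Lemma ends_adj i : cone_adj (row_end i) (col_end i).
Proof.
have [W sW aW] := lattice_clique i.
rewrite /cone_adj; case rE: (row_end i) => [x|]; case cE: (col_end i) => [y|] //=.
- have [/eqP ax cx] := (row_endP i x).1 rE; have [/eqP ay cy] := (col_endP i y).1 cE.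
  rewrite aW clique_pointE in ax; rewrite aW clique_pointE in ay.
  have xy : x != y by apply: contraNneq cy => <-.
  rewrite cx cy /compl_graph /= xy /=; move/forallP: sW => /(_ x); rewrite ax => /forallP/(_ y).
  by rewrite ay xy.
- by have [_ ->] := (row_endP i x).1 rE.
- by have [_ ->] := (col_endP i y).1 cE.
Qed.

Lemma cone_adj_ends r q : cone_adj r q -> exists i, row_end i = r /\ col_end i = q.
Proof.
move=> rq.
pose W : {set 'I_n} := finset (fun x => (r == Some x) || (q == Some x)).
have sW : stable e W.
  apply/forallP => x; apply/implyP; rewrite inE => xW.
  apply/forallP => y; apply/implyP; rewrite inE => yW; apply/implyP => xy.
  move: rq xW yW; case: (r) (q) => [x0|] [y0|] //= rq; last 2 first.
  - by rewrite !orbF => /eqP[E0] /eqP[E1]; case/eqP: xy; rewrite -E0 -E1.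
  - by move=> /eqP[E0] /eqP[E1]; case/eqP: xy; rewrite -E0 -E1.
  have [_ _ /andP[_ ee]] := and3P rq.
  case/orP => /eqP[E0] /orP[]/eqP[E1]; move: xy ee; rewrite -E0 -E1 ?eqxx //.
  by rewrite e_sym.
have [i aW] : exists i, a i = clique_point W.
  case: enum_a => _ aE; suff : range a (clique_point W) by case=> i _ <-; exists i.
  by rewrite aE /=; apply/lattice_pointP; exists W.
exists i; have aiE x : a i 0 x = 1 <-> (r == Some x) || (q == Some x).
  rewrite aW; split=> [/eqP|]; first by rewrite clique_pointE inE.
  by move=> h; apply/eqP; rewrite clique_pointE inE.
have [rc qc] : (forall x, r = Some x -> c x) /\ (forall y, q = Some y -> ~~ c y).
  by move: rq; split=> x E; move: rq; rewrite E => /and3P[].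
split.
  case rE: r => [x|]; first by apply/row_endP; rewrite aiE rE eqxx; split=> //; apply: rc.
  case iE: (row_end i) => [x|] //; have [/aiE] := (row_endP i x).1 iE.
  by rewrite rE /= => /eqP/qc/negPf->.
case qE: q => [y|]; first by apply/col_endP; rewrite aiE qE eqxx orbT; split=> //; apply: qc.
case iE: (col_end i) => [y|] //; have [/aiE] := (col_endP i y).1 iE.
by rewrite qE orbF => /eqP/rc->.
Qed.

End LatticePoints.

(** * Bisimplicial edges *)

Section ShortestPath.
Variables (T : finType) (r : rel T).

(** A shortest path will do, since a forward chord would shorten it. *)
Lemma induced_path_exists x y : connect r x y -> exists p,
  [/\ path r x p, last x p = y, uniq (x :: p)
    & forall i j, (i < j <= size p)%N -> r (nth x (x :: p) i) (nth x (x :: p) j) -> j = i.+1].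
Proof.
move=> xy.
pose P k := `[< exists p, [/\ path r x p, last x p = y & size p = k] >].
have exP : exists k, P k.
  by have [p xp yE] := connectP xy; exists (size p); apply/asboolP; exists p.
case: (ex_minnP exP) => k /asboolP[p0 [xp0 yE0 szp0]] kmin.
have [p xp [yE up szp]] : exists2 p, path r x p & [/\ last x p = y, uniq (x :: p) & (size p <=
  k)%N].
  case: (shortenP xp0) yE0 => p xp up sub yE; exists p => //; split=> //.
  by rewrite -szp0; apply: uniq_leq_size => [|z /sub //]; case/andP: up.
exists p; split=> // i j /andP[ij jp] rij.
apply/eqP; rewrite eqn_leq ij andbT leqNgt; apply/negP => ltij.
have j0 : (0 < j)%N by case: (j) ij.
have ip : (i <= size p)%N by rewrite (leq_trans (ltnW ij)).
have lastE h : (h <= size p)%N -> last x (take h p) = nth x (x :: p) h.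
  by elim: (p) {1 3}(x) h => [|a q IH] z [|h] //= hq; apply: IH.
(* Position [j] of [x :: p] is position [j.-1] of [p]; the chord jumps there directly from position
   [i]. *)
pose p' := take i p ++ drop j.-1 p.
have dropE : drop j.-1 p = nth x (x :: p) j :: drop j p.
  by rewrite (drop_nth x) ?prednK //; case: (j) j0.
have path' : path r x p'.
  rewrite cat_path; have := xp; rewrite -{1}(cat_take_drop i p) cat_path => /andP[-> _] /=.
  rewrite lastE // dropE /= rij /=.
  have := xp; rewrite -{1}(cat_take_drop j p) cat_path => /andP[_].
  by rewrite lastE.
have last' : last x p' = y.
  rewrite last_cat dropE /= -lastE // -last_cat cat_take_drop //.
have : (k <= size p')%N by apply: kmin; apply/asboolP; exists p'.
rewrite size_cat size_takel // size_drop leqNgt => /negP; apply.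
apply: leq_trans szp; clear -ij ltij jp j0; lia.
Qed.

End ShortestPath.

Section InducedCycles.
Variable n : nat.
Implicit Types (H : rel 'I_n) (s : seq 'I_n).

Lemma next_nth_mod x0 s i : uniq s -> (i < size s)%N ->
  next s (nth x0 s i) = nth x0 s (i.+1 %% size s).
Proof.
move=> us ilt; rewrite next_nth mem_nth // index_uniq //.
case: s us ilt => // y p us /=; rewrite ltnS leq_eqVlt => /orP[/eqP->|ilt].
  by rewrite nth_default // modnn.
by rewrite modn_small ?ltnS //= (set_nth_default x0).
Qed.

Lemma induced_cycleP H s : reflect
  [/\ (2 < size s)%N, uniq s, forall x, x \in s -> H x (next s x)
    & forall x y, x \in s -> y \in s -> H x y -> y = next s x \/ x = next s y]
  (induced_cycle H s).
Proof.
apply: (iffP andP) => [[/andP[sz /andP[cyc us]] /forallP ind]|[sz us nx ind]].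
  split=> // [x xs|x y xs ys xy]; first exact: next_cycle.
  move/implyP: (ind x) => /(_ xs)/forallP/(_ y); rewrite ys xy /=.
  by case/orP => /eqP; [left|right].
split.
  by rewrite /graph_cycle sz /ucycleb us andbT; apply: cycle_from_next => // x; apply: nx.
apply/forallP => x; apply/implyP => xs; apply/forallP => y; apply/implyP => ys.
by apply/implyP => /(ind _ _ xs ys)[] <-; rewrite eqxx ?orbT.
Qed.

Lemma induced_cycle_of_nth H x0 s : ssrbool.symmetric H -> irreflexive H ->
  uniq s -> (2 < size s)%N ->
  (forall i, (i < size s)%N -> H (nth x0 s i) (nth x0 s (i.+1 %% size s))) ->
  (forall i j, (i < j < size s)%N -> H (nth x0 s i) (nth x0 s j) ->
    j = i.+1 \/ i = 0%N /\ j = (size s).-1) ->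
  induced_cycle H s.
Proof.
move=> Hsym Hirr us sz cyc ind; apply/induced_cycleP; split=> //.
  by move=> x xs; rewrite -(nth_index x0 xs) next_nth_mod ?index_mem //; apply: cyc;
    rewrite index_mem.
have key i j : (i < j < size s)%N -> H (nth x0 s i) (nth x0 s j) ->
    nth x0 s j = next s (nth x0 s i) \/ nth x0 s i = next s (nth x0 s j).
  move=> ij /(ind _ _ ij)[jE|[i0 jE]]; case/andP: ij => ij js.
    by left; rewrite next_nth_mod ?(ltn_trans ij) // -jE modn_small.
  right; rewrite next_nth_mod // jE prednK ?modnn ?i0 //.
  by rewrite (leq_trans _ sz).
move=> x y xs ys xy; rewrite -(nth_index x0 xs) -(nth_index x0 ys) in xy *.
rewrite -index_mem in xs; rewrite -index_mem in ys.
case: (ltngtP (index x s) (index y s)) => [lt0|lt0|E0].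
- by apply: key => //; rewrite lt0.
- by rewrite Hsym in xy; case: (key _ _ _ xy); rewrite ?lt0 //; tauto.
- by rewrite E0 Hirr in xy.
Qed.

Definition induced4 H : Prop := forall s, induced_cycle H s -> size s = 4%N.

Definition bisimplicial H x y : Prop :=
  H x y /\ forall k l, H x l -> H y k -> H k l.

Definition del_edge H x y : rel 'I_n :=
  [rel a b | H a b && ~~ ((a == x) && (b == y) || (a == y) && (b == x))].

Lemma del_edge_sym H x y : ssrbool.symmetric H -> ssrbool.symmetric (del_edge H x y).
Proof.
move=> Hsym a b; rewrite /del_edge /= Hsym; congr (_ && ~~ _).
by rewrite orbC andbC [X in _ || X]andbC.
Qed.

(** On an induced cycle of the smaller graph through both [x] and [y], bisimpliciality joins the
    successors of [x] and [y]. That edge is a chord, because [x] and [y] are no longer adjacent. A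
    cycle missing one of them is already induced in [H]. *)
Lemma induced4_del H x y (c : 'I_n -> bool) :
  (forall a b, H a b -> c a != c b) -> bisimplicial H x y -> induced4 H ->
  induced4 (del_edge H x y).
Proof.
move=> cP [Hxy bis] H4 s indS; have [sz us nx ind] := induced_cycleP _ _ indS.
have sub a b : del_edge H x y a b -> H a b by case/andP.
have [/andP[xs ys]|nxy] := boolP ((x \in s) && (y \in s)).
  exfalso.
  have del1 := nx _ xs; have del2 := nx _ ys.
  have kx : next s y != x by apply/eqP => E0; move: del2; rewrite E0 /del_edge /= !eqxx orbT andbF.
  have ly : next s x != y by apply/eqP => E0; move: del1; rewrite E0 /del_edge /= !eqxx andbF.
  have lx : next s x != x.
    by apply/eqP => E0; move: (cP _ _ (sub _ _ del1)); rewrite E0 eqxx.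
  have kl : del_edge H x y (next s y) (next s x).
    by rewrite /del_edge /= (bis _ _ (sub _ _ del1) (sub _ _ del2)) (negPf kx) (negPf lx) andbF.
  case: (ind _ _ _ _ kl); rewrite ?mem_next // => /(congr1 (prev s)); rewrite !prev_next //.
    by move/eqP; rewrite eq_sym (negPf kx).
  by move/eqP; rewrite eq_sym (negPf ly).
apply: H4; apply/induced_cycleP; split=> // [a /nx /sub //|a b as_ bs ab].
apply: ind => //; rewrite /del_edge /= ab /=; apply: contra nxy.
by case/orP => /andP[/eqP<- /eqP<-]; rewrite as_ bs.
Qed.


Section Bisimplicial.
Variables (H : rel 'I_n) (c : 'I_n -> bool).
Hypothesis Hsym : ssrbool.symmetric H.
Hypothesis cP : forall a b, H a b -> c a != c b.
Hypothesis H4 : induced4 H.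
Implicit Types (U W Z : {set 'I_n}) (a b k l v x y z : 'I_n).

Lemma color_irr : irreflexive H.
Proof. by move=> a; apply/negP => /cP; rewrite eqxx. Qed.

Lemma color_flip a b d : H a b -> H b d -> c a = c d.
Proof. by move=> /cP + /cP; case: (c a) (c b) (c d) => [] [] []. Qed.

Lemma color_odd a b d : H a b -> H b d -> ~~ H a d.
Proof. by move=> ab bd; apply/negP => /cP; rewrite (color_flip ab bd) eqxx. Qed.

Definition within U : rel 'I_n := [rel a b | [&& a \in U, b \in U & H a b]].
Definition touches U v := [exists u in U, H u v].
Definition connected_in U := [forall a in U, forall b in U, connect (within U) a b].
Definition far_from U W := [set v in W | (v \notin U) && ~~ touches U v]%SET.
Definition has_edge Z := [exists a in Z, exists b in Z, H a b].

Lemma within_sym U : ssrbool.symmetric (within U).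
Proof. by move=> a b; rewrite /within /= Hsym andbCA. Qed.

Lemma has_edgeP Z : reflect (exists a b, [/\ a \in Z, b \in Z & H a b]) (has_edge Z).
Proof.
apply: (iffP existsP) => [[a /andP[aZ /existsP[b /andP[bZ ab]]]]|[a [b [aZ bZ ab]]]].
  by exists a, b.
by exists a; rewrite aZ; apply/existsP; exists b; rewrite bZ.
Qed.

Lemma touchesP U v : reflect (exists2 u, u \in U & H u v) (touches U v).
Proof.
by apply: (iffP existsP) => [[u /andP[]]|[u uU uv]]; exists u => //; rewrite uU.
Qed.

Lemma connected_inU U v : connected_in U -> touches U v -> connected_in (v |: U)%SET.
Proof.
move=> conU /touchesP[u uU uv].
have sub : subrel (connect (within U)) (connect (within (v |: U)%SET)).
  apply: connect_sub => a b /and3P[aU bU ab]; apply: connect1.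
  by rewrite /within /= !in_setU1 aU bU ab !orbT.
have conv a : a \in U -> connect (within (v |: U)%SET) a v.
  move=> aU; have au : connect (within U) a u.
    by move/forallP: conU => /(_ a); rewrite aU => /forallP/(_ u); rewrite uU.
  apply: connect_trans (sub _ _ au) (connect1 _).
  by rewrite /within /= !in_setU1 uU eqxx uv orbT.
have csym := sym_connect_sym (@within_sym (v |: U)%SET).
apply/forallP => a; apply/implyP; rewrite in_setU1 => /predU1P aU.
apply/forallP => b; apply/implyP; rewrite in_setU1 => /predU1P bU.
case: aU bU => [->|aU] [->|bU]; [exact: connect0|by rewrite csym conv|exact: conv|].
by apply: connect_trans (conv _ aU) _; rewrite csym conv.
Qed.

(** A shortest path from [k] to [l] through [U] closes up with the edge [x y] to an induced cycle:
    [x] and [y] do not touch [U], and colours exclude the other chords. Its length is 4, so the path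
    is a single edge. *)
Lemma boundary_complete U k l x y : connected_in U -> touches U k -> touches U l ->
  k \notin U -> l \notin U -> ~~ touches U x -> ~~ touches U y -> x \notin U -> y \notin U ->
  H x y -> H x l -> H y k -> H k l.
Proof.
move=> conU tk tl kU lU tx ty xU yU xy xl yk.
have kl : k != l by apply: contraTneq xl => <-; apply: color_odd xy yk.
pose V := (k |: (l |: U))%SET.
have conV : connected_in V.
  apply: connected_inU; first exact: connected_inU.
  by case/touchesP: tk => u uU uk; apply/touchesP; exists u; rewrite // in_setU1 uU orbT.
have : connect (within V) k l.
  move/forallP: conV => /(_ k); rewrite !in_setU1 eqxx => /forallP/(_ l).
  by rewrite !in_setU1 eqxx orbT.
case/induced_path_exists => p [kp pl up ind].
have inV z : z \in k :: p -> z \in V.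
  rewrite inE => /predU1P[->|]; first by rewrite !in_setU1 eqxx.
  elim: p (k) kp {pl up ind} => // b p IH a /= /andP[/and3P[_ bV _] bp].
  by rewrite inE => /predU1P[->//|]; apply: IH bp.
have pV z : z \in k :: p -> [\/ z = k, z = l | z \in U].
  by move=> /inV; rewrite !in_setU1 => /or3P[/eqP->|/eqP->|];
    [constructor 1|constructor 2|constructor 3].
have far v : v \in U -> ~~ H x v /\ ~~ H y v.
  by move=> vU; split; rewrite Hsym;
    [apply: contra tx => h | apply: contra ty => h]; apply/touchesP; exists v.
have notp z : ~~ touches U z -> z \notin U -> z \notin k :: p.
  move=> tz zU; apply/negP => /pV[E0|E0|]; last exact/negP.
    by rewrite E0 tk in tz.
  by rewrite E0 tl in tz.
pose s := [:: x, y, k & p].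
have p0 : (0 < size p)%N by case: (p) pl kl => //= ->; rewrite eqxx.
have us : uniq s.
  rewrite /s cons_uniq cons_uniq up inE negb_or !notp //= andbT andbT.
  by apply: contraTneq xy => ->; rewrite color_irr.
have lE : nth k (k :: p) (size p) = l by rewrite -pl -nth_last; case: (p) p0.
have indS : induced_cycle H s.
  apply: (@induced_cycle_of_nth _ k) => //; first exact: color_irr.
    case=> [|[|i]] /=; rewrite ?ltnS => isz.
    - by [].
    - by rewrite ?modn_small ?ltnS.
    move: isz; rewrite leq_eqVlt => /orP[/eqP->|isz].
      by rewrite modnn /= lE Hsym.
    rewrite modn_small ?ltnS //=.
    by have /pathP := kp => /(_ k i isz) /and3P[].
  move=> i j /andP[]; case: i => [|[|i]]; case: j => [|[|j]] //= ij jp h; try by left.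
  - right; split=> //; have zin : nth k (k :: p) j \in k :: p by rewrite mem_nth.
    case: (pV _ zin) => [zE|zE|/far[]]; last by rewrite h.
      by have := color_odd xy yk; rewrite -zE h.
    have jk : (j < size (k :: p))%N by [].
    have lk : (size p < size (k :: p))%N by [].
    by congr _.+2; apply/eqP; rewrite -(nth_uniq k jk lk up) zE lE.
  - case: j => [|j] in ij jp h *; first by left.
    have zin : nth k (k :: p) j.+1 \in k :: p by rewrite mem_nth.
    case: (pV _ zin) => [zE|zE|/far[_]]; last by rewrite h.
      have jk : (j.+1 < size (k :: p))%N by [].
      by have := nth_uniq k jk (ltn0Sn _) up; rewrite zE /= eqxx.
    have yx : H y x by rewrite Hsym.
    by have := color_odd yx xl; rewrite -zE h.
  have ij' : (i < j)%N by exact: ij.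
  have jp' : (j <= size p)%N by exact: jp.
  left; congr _.+2; apply: ind; first by rewrite ij' jp'.
  by rewrite /within /= h !inV // mem_nth //= ltnS // (leq_trans (ltnW ij')).
have := H4 indS; rewrite /s /= => -[sp]; move: pl kp.
by case: (p) sp => [|a []] //= _ -> /andP[/and3P[]].
Qed.

(* A maximal connected [U] whose far side [Z] still contains an edge: by
   maximality every vertex of the boundary of [U] is adjacent to all
   non-isolated vertices of [Z] on the other side, and the boundary is complete
   bipartite, so a bisimplicial edge of [Z] is one of [W]. *)
Lemma bisimplicial_in W : has_edge W -> exists x y, [/\ x \in W, y \in W, H x y
  & forall k l, k \in W -> l \in W -> H x l -> H y k -> H k l].
Proof.
have [N] := ubnP #|W|; elim: N W => // N IH W; rewrite ltnS => WN edgeW.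
pose P U := [&& U \subset W, U != finset.set0, connected_in U & has_edge (far_from U W)].
have [|no] := pselect (exists U, P U); last first.
  (* Here every edge is bisimplicial: if [k] and [l] were not adjacent, the singleton of [k] would
     be a connected set with the edge [a l] on its far side. *)
  have [a [b [aW bW ab]]] := has_edgeP _ edgeW; exists a, b; split=> // k l kW lW al bk.
  apply/negPn/negP => nkl; apply: no; exists [set k]%SET; apply/and4P; split.
  - by rewrite finset.sub1set.
  - by apply/finset.set0Pn; exists k; apply: finset.set11.
  - apply/forallP => z; apply/implyP => /finset.set1P->; apply/forallP => z'.
    by apply/implyP => /finset.set1P->; apply: connect0.
  have ba : H b a by rewrite Hsym.
  apply/has_edgeP; exists a, l; split=> //; rewrite !inE ?aW ?lW /=.
    apply/andP; split; first by apply: contraNneq nkl => <-.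
    apply/touchesP => -[u /finset.set1P->]; apply/negP; rewrite Hsym in bk.
    by apply: color_odd bk ba.
  apply/andP; split.
    by apply: contraTneq bk => <-; apply: color_odd ba al.
  by apply/touchesP => -[u /finset.set1P->]; apply/negP.
case=> U0 PU0.
have [U /and4P[UW U0' conU edgeU] Umax] := @arg_maxnP _ U0 P (fun U => #|U|) PU0.
set Z := far_from U W in edgeU.
have ZP v : v \in Z -> [/\ v \in W, v \notin U & ~~ touches U v].
  by rewrite inE => /andP[-> /andP[-> ->]].
have ZW : (#|Z| < N)%N.
  apply: leq_trans WN; apply: proper_card; apply/properP; split.
    by apply/fintype.subsetP => v /ZP[].
  have /finset.set0Pn[u uU] := U0'; exists u; first exact: (fintype.subsetP UW).
  by apply/negP => /ZP[_ /negP].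
have [x [y [xZ yZ xy bis]]] := IH Z ZW edgeU.
have [xW xU tx] := ZP _ xZ; have [yW yU ty] := ZP _ yZ.
(* Otherwise [v] could be added to [U], and the edge [a b] would still be far away, against
   maximality. *)
have boundary v a b : v \in W -> touches U v -> v \notin U -> a \in Z -> b \in Z -> H a b ->
    H v a \/ H v b.
  move=> vW tv vU aZ bZ ab; apply: contrapT => no.
  have [aW aU ta] := ZP _ aZ; have [bW bU tb] := ZP _ bZ.
  have : P (v |: U)%SET.
    apply/and4P; split; first by rewrite finset.subUset finset.sub1set vW.
    - by apply/finset.set0Pn; exists v; rewrite in_setU1 eqxx.
    - exact: connected_inU.
    have far z : z \in W -> z \notin U -> ~~ touches U z -> ~~ H v z -> z != v ->
        z \in far_from (v |: U)%SET W.
      move=> zW zU tz vz zv; rewrite inE zW in_setU1 (negPf zv) zU /=.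
      apply/touchesP => -[u /finset.setU1P[->|uU]]; first exact/negP.
      by move=> uz; case/negP: tz; apply/touchesP; exists u.
    apply/has_edgeP; exists a, b; split=> //; apply: far => //.
    - by apply/negP => h; apply: no; left.
    - by apply: contraNneq ta => ->.
    - by apply/negP => h; apply: no; right.
    - by apply: contraNneq tb => ->.
  by move/Umax; rewrite /= cardsU1 vU add1n ltnn.
have inU v a : a \notin U -> ~~ touches U a -> H a v -> v \notin U.
  by move=> aU ta av; apply: contra ta => vU; apply/touchesP; exists v; rewrite // Hsym.
exists x, y; split=> // k l kW lW xl yk.
have kU := inU _ _ yU ty yk; have lU := inU _ _ xU tx xl.
have yx : H y x by rewrite Hsym.
(* If only one of [k] and [l] touches [U], it is adjacent to an end of the far edge containing the
   other, and by colours that end is the other one. If neither does, both lie in [Z]. *)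
have [tk|tk] := boolP (touches U k); have [tl|tl] := boolP (touches U l).
- exact: (@boundary_complete U k l x y).
- have lZ : l \in Z by rewrite inE lW lU tl.
  case: (boundary k x l kW tk kU xZ lZ xl) => // kx.
  by have := color_odd xy yk; rewrite Hsym kx.
- have kZ : k \in Z by rewrite inE kW kU tk.
  case: (boundary l y k lW tl lU yZ kZ yk) => [ly|]; last by rewrite Hsym.
  by have := color_odd yx xl; rewrite Hsym ly.
- by apply: bis => //; rewrite inE ?kW ?lW ?kU ?lU ?tk ?tl.
Qed.

End Bisimplicial.
End InducedCycles.

(** * Elimination orders on the edges *)

Section EliminationOrder.
Variable n : nat.
Implicit Types (H : rel 'I_n).

(** A bisimplicial edge gets key 0 and the keys of the graph without it are shifted by one;
    [induced4_del] keeps the induction going. The values of [key] matter only on edges whose first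
    end has colour [c]. *)
Lemma elimination_order H (c : 'I_n -> bool) : ssrbool.symmetric H ->
  (forall a b, H a b -> c a != c b) -> induced4 H ->
  exists key : 'I_n -> 'I_n -> nat,
    (forall i j k l, c i -> c k -> H i j -> H k l -> key i j = key k l -> i = k /\ j = l) /\
    forall i j k l, c i -> c k -> H i j -> H i l -> H k j ->
      (key i j < key i l)%N -> (key i j < key k j)%N -> H k l /\ (key i j < key k l)%N.
Proof.
pose edges H := finset (fun p : 'I_n * 'I_n => H p.1 p.2).
have [N] := ubnP #|edges H|; elim: N H => // N IH H; rewrite ltnS => HN Hsym cP H4.
have [|no] := boolP (has_edge H [set: 'I_n]%SET); last first.
  have noH i j : ~~ H i j.
    by apply/negP => ij; case/negP: no; apply/has_edgeP; exists i, j; rewrite !inE.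
  exists (fun _ _ => 0%N); split=> i j k l _ _ ij; first by rewrite (negPf (noH i j)) in ij.
  by rewrite (negPf (noH i j)) in ij.
move=> /(bisimplicial_in Hsym cP H4)[x0 [y0 [_ _ xy0 bis0]]].
have [x [y [cx [xy bis]]]] : exists x y, c x /\ bisimplicial H x y.
  have [cx|cx] := boolP (c x0).
    by exists x0, y0; split=> //; split=> // k l; apply: bis0; rewrite inE.
  exists y0, x0; split; first by move: (cP _ _ xy0); rewrite (negPf cx); case: (c y0).
  split=> [|k l yl xk]; first by rewrite Hsym.
  by rewrite Hsym; apply: bis0; rewrite ?inE.
have cy : ~~ c y by move: (cP _ _ xy); rewrite cx; case: (c y).
have delE i j : c i -> H i j -> del_edge H x y i j = ~~ ((i == x) && (j == y)).
  move=> ci ij; rewrite /del_edge /= ij /=; congr (~~ _).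
  have [iy|_] := eqVneq i y; first by rewrite -iy ci in cy.
  by rewrite /= orbF.
have sub i j : del_edge H x y i j -> H i j by case/andP.
have [||||key [kinj kfill]] := IH (del_edge H x y).
- apply: leq_trans HN; apply: proper_card; apply/properP; split.
    by apply/fintype.subsetP => p; rewrite !inE => /sub.
  by exists (x, y); rewrite !inE //= /del_edge /= !eqxx /= andbF.
- exact: del_edge_sym.
- by move=> a b /sub; apply: cP.
- exact: induced4_del cP (conj xy bis) H4.
exists (fun i j => if (i == x) && (j == y) then 0%N else (key i j).+1); split.
  move=> i j k l ci ck ij kl.
  case: ifP => [/andP[/eqP-> /eqP->]|nij]; case: ifP => [/andP[/eqP-> /eqP->]|nkl] //.
  by case; apply: kinj => //; rewrite delE ?nij ?nkl.
move=> i j k l ci ck ij il kj.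
have [/andP[/eqP ix /eqP jy]|nij] := boolP ((i == x) && (j == y)).
  case: ifP => // nil _; case: ifP => // nkj _.
  split; first by apply: bis; [rewrite -ix | rewrite -jy Hsym].
  case: ifP => // /andP[_ ly]; move: nil; rewrite ix eqxx /= => nil.
  by rewrite nil in ly.
case: ifP => // nil; case: ifP => // nkj; rewrite !ltnS => lt1 lt2.
have dij : del_edge H x y i j by rewrite delE.
have dil : del_edge H x y i l by rewrite delE ?nil.
have dkj : del_edge H x y k j by rewrite delE ?nkj.
have [kl lt3] := kfill i j k l ci ck dij dil dkj lt1 lt2; split; first exact: sub kl.
case: ifP => [klxy|_ //]; have := kl; rewrite delE ?klxy //.
exact: sub kl.
Qed.

(** The added edges are eliminated after all edges of [H]. Then an edge at an added vertex is never
    the smallest corner, and a corner at an edge of [H] that uses an added vertex is filled by the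
    completeness of that vertex. *)
Lemma cone_elimination_key (e : rel 'I_n) (c : 'I_n -> bool) (m : nat)
    (ro co : 'I_m -> option 'I_n) :
  ssrbool.symmetric (compl_graph e) ->
  (forall a b, compl_graph e a b -> c a != c b) -> induced4 (compl_graph e) ->
  (forall i j, ro i = ro j -> co i = co j -> i = j) ->
  (forall i, cone_adj e c (ro i) (co i)) ->
  (forall r q, cone_adj e c r q -> exists i, ro i = r /\ co i = q) ->
  exists2 key : 'I_m -> nat, injective key & forall i j k, corner ro co key i j k ->
    exists h, [/\ ro h = ro k, co h = co j & (key i < key h)%N].
Proof.
move=> Hsym cP H4 inj adj surj.
have [key [kinj kfill]] := elimination_order Hsym cP H4.
pose M := (\max_(x < n) \max_(y < n) (key x y).+1)%N.
have keyM x y : (key x y < M)%N.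
  rewrite /M (bigD1 x) //= leq_max; apply/orP; left.
  by rewrite (bigD1 y) //= leq_maxl.
(* [M] exceeds all keys of [H], and the summands [n] keep the ranges of the added edges disjoint. *)
pose vk (r q : option 'I_n) : nat := match r, q with
  | Some x, Some y => key x y | Some x, None => (M + x)%N
  | None, Some y => (M + n + y)%N | None, None => (M + n + n)%N end.
have row_ok x q : cone_adj e c (Some x) q -> c x by case/and3P.
have col_ok r y : cone_adj e c r (Some y) -> ~~ c y by case/and3P.
have edge x y : cone_adj e c (Some x) (Some y) -> [/\ c x, ~~ c y & compl_graph e x y].
  by case/and3P.
exists (fun i => vk (ro i) (co i)).
  move=> i j E0; have [ai aj] := (adj i, adj j).
  suff [rE cE] : ro i = ro j /\ co i = co j by apply: inj.
  move: ai aj E0; case: (ro i) (ro j) (co i) (co j) => [x|] [x'|] [y|] [y'|] //= ai aj E0.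
  - have [cx _ xy] := edge _ _ ai; have [cx' _ xy'] := edge _ _ aj.
    by have [-> ->] := kinj _ _ _ _ cx cx' xy xy' E0.
  - by have := keyM x y; clear -E0; lia.
  - by have := keyM x' y'; clear -E0; lia.
  - by move/addnI/val_inj: E0 => ->.
  - by have := keyM x y; clear -E0; lia.
  - by have := keyM x y; clear -E0; lia.
  - by have := ltn_ord x; clear -E0; lia.
  - by have := ltn_ord x; clear -E0; lia.
  - by have := keyM x' y'; clear -E0; lia.
  - by have := ltn_ord x'; clear -E0; lia.
  - by have := keyM x' y'; clear -E0; lia.
  - by have := ltn_ord x'; clear -E0; lia.
  - by move/addnI/val_inj: E0 => ->.
  - by have := ltn_ord y; clear -E0; lia.
  - by have := ltn_ord y'; clear -E0; lia.
move=> i j k /and4P[/eqP rj /eqP ck]; have [[ai aj] ak] := (adj i, adj j, adj k).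
suff h : (vk (ro i) (co i) < vk (ro i) (co j))%N -> (vk (ro i) (co i) < vk (ro k) (co i))%N ->
    cone_adj e c (ro k) (co j) /\ (vk (ro i) (co i) < vk (ro k) (co j))%N.
  rewrite rj ck => lt1 lt2; have [a lt3] := h lt1 lt2; have [p [rp cp]] := surj _ _ a.
  by exists p; rewrite rp cp.
move: ai aj ak; rewrite rj ck.
case: (ro i) (co i) => [x|] [y|] ai; last first.
- case: (co j) => [l|] _ _ /=; last by rewrite ltnn.
  by have := ltn_ord l; clear; lia.
- case: (ro k) => [z|] _ ak /= _; last by rewrite ltnn.
  by have := keyM z y; clear; lia.
- case: (co j) => [l|] aj _ /=; last by rewrite ltnn.
  by have := keyM x l; clear; lia.
have [cx cy xy] := edge _ _ ai.
have kM := keyM x y.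
case: (ro k) (co j) => [z|] [l|] aj ak /= lt1 lt2.
- have [_ cl xl] := edge _ _ aj; have [cz _ zy] := edge _ _ ak.
  have [zl lt3] := kfill _ _ _ _ cx cz xy xl zy lt1 lt2.
  by split=> //; rewrite /cone_adj cz cl zl.
- by split; [rewrite /cone_adj (row_ok _ _ ak) | clear -kM; lia].
- by split; [rewrite /cone_adj (col_ok _ _ aj) | clear -kM; lia].
- by split=> //; clear -kM; lia.
Qed.

End EliminationOrder.

(** * Alternating cycles *)

Section CycleFibers.
Variables (m : nat) (X Y : finType) (ro : 'I_m -> X) (co : 'I_m -> Y).
Hypothesis ends_inj : forall i j, ro i = ro j -> co i = co j -> i = j.
Implicit Types (u v w : 'X_{1..m}) (h i j : 'I_m).

Lemma row_deg_bigsum (J : Type) (s : seq J) (P : pred J) (f : J -> 'X_{1..m}) x :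
  row_deg ro (\sum_(j <- s | P j) f j)%MM x = (\sum_(j <- s | P j) row_deg ro (f j) x)%N.
Proof.
elim/big_rec2: _ => [|j y1 y2 _ <-]; last by rewrite row_degD.
by rewrite /row_deg big1 // => i _; rewrite mnm0E.
Qed.

Lemma col_deg_bigsum (J : Type) (s : seq J) (P : pred J) (f : J -> 'X_{1..m}) y :
  col_deg co (\sum_(j <- s | P j) f j)%MM y = (\sum_(j <- s | P j) col_deg co (f j) y)%N.
Proof.
elim/big_rec2: _ => [|j y1 y2 _ <-]; last by rewrite col_degD.
by rewrite /col_deg big1 // => i _; rewrite mnm0E.
Qed.

Lemma row_deg_supp u i : u i != 0%N -> row_deg ro u (ro i) != 0%N.
Proof. by move=> ui; rewrite /row_deg (bigD1 i) //= addn_eq0 (negPf ui). Qed.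

Lemma col_deg_supp u i : u i != 0%N -> col_deg co u (co i) != 0%N.
Proof. by move=> ui; rewrite /col_deg (bigD1 i) //= addn_eq0 (negPf ui). Qed.

Lemma row_deg_neq0 u x : row_deg ro u x != 0%N -> exists i, ro i = x /\ u i != 0%N.
Proof.
move=> h; apply: contrapT => no; case/eqP: h; apply: big1 => i /eqP ix.
by apply/eqP/negPn/negP => ui; apply: no; exists i.
Qed.

Lemma col_deg_neq0 u y : col_deg co u y != 0%N -> exists i, co i = y /\ u i != 0%N.
Proof.
move=> h; apply: contrapT => no; case/eqP: h; apply: big1 => i /eqP ix.
by apply/eqP/negPn/negP => ui; apply: no; exists i.
Qed.

(* [f] and [g] are the two perfect matchings of a cycle with rows [r] and
   columns [q]. *)
Definition alternating t (r : 'I_t -> X) (q : 'I_t -> Y) (f g : 'I_t -> 'I_m) : Prop :=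
  [/\ injective r, injective q, forall s, ro (f s) = r s /\ co (f s) = q s
    & forall s, ro (g s) = r (ordS s) /\ co (g s) = q s].

Section TwoFiber.
Variables (k : nat) (r : 'I_k.+2 -> X) (q : 'I_k.+2 -> Y) (f g : 'I_k.+2 -> 'I_m).
Hypothesis alt : alternating r q f g.
Hypothesis chordless : forall h a b, ro h = r a -> co h = q b -> a = b \/ a = ordS b.
Let u := (\sum_s U_(f s))%MM.
Let v := (\sum_s U_(g s))%MM.

Lemma ordS_neq s : ordS s != s :> 'I_k.+2.
Proof.
apply/eqP => /(congr1 val) /=; have := ltn_ord s; rewrite leq_eqVlt => /orP[/eqP E0|lt0].
  by rewrite E0 modnn => E1; move: E0; rewrite -E1.
by rewrite modn_small // => /eqP; rewrite eqn_leq ltnn.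
Qed.

Lemma alternating_neq a b : f a <> g b.
Proof.
case: alt => r_inj q_inj fE gE E0; have [fa1 fa2] := fE a; have [gb1 gb2] := gE b.
have ab : a = b by apply: q_inj; rewrite -fa2 -gb2 E0.
have /eqP := ordS_neq b; apply; rewrite -{2}ab; apply: r_inj.
by rewrite -gb1 -fa1 E0.
Qed.

Lemma f_inj : injective f.
Proof. by case: alt => r_inj _ fE _ a b E0; apply: r_inj; rewrite -(fE a).1 -(fE b).1 E0. Qed.

Lemma g_inj : injective g.
Proof. by case: alt => _ q_inj _ gE a b E0; apply: q_inj; rewrite -(gE a).2 -(gE b).2 E0. Qed.

Lemma matching_f a : u (f a) = 1%N.
Proof.
rewrite mnm_sumE (bigD1 a) //= mnm1E eqxx big1 // => b ba.
by rewrite mnm1E (inj_eq f_inj) (negPf ba).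
Qed.

Lemma matching_g a : v (g a) = 1%N.
Proof.
rewrite mnm_sumE (bigD1 a) //= mnm1E eqxx big1 // => b ba.
by rewrite mnm1E (inj_eq g_inj) (negPf ba).
Qed.

Lemma matching_f0 i : (forall a, i <> f a) -> u i = 0%N.
Proof. by move=> h; rewrite mnm_sumE big1 // => a _; rewrite mnm1E; case: eqP => // /esym/h. Qed.

Lemma matching_g0 i : (forall a, i <> g a) -> v i = 0%N.
Proof. by move=> h; rewrite mnm_sumE big1 // => a _; rewrite mnm1E; case: eqP => // /esym/h. Qed.

Lemma matching_mdeg : mdeg u = k.+2.
Proof.
by rewrite mdeg_sum (eq_bigr (fun=> 1%N)) ?sum1_card ?card_ord // => s _; rewrite mdeg1.
Qed.

Lemma matching_coprime i : u i = 0%N \/ v i = 0%N.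
Proof.
have [[a ->]|no] := pselect (exists a, i = f a).
  by right; apply: matching_g0 => b; apply: alternating_neq.
by left; apply: matching_f0 => a E0; apply: no; exists a.
Qed.

Lemma matching_neq : u != v.
Proof.
apply/eqP => uv; have [] := matching_coprime (f ord0); rewrite -?uv matching_f //.
Qed.

Lemma matching_vertex_deg : vertex_deg ro co u = vertex_deg ro co v.
Proof.
case: alt => _ _ fE gE; apply/vertex_degP; split=> z.
  rewrite !row_deg_bigsum [LHS](reindex_inj (@ordS_inj _)) /=; apply: eq_bigr => s _.
  by rewrite !row_degU (fE _).1 (gE s).1.
rewrite !col_deg_bigsum; apply: eq_bigr => s _.
by rewrite !col_degU (fE s).2 (gE s).2.
Qed.

(** Vertex degrees confine [w] to edges between vertices of the cycle, hence to the cycle itself.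
    Each vertex has degree 1, so multiplicities along the cycle alternate between a value and its
    complement to 1. *)
Lemma matching_two_fiber w : vertex_deg ro co w = vertex_deg ro co u -> w = u \/ w = v.
Proof.
case: (alt) => r_inj q_inj fE gE /vertex_degP[h1 h2].
have supp i : w i != 0%N -> (exists a, i = f a) \/ (exists a, i = g a).
  move=> wi; have [a ra] : exists a, ro i = r a.
    have := row_deg_supp wi; rewrite h1 => /row_deg_neq0[j [jE uj]].
    apply: contrapT => no; case/eqP: uj; apply: matching_f0 => a ja.
    by apply: no; exists a; rewrite -jE ja (fE a).1.
  have [b qb] : exists b, co i = q b.
    have := col_deg_supp wi; rewrite h2 => /col_deg_neq0[j [jE uj]].
    apply: contrapT => no; case/eqP: uj; apply: matching_f0 => b jb.
    by apply: no; exists b; rewrite -jE jb (fE b).2.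
  case: (chordless ra qb) => ab; [left; exists a|right; exists b]; apply: ends_inj.
  - by rewrite ra (fE a).1.
  - by rewrite qb (fE a).2 ab.
  - by rewrite ra (gE b).1 ab.
  - by rewrite qb (gE b).2.
have colb b : (w (f b) + w (g b))%N = 1%N.
  have <- : col_deg co u (q b) = 1%N.
    rewrite col_deg_bigsum (bigD1 b) //= col_degU (fE b).2 eqxx big1 // => a ab.
    by rewrite col_degU (fE a).2 (inj_eq q_inj) (negPf ab).
  rewrite -h2 /col_deg (bigD1 (f b)) ?(fE b).2 //= (bigD1 (g b)) /=; last first.
    by rewrite (gE b).2 eqxx; apply/eqP => /esym; apply: alternating_neq.
  rewrite big1 ?addn0 // => i /andP[/andP[/eqP ib if_] ig].
  apply/eqP/negPn/negP => /supp[] [a ia].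
    by case/eqP: if_; rewrite ia; congr f; apply: q_inj; rewrite -ib ia (fE a).2.
  by case/eqP: ig; rewrite ia; congr g; apply: q_inj; rewrite -ib ia (gE a).2.
have rowb b : (w (f (ordS b)) + w (g b))%N = 1%N.
  have <- : row_deg ro u (r (ordS b)) = 1%N.
    rewrite row_deg_bigsum (bigD1 (ordS b)) //= row_degU (fE _).1 eqxx big1 // => a ab.
    by rewrite row_degU (fE a).1 (inj_eq r_inj) (negPf ab).
  rewrite -h1 /row_deg (bigD1 (f (ordS b))) ?(fE _).1 //= (bigD1 (g b)) /=; last first.
    by rewrite (gE b).1 eqxx; apply/eqP => /esym; apply: alternating_neq.
  rewrite big1 ?addn0 // => i /andP[/andP[/eqP ib if_] ig].
  apply/eqP/negPn/negP => /supp[] [a ia].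
    by case/eqP: if_; rewrite ia; congr f; apply: r_inj; rewrite -ib ia (fE a).1.
  case/eqP: ig; rewrite ia; congr g; apply: (@ordS_inj k.+2); apply: r_inj.
  by rewrite -ib ia (gE a).1.
have const b : w (f b) = w (f ord0).
  case: b => b; elim: b => [|b IH] bk; first by congr (w (f _)); apply: val_inj.
  have bk' : (b < k.+2)%N by apply: ltnW.
  rewrite -(IH bk'); have -> : Ordinal bk = ordS (Ordinal bk').
    by apply: val_inj; rewrite /= modn_small.
  by apply/eqP; rewrite -(eqn_add2r (w (g (Ordinal bk')))) rowb colb.
have [w0|w0] : w (f ord0) = 1%N \/ w (f ord0) = 0%N.
  by have := colb ord0; case: (w (f ord0)) => [|[|x]]; [right|left|].
- left; apply/mnmP => i; have [[a ->]|nf] := pselect (exists a, i = f a).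
    by rewrite matching_f const.
  rewrite matching_f0 => [|a E0]; last by apply: nf; exists a.
  apply/eqP/negPn/negP => wi; case: (supp i wi) => // -[a ia].
  by move: wi; rewrite ia; have := colb a; rewrite const w0; case: (w (g a)).
right; apply/mnmP => i; have [[a ->]|ng] := pselect (exists a, i = g a).
  by rewrite matching_g; have := colb a; rewrite const w0 add0n.
rewrite matching_g0 => [|a E0]; last by apply: ng; exists a.
apply/eqP/negPn/negP => wi; case: (supp i wi) => // -[a ia].
by move: wi; rewrite ia const w0.
Qed.

End TwoFiber.

Section Connectivity.
Variable k : nat.
Hypothesis chord : forall t (r : 'I_t -> X) (q : 'I_t -> Y) f g, (k < t)%N ->
  alternating r q f g -> exists h a b, [/\ ro h = r a, co h = q b, a <> b & a <> ordS b].

Lemma supp_bigsum t (f : nat -> 'I_m) i (P : pred nat) :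
  (\sum_(s < t | P s) U_(f s))%MM i != 0%N <-> exists s : nat, [/\ (s < t)%N, P s & f s = i].
Proof.
rewrite mnm_sumE; split=> [h|[s [st Ps <-]]]; last first.
  by rewrite (bigD1 (Ordinal st)) //= mnm1E eqxx.
apply: contrapT => no; case/eqP: h; apply: big1 => s Ps; rewrite mnm1E.
by case: eqP => // E0; case: no; exists s.
Qed.

Lemma sum_distinct_le t (f : nat -> 'I_m) u :
  (forall a b, (a < t)%N -> (b < t)%N -> f a = f b -> a = b) ->
  (forall s, (s < t)%N -> u (f s) != 0%N) -> (\sum_(s < t) U_(f s) <= u)%MM.
Proof.
move=> inj uf; apply/mnm_lepP => i; rewrite mnm_sumE.
have [[s [st <-]]|no] := pselect (exists s, (s < t)%N /\ f s = i).
  rewrite (bigD1 (Ordinal st)) //= mnm1E eqxx big1 => [|a /eqP as_]; first by rewrite lt0n uf.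
  rewrite mnm1E; case: eqP => // E0; case: as_; apply: val_inj => /=.
  by apply: inj => //; apply: ltn_ord.
rewrite big1 // => a _; rewrite mnm1E; case: eqP => // E0.
by case: no; exists a; split=> //; apply: ltn_ord.
Qed.

Lemma lem_mdeg_eq u v : (u <= v)%MM -> mdeg u = mdeg v -> u = v.
Proof.
case/lem_exists => w ->; rewrite mdegD => /eqP; rewrite -[X in X == _]add0n eqn_add2r.
by rewrite eq_sym mdeg_eq0 => /eqP->; rewrite add0m.
Qed.

Section Middle.
Variables (u v : 'X_{1..m}).
Hypothesis uvE : vertex_deg ro co u = vertex_deg ro co v.
Hypothesis k_lt : (k < mdeg u)%N.

(* Alternating between edges of [u] and [v] eventually closes up into an
   alternating cycle; exchanging it, or one of the two parts in which a chord
   splits it, gives a monomial which has a variable in common with [u] and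
   another one with [v]. *)
Lemma middle_monomial : exists w, vertex_deg ro co w = vertex_deg ro co u /\
  (exists i, u i != 0%N /\ w i != 0%N) /\ (exists i, w i != 0%N /\ v i != 0%N).
Proof.
have [h1 h2] := (vertex_degP _ _ _ _).1 uvE.
have [i0 ui0] : exists i, u i != 0%N.
  apply: contrapT => no; suff u0 : u = 0%MM by move: k_lt; rewrite u0 mdeg0.
  by apply/mnmP => i; rewrite mnm0E; apply/eqP/negPn/negP => ui; apply: no; exists i.
have /choice[ur urP] x : exists i, row_deg ro u x != 0%N -> ro i = x /\ u i != 0%N.
  have [/row_deg_neq0[i]|] := pselect (row_deg ro u x != 0%N); first by exists i.
  by exists i0.
have /choice[vc vcP] y : exists i, col_deg co u y != 0%N -> co i = y /\ v i != 0%N.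
  have [|] := pselect (col_deg co u y != 0%N); last by exists i0.
  by rewrite h2 => /col_deg_neq0[i ?]; exists i.
(* One step of the walk: leave row [x] along an edge of [u], and return to a row along an edge of
   [v] in the column reached. *)
pose F x := ro (vc (co (ur x))).
have step x : row_deg ro u x != 0%N ->
    [/\ ro (ur x) = x, u (ur x) != 0%N, co (vc (co (ur x))) = co (ur x),
        v (vc (co (ur x))) != 0%N & row_deg ro u (F x) != 0%N].
  move=> /urP[h3 h4]; have [h5 h6] := vcP _ (col_deg_supp h4).
  by split=> //; rewrite h1; apply: row_deg_supp.
have live x s : row_deg ro u x != 0%N -> row_deg ro u (iter s F x) != 0%N.
  by move=> xl; elim: s => //= s /step[].
(* There are finitely many rows, so the walk becomes periodic; the least period makes the rows of
   the closed part distinct. *)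
have [x [t [xl t0 tF tmin]]] : exists x t, [/\ row_deg ro u x != 0%N, (0 < t)%N,
    iter t F x = x & forall s, (0 < s < t)%N -> iter s F x <> x].
  have [a [b [ab abE]]] : exists a b, (a < b)%N /\ iter a F (ro i0) = iter b F (ro i0).
    apply: contrapT => no.
    have inj : injective (fun s : 'I_(#|X|.+1) => iter s F (ro i0)).
      move=> a b E0; apply: val_inj; have [lt0|lt0|//] := ltngtP (val a) (val b).
        by case: no; exists a, b.
      by case: no; exists b, a.
    by have := leq_card _ inj; rewrite card_ord ltnn.
  pose y := iter a F (ro i0).
  have exP : exists s, (0 < s)%N && (iter s F y == y).
    exists (b - a)%N; rewrite subn_gt0 ab /=; apply/eqP.
    by rewrite /y -iterD subnK ?(ltnW ab).
  case: (ex_minnP exP) => t /andP[t0 /eqP tE] tmin; exists y, t; split=> //.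
    by apply: live; apply: row_deg_supp.
  move=> s /andP[s0 st] sE; have := tmin s; rewrite s0 sE eqxx => /(_ isT).
  by rewrite leqNgt st.
have rinj0 y : iter t F y = y -> (forall s, (0 < s < t)%N -> iter s F y <> y) ->
    forall a b, (a < t)%N -> (b < t)%N -> iter a F y = iter b F y -> a = b.
  move=> yt ymin; have wlog_lt a b : (a < b)%N -> (b < t)%N -> iter a F y <> iter b F y.
    move=> ab bt E0; apply: (ymin (t - b + a)%N).
      by clear -ab bt; apply/andP; split; lia.
    by rewrite iterD E0 -iterD subnK ?(ltnW bt).
  move=> a b at_ bt E0; have [lt0|lt0|//] := ltngtP a b.
    by case: (wlog_lt a b).
  by case: (wlog_lt b a).
have rinj := rinj0 x tF tmin.
pose r s := iter s F x.
have rl s : row_deg ro u (r s) != 0%N by apply: live.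
pose f s := ur (r s).
pose q s := co (f s).
pose g s := vc (q s).
have fP s : [/\ ro (f s) = r s, u (f s) != 0%N, co (g s) = q s, v (g s) != 0%N
    & ro (g s) = r s.+1].
  by have [? ? ? ? _] := step _ (rl s).
have period s d : r (s + d * t)%N = r s.
  by elim: d => [|d IH]; rewrite ?addn0 // -IH mulSn addnCA addnC {1}/r iterD tF.
have rmod s : r (s %% t)%N = r s.
  by rewrite [in RHS](divn_eq s t) addnC period.
have r_eq a b : r a = r b -> a = b %[mod t].
  by move=> E0; apply: rinj; rewrite ?ltn_mod // -/(r _) -/(r _) !rmod.
(* Equal columns have the same chosen edge of [v] and hence the same next row, so the columns are
   distinct too. *)
have q_eq a b : q a = q b -> a = b %[mod t].
  move=> E0; have : a.+1 = b.+1 %[mod t].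
    apply: r_eq; have [_ _ _ _ <-] := fP a; have [_ _ _ _ <-] := fP b.
    by rewrite /g E0.
  by move/eqP; rewrite -addn1 -[b.+1]addn1 eqn_modDr => /eqP.
have f_eq a b : f a = f b -> a = b %[mod t].
  by move=> E0; apply: q_eq; rewrite /q E0.
have g_eq a b : g a = g b -> a = b %[mod t].
  by move=> E0; apply: q_eq; have [_ _ <- _ _] := fP a; have [_ _ <- _ _] := fP b; rewrite E0.
have shift_inj d (z : nat -> 'I_m) : (forall a b, z a = z b -> a = b %[mod t]) ->
    forall a b, (a < t)%N -> (b < t)%N -> z (d + a)%N = z (d + b)%N -> a = b.
  move=> zinj a b at_ bt /zinj/eqP; rewrite eqn_modDl => /eqP.
  by rewrite !modn_small.
(* The offset [d] only rotates the cycle; it is used to start at the row of a chord. *)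
pose uC d := (\sum_(s < t) U_(f (d + s)%N))%MM.
pose vC d := (\sum_(s < t) U_(g (d + s)%N))%MM.
have uCle d : (uC d <= u)%MM.
  apply: (sum_distinct_le (f := fun s => f (d + s)%N)); first exact: shift_inj.
  by move=> s _; have [] := fP (d + s)%N.
have vCle d : (vC d <= v)%MM.
  apply: (sum_distinct_le (f := fun s => g (d + s)%N)); first exact: shift_inj.
  by move=> s _; have [] := fP (d + s)%N.
have uC_mdeg d : mdeg (uC d) = t.
  by rewrite mdeg_sum (eq_bigr (fun=> 1%N)) ?sum1_card ?card_ord // => s _; rewrite mdeg1.
have uvC : vertex_deg ro co (uC 0%N) = vertex_deg ro co (vC 0%N).
  apply/vertex_degP; split=> z.
    rewrite !row_deg_bigsum.
    rewrite (eq_bigr (fun s : 'I_t => (r s == z) : nat)) => [|s _]; last first.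
      by rewrite row_degU; have [->] := fP s.
    rewrite [RHS](eq_bigr (fun s : 'I_t => (r s.+1 == z) : nat)) => [|s _]; last first.
      by rewrite row_degU; have [_ _ _ _ ->] := fP s.
    case: (t) t0 tF => // t' _ tF'; rewrite big_ord_recl [RHS]big_ord_recr /= addnC.
    by congr addn; rewrite /r -iterS tF'.
  rewrite !col_deg_bigsum; apply: eq_bigr => s _.
  by rewrite !col_degU; have [_ _ ->] := fP (0 + s)%N.
(* A cycle shorter than the degree of [u] is exchanged as a whole, and the rest of [u] remains in
   common. Otherwise the cycle is all of [u], so it is longer than [k] and has a chord. *)
have [lt_t|ge_t] := ltnP t (mdeg u).
  have [u' uE] := lem_exists (uCle 0%N); have [v' vE] := lem_exists (vCle 0%N).
  exists (u' + vC 0%N)%MM; split; [|split].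
  - by rewrite uE ![(u' + _)%MM]addmC; apply/vertex_deg_add.
  - have [i u'i] : exists i, u' i != 0%N.
      apply: contrapT => no; suff u'0 : u' = 0%MM by move: lt_t; rewrite uE u'0 add0m uC_mdeg ltnn.
      by apply/mnmP => i; rewrite mnm0E; apply/eqP/negPn/negP => ui; apply: no; exists i.
    by exists i; rewrite uE !mnmDE !addn_eq0 !(negPf u'i).
  exists (g 0%N); have [_ _ _ vg _] := fP 0%N; split=> //.
  rewrite mnmDE addn_eq0 negb_and; apply/orP; right.
  by apply/(supp_bigsum t (fun s => g (0 + s)%N) _ predT); exists 0%N; rewrite t0 addn0.
have ut d : uC d = u.
  apply: lem_mdeg_eq => //; apply/eqP; rewrite eqn_leq uC_mdeg ge_t andbT.
  have [u' uE] := lem_exists (uCle d); rewrite uE mdegD uC_mdeg leq_addl //.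
have tE : mdeg u = t by rewrite -(ut 0%N) uC_mdeg.
have [||h [a [b [ha hb ab aSb]]]] := chord (t := t) (r := fun s => r s) (q := fun s => q s)
    (f := fun s => f s) (g := fun s => g s).
- by rewrite -tE.
- split.
  + by move=> a b /r_eq; rewrite !modn_small // => /val_inj.
  + by move=> a b /q_eq; rewrite !modn_small // => /val_inj.
  + by move=> s; have [] := fP s.
  + by move=> s; have [_ _ ? _ ->] := fP s; rewrite /= rmod.
(* The number of steps along the cycle from the row of the chord to the row preceding its column. It
   is nonzero and [p.+1 < t] because the chord is not an edge of the cycle. *)
pose p := ((b + (t - a)) %% t)%N.
have pt : (p < t)%N by rewrite ltn_mod.
have rap : r (a + p)%N = r b.
  rewrite -rmod modnDmr addnCA subnKC ?modnDr ?modn_small ?ltn_ord ?(ltnW (ltn_ord a)) //.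
have rF s : F (r s) = r s.+1 by [].
have p0 : (0 < p)%N.
  rewrite lt0n; apply/eqP => pE; apply: ab; apply: val_inj.
  by move: rap; rewrite pE addn0 => /r_eq; rewrite !modn_small.
have p1 : (p.+1 < t)%N.
  rewrite ltn_neqAle pt andbT; apply/eqP => pE; apply: aSb; apply: val_inj => /=.
  have : r (a + p).+1 = r b.+1 by rewrite -!rF rap.
  by rewrite -addnS pE -[X in (a + X)%N]mul1n period => /r_eq; rewrite modn_small.
have split_sum (G : nat -> nat) :
    (\sum_(s < t) G s = \sum_(s < p) G s + G p + \sum_(s < t | (p < s)%N) G s)%N.
  rewrite (bigID (fun s : 'I_t => (s < p)%N)) /= (big_ord_widen t G (ltnW pt)) -addnA.
  congr addn; rewrite (bigD1 (Ordinal pt)) /= -?leqNgt //; congr addn.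
  by apply: eq_bigl => s; rewrite -leqNgt ltn_neqAle andbC -(inj_eq val_inj) /= eq_sym.
(* The [p.+1] edges of [u] on the arc are replaced by the chord and the [p] edges of [v] between
   them. Both an edge of [u] and an edge of [v] remain by the bounds on [p]. *)
exists (U_(h) + \sum_(s < p) U_(g (a + s)%N) + \sum_(s < t | (p < s)%N) U_(f (a + s)%N))%MM.
split; [|split].
- rewrite -(ut a); apply/vertex_degP; split=> z.
    rewrite !row_degD !row_deg_bigsum row_degU ha (split_sum (fun s => row_deg ro U_(f (a +
      s)%N) z)).
    congr addn.
    have fE s : row_deg ro U_(f (a + s)%N) z = (r (a + s)%N == z) by rewrite row_degU;
      have [->] := fP (a + s)%N.
    have gE s : row_deg ro U_(g (a + s)%N) z = (r (a + s.+1)%N == z).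
      by rewrite row_degU addnS; have [_ _ _ _ ->] := fP (a + s)%N.
    rewrite (eq_bigr (fun s : 'I_p => (r (a + s.+1)%N == z) : nat)) => [|s _]; last exact: gE.
    rewrite fE [in RHS](eq_bigr (fun s : 'I_p => (r (a + s)%N == z) : nat)) => [|s _];
      last exact: fE.
    transitivity (\sum_(s < p.+1) ((r (a + s)%N == z) : nat))%N; last by rewrite big_ord_recr.
    by rewrite big_ord_recl /= addn0.
  rewrite !col_degD !col_deg_bigsum col_degU hb (split_sum (fun s => col_deg co U_(f (a + s)%N) z)).
  congr addn; rewrite addnC; congr addn.
    by apply: eq_bigr => s _; rewrite !col_degU; have [_ _ ->] := fP (a + s)%N.
  by rewrite col_degU -/(q _) /q /f rap.
- exists (f (a + p.+1)%N); split; first by have [] := fP (a + p.+1)%N.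
  rewrite mnmDE addn_eq0 negb_and; apply/orP; right.
  by apply/(supp_bigsum t (fun s => f (a + s)%N) _ (fun s => p < s)%N); exists p.+1.
exists (g a); have [_ _ _ vg _] := fP a; split=> //.
rewrite !mnmDE !addn_eq0 !negb_and; apply/orP; left; apply/orP; right.
by apply/(supp_bigsum p (fun s => g (a + s)%N) _ predT); exists 0%N; rewrite addn0.
Qed.

End Middle.

(** Through the middle monomial, each difference is between monomials with a common variable;
    cancelling it lowers the degree. *)
Lemma fiber_connected (K : fieldType) (J : set {mpoly K[m]}) : is_ideal J ->
  (forall u v, vertex_deg ro co u = vertex_deg ro co v -> (mdeg u <= k)%N -> J ('X_[u] - 'X_[v])) ->
  forall u v, vertex_deg ro co u = vertex_deg ro co v -> J ('X_[u] - 'X_[v]).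
Proof.
move=> idJ Jk u v; have [d] := ubnP (mdeg u); elim: d u v => // d IH u v ud uvE.
have [/Jk|k_lt] := leqP (mdeg u) k; first exact.
have common a b : mdeg a = mdeg u -> vertex_deg ro co a = vertex_deg ro co b ->
    (exists i, a i != 0%N /\ b i != 0%N) -> J ('X_[a] - 'X_[b]).
  move=> ad abE [i [ai bi]].
  have [a' aE] : exists a', a = (a' + U_(i))%MM by apply: lem_exists; rewrite lep1mP.
  have [b' bE] : exists b', b = (b' + U_(i))%MM by apply: lem_exists; rewrite lep1mP.
  rewrite aE bE !mpolyXD -mulrBl mulrC; case: (idJ) => _ _; apply; apply: IH.
    by move: ud; rewrite -ad aE mdegD mdeg1 addn1.
  by move: abE; rewrite aE bE => /vertex_deg_add.
have [w [wE [uw wv]]] := middle_monomial uvE k_lt.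
have -> : 'X_[u] - 'X_[v] = ('X_[u] - 'X_[w]) + ('X_[w] - 'X_[v]) :> {mpoly K[m]} by rewrite
  addrA subrK.
case: (idJ) => _ JD _; apply: JD; apply: common => //.
- exact: (vertex_deg_mdeg wE).
- by rewrite wE.
Qed.

End Connectivity.
End CycleFibers.

(** * Induced cycles of the complement and their fibers *)

Section CyclesOfBipartiteGraphs.
Variables (n : nat) (H : rel 'I_n) (c : 'I_n -> bool).
Hypothesis Hsym : ssrbool.symmetric H.
Hypothesis cP : forall a b, H a b -> c a != c b.
Implicit Types s : seq 'I_n.

(** A shortest cycle is induced: rotated to start at [x], a chord [x y] would close up the part up
    to [y] to a shorter cycle. *)
Lemma has_induced_cycle : has_cycle H -> exists s, induced_cycle H s.
Proof.
case=> s0 gs0; pose P k := `[< exists2 s, graph_cycle H s & size s = k >].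
have exP : exists k, P k by exists (size s0); apply/asboolP; exists s0.
case: (ex_minnP exP) => k /asboolP[s gs szs] kmin; exists s.
have /andP[sz /andP[cyc us]] := gs; apply/induced_cycleP; split=> //.
  by move=> x xs; apply: next_cycle.
move=> x y xs ys xy; apply: contrapT => no.
have [i p sE] := rot_to xs.
have nE z : next s z = next (x :: p) z by rewrite -sE next_rot.
have up : uniq (x :: p) by rewrite -sE rot_uniq.
have cp : cycle H (x :: p) by rewrite -sE rot_cycle.
have yp : y \in p.
  have : y \in x :: p by rewrite -sE mem_rot.
  by rewrite inE => /predU1P[yx|//]; move: (cP xy); rewrite yx eqxx.
case/splitPr: yp nE sE up cp => p1 p2 nE sE up cp.
have p1_neq : p1 != [::].
  by apply/eqP => p1E; apply: no; left; rewrite nE p1E /= eqxx.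
have p2_neq : p2 != [::].
  apply/eqP => p2E; apply: no; right; rewrite nE next_nth.
  rewrite !(inE, mem_cat) eqxx !orbT; rewrite /= p2E; move: up; rewrite p2E /=.
  rewrite mem_cat !inE !negb_or cat_uniq /= => /andP[/andP[_ xy'] /and3P[_]].
  rewrite orbF => yp1 _; rewrite (negPf xy') index_cat (negPf yp1) /= eqxx addn0.
  by rewrite nth_default // size_cat addn1.
have : P (size (x :: rcons p1 y)).
  apply/asboolP; exists (x :: rcons p1 y) => //; apply/andP; split.
    by rewrite /= size_rcons !ltnS lt0n size_eq0.
  apply/andP; split.
    rewrite /= rcons_path last_rcons Hsym xy andbT rcons_path.
    move: cp; rewrite /= rcons_path cat_path /= => /andP[/and3P[-> -> _] _] //.
  by move: up; rewrite -cat_rcons -cat_cons cat_uniq => /andP[].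
move/kmin; rewrite -szs -(size_rot i s) sE /= size_rcons size_cat /= addnS !ltnS.
by rewrite -[X in (_ <= X)%N]addn0 leq_add2l leqn0 size_eq0 (negPf p2_neq).
Qed.

Lemma max_induced_cycle_exists : has_cycle H -> exists l, max_induced_cycle_length H l.
Proof.
case/has_induced_cycle => s0 is0.
pose P k := `[< exists2 s, induced_cycle H s & size s = k >].
have exP : exists k, P k by exists (size s0); apply/asboolP; exists s0.
have bound k : P k -> (k <= n)%N.
  case/asboolP => s /induced_cycleP[_ us _ _] <-.
  by rewrite -(card_uniqP us) -[X in (_ <= X)%N]card_ord max_card.
case: (ex_maxnP exP bound) => k /asboolP[s is_ sk] kmax; exists k; split; first by exists s.
by move=> s' is'; apply: kmax; apply/asboolP; exists s'.
Qed.

(* Starting an induced cycle at a row makes rows and columns alternate. *)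
Lemma induced_cycle_alternate s : induced_cycle H s -> exists t k,
  [/\ induced_cycle H t, size t = size s, size s = k.+2.*2
    & forall x0 i, (i < size t)%N -> c (nth x0 t i) = ~~ odd i].
Proof.
move=> is_; have [sz us nx ind] := induced_cycleP _ _ is_.
have [y ys cy] : exists2 y, y \in s & c y.
  case: (s) sz nx => // x p _ /(_ x (mem_head _ _)) nx'.
  have [cx|cx] := boolP (c x); first by exists x; rewrite ?mem_head.
  exists (next (x :: p) x); first by rewrite mem_next mem_head.
  by move: (cP nx'); rewrite (negPf cx); case: (c _).
have [i p sE] := rot_to ys; pose t := y :: p.
have it : induced_cycle H t.
  rewrite /t -sE; apply/induced_cycleP; rewrite size_rot rot_uniq; split=> //.
    by move=> x; rewrite mem_rot next_rot // => /nx.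
  by move=> x z; rewrite !mem_rot !next_rot //; apply: ind.
have st : size t = size s by rewrite /t -sE size_rot.
have [szt ut nxt _] := induced_cycleP _ _ it.
have alt x0 j : (j < size t)%N -> c (nth x0 t j) = ~~ odd j.
  elim: j => [//|j IH jt]; have jt' := ltnW jt.
  have := nxt _ (mem_nth x0 jt'); rewrite next_nth_mod // modn_small // => /cP.
  by rewrite IH //=; case: (odd j) (c _) => [] [].
have ev : ~~ odd (size t).
  case LE: (size t) szt alt nxt => [//|L] _ alt nxt.
  have jt : (L < size t)%N by rewrite LE.
  have := nxt _ (mem_nth y jt); rewrite next_nth_mod // LE modnn => /cP.
  by rewrite !alt //=; case: (odd L).
have tE : size t = (size t)./2.*2 by rewrite -[LHS]odd_double_half (negPf ev).
exists t; case hE : (size t)./2 tE => [|[|k]] tE; [by rewrite tE in szt|by rewrite tE in szt|].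
by exists k; split=> //; rewrite -st.
Qed.

End CyclesOfBipartiteGraphs.

Section ConeFibers.
Variables (n m : nat) (e : rel 'I_n) (c : 'I_n -> bool).
Variables (ro co : 'I_m -> option 'I_n).
Local Notation H := (compl_graph e).
Hypothesis Hsym : ssrbool.symmetric H.
Hypothesis cP : forall a b, H a b -> c a != c b.
Hypothesis ro_co_inj : forall i j, ro i = ro j -> co i = co j -> i = j.
Hypothesis adj : forall i, cone_adj e c (ro i) (co i).
Hypothesis surj : forall r q, cone_adj e c r q -> exists i, ro i = r /\ co i = q.

(** This is the only obstruction used: it bounds [mu] from below by [d], and for [d > 2] it refutes
    quadratic generation, Koszulness and quadratic Groebner bases. *)
Definition coprime_two_fiber (d : nat) : Prop := exists u v : 'X_{1..m},
  [/\ mdeg u = d, u != v /\ vertex_deg ro co u = vertex_deg ro co v,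
      forall w, vertex_deg ro co w = vertex_deg ro co u -> w = u \/ w = v
    & forall i, u i = 0%N \/ v i = 0%N].

Lemma cone_adj_edge x y : c x -> H x y -> cone_adj e c (Some x) (Some y).
Proof.
by move=> cx xy; rewrite /cone_adj cx xy andbT /=; move: (cP xy); rewrite cx; case: (c y).
Qed.

Lemma two_fiber_of_cycle k (r q : 'I_k.+2 -> option 'I_n) :
  injective r -> injective q ->
  (forall s, cone_adj e c (r s) (q s)) -> (forall s, cone_adj e c (r (ordS s)) (q s)) ->
  (forall a b, cone_adj e c (r a) (q b) -> a = b \/ a = ordS b) ->
  coprime_two_fiber k.+2.
Proof.
move=> r_inj q_inj fadj gadj chordless.
have /choice[f fP] s : exists i, ro i = r s /\ co i = q s := surj (fadj s).
have /choice[g gP] s : exists i, ro i = r (ordS s) /\ co i = q s := surj (gadj s).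
have alt : alternating ro co r q f g by split.
have nochord h a b : ro h = r a -> co h = q b -> a = b \/ a = ordS b.
  by move=> ha hb; apply: chordless; rewrite -ha -hb.
exists (\sum_s U_(f s))%MM, (\sum_s U_(g s))%MM; split.
- exact: matching_mdeg.
- by split; [apply: (matching_neq alt) | apply: (matching_vertex_deg alt)].
- by move=> w; apply: (matching_two_fiber ro_co_inj alt nochord).
- by move=> i; apply: (matching_coprime alt).
Qed.

(** An edge of the complement and the two added vertices form a 4-cycle, so degree 2 is needed even
    when the complement is a forest. With two rows and two columns no chord is possible. *)
Lemma two_fiber_of_edge x y : H x y -> coprime_two_fiber 2.
Proof.
move=> xy0; have [x' [y' [cx xy]]] : exists x' y', c x' /\ H x' y'.
  have [cx|cx] := boolP (c x); first by exists x, y.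
  exists y, x; split; last by rewrite Hsym.
  by move: (cP xy0); rewrite (negPf cx); case: (c y).
have a := cone_adj_edge cx xy.
apply: (@two_fiber_of_cycle 0 (fun s => if s == ord0 then None else Some x')
  (fun s => if s == ord0 then None else Some y')).
- by case=> [[|[|s]] ?] [[|[|t]] ?] //= _; apply: val_inj.
- by case=> [[|[|s]] ?] [[|[|t]] ?] //= _; apply: val_inj.
- by case=> [[|[|s]] ?].
- case=> [[|[|s]] ?] //=; first by case/and3P: a => h1 _ _; rewrite /cone_adj h1.
  by case/and3P: a => _ h1 _; rewrite /cone_adj h1.
- by case=> [[|[|s]] ?] [[|[|t]] ?] // _; (left + right); apply: val_inj.
Qed.

Lemma two_fiber_of_induced_cycle s : induced_cycle H s -> exists k,
  [/\ size s = k.*2, (2 <= k)%N & coprime_two_fiber k].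
Proof.
case/(induced_cycle_alternate cP) => t [k [it st sk alt]]; exists k.+2; split=> //.
have [szt ut nxt ind] := induced_cycleP _ _ it.
have x0 : 'I_n by case: (t) szt => // x.
have tE : size t = k.+2.*2 by rewrite st.
pose z i := nth x0 t i.
have ev (a : 'I_k.+2) : (a.*2 < size t)%N by rewrite tE ltn_double.
have od (a : 'I_k.+2) : (a.*2.+1 < size t)%N by rewrite tE ltn_Sdouble.
have modS (a : 'I_k.+2) : (a.*2.+2 %% size t)%N = (ordS a).*2.
  by rewrite tE -doubleS -!muln2 -muln_modl.
have zP i : (i < size t)%N -> H (z i) (z (i.+1 %% size t)%N).
  by move=> it'; have := nxt _ (mem_nth x0 it'); rewrite next_nth_mod.
have z_eq i j : (i < size t)%N -> (j < size t)%N -> z i = z j -> i = j.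
  by move=> it' jt' E0; apply/eqP; rewrite -(nth_uniq x0 it' jt' ut); apply/eqP.
have half_inj (a b : 'I_k.+2) : a.*2 = b.*2 -> a = b.
  by move=> E0; apply: val_inj; apply: double_inj.
apply: (@two_fiber_of_cycle k (fun a => Some (z a.*2)) (fun a => Some (z a.*2.+1))).
- by move=> a b [/z_eq E0]; apply: half_inj; apply: E0.
- by move=> a b [/z_eq E0]; apply: half_inj; have [] := E0 (od a) (od b).
- move=> a; apply: cone_adj_edge; first by rewrite alt ?odd_double.
  by have := zP _ (ev a); rewrite modn_small.
- move=> a; apply: cone_adj_edge; first by rewrite alt ?odd_double.
  by rewrite Hsym; have := zP _ (od a); rewrite modS.
move=> a b /and3P[_ _ /ind]; rewrite !mem_nth // => /(_ isT isT).
rewrite !next_nth_mod // modS (modn_small (od a)) => -[] /z_eq E0.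
  by left; apply: half_inj; have [] := E0 (od b) (od a).
by right; apply: half_inj; apply: E0.
Qed.

Lemma cone_chord k : (2 <= k)%N ->
  (forall s, induced_cycle H s -> (size s <= k.*2)%N) ->
  forall t (r q : 'I_t -> option 'I_n) f g, (k < t)%N -> alternating ro co r q f g ->
  exists h a b, [/\ ro h = r a, co h = q b, a <> b & a <> ordS b].
Proof.
move=> k2 maxk t r q f g kt [r_inj q_inj fP gP]; apply: contrapT => no.
have nochord a b : cone_adj e c (r a) (q b) -> a = b \/ a = ordS b.
  move=> /surj[h [ha hb]]; apply: contrapT => nab; apply: no; exists h, a, b.
  by split=> // E0; apply: nab; tauto.
have t3 : (2 < t)%N by apply: leq_trans kt.
case: t t3 kt r q f g r_inj q_inj fP gP no nochord => [|[|[|t]]] // _ kt r q f g r_inj q_inj fP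
  gP _ nochord.
(* With at least three rows, [ordS a] is a column not adjacent to row [a] along the cycle. If row
   [a] were the added one, it would have a chord there; the same works for the added column, so the
   cycle lies in [H]. *)
have ordSS_neq (a : 'I_t.+3) : ordS (ordS a) != a.
  apply/eqP => /(congr1 val) /=; rewrite -addn1 modnDml addn1 -addn2.
  move=> /eqP; rewrite -[X in _ == X](modn_small (ltn_ord a)) -[X in _ == (X %% _)%N]addn0.
  by rewrite eqn_modDl.
have rS a : exists x, r a = Some x.
  case rE: (r a) => [x|]; first by exists x.
  have ad : cone_adj e c (r a) (q (ordS a)).
    rewrite rE; have [_ <-] := fP (ordS a); have := adj (f (ordS a)).
    by rewrite /cone_adj; case: (co _) => //= y /and3P[_ ->].
  case: (nochord _ _ ad) => /esym/eqP; first by rewrite (negPf (ordS_neq _)).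
  by rewrite (negPf (ordSS_neq _)).
have qS b : exists y, q b = Some y.
  case qE: (q b) => [y|]; first by exists y.
  have ad : cone_adj e c (r (ordS (ordS b))) (q b).
    rewrite qE; have [<- _] := fP (ordS (ordS b)); have := adj (f (ordS (ordS b))).
    by rewrite /cone_adj; case: (ro _) => //= x /and3P[->].
  case: (nochord _ _ ad) => /eqP; first by rewrite (negPf (ordSS_neq _)).
  by rewrite (negPf (ordS_neq _)).
have /choice[R RP] := rS; have /choice[Q QP] := qS.
have fH a : [/\ c (R a), ~~ c (Q a) & H (R a) (Q a)].
  by have [fr fq] := fP a; have := adj (f a); rewrite fr fq RP QP => /and3P.
have gH a : H (R (ordS a)) (Q a).
  by have [gr gq] := gP a; have := adj (g a); rewrite gr gq RP QP => /and3P[].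
have HRQ a b : H (R a) (Q b) -> a = b \/ a = ordS b.
  move=> ab; apply: nochord; rewrite RP QP; apply: cone_adj_edge => //.
  by case: (fH a).
pose z i := if odd i then Q (inord i./2) else R (inord i./2).
have z_ev (a : 'I_t.+3) : z a.*2 = R a by rewrite /z odd_double doubleK inord_val.
have z_od (a : 'I_t.+3) : z a.*2.+1 = Q a.
  by rewrite /z /= odd_double /= uphalf_double inord_val.
have idx i : (i < t.+3.*2)%N -> exists a : 'I_t.+3, i = a.*2 \/ i = a.*2.+1.
  move=> it; have at_ : (i./2 < t.+3)%N by rewrite ltn_half_double.
  exists (Ordinal at_) => /=; have := odd_double_half i.
  by case: (odd i) => /= E0; [right|left]; apply/esym.
pose s := mkseq z t.+3.*2.
have szs : size s = t.+3.*2 by rewrite size_mkseq.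
have nthE i : (i < t.+3.*2)%N -> nth (R ord0) s i = z i by apply: nth_mkseq.
have us : uniq s.
  apply/mkseq_uniqP => i j; rewrite !inE => /idx[a [->|->]] /idx[b [->|->]];
    rewrite ?z_ev ?z_od => E0.
  - by congr _.*2; congr val; apply: r_inj; rewrite !RP E0.
  - by have [ca _ _] := fH a; have [_ cb _] := fH b; move: cb; rewrite -E0 ca.
  - by have [_ ca _] := fH a; have [cb _ _] := fH b; move: ca; rewrite E0 cb.
  - by congr _.*2.+1; congr val; apply: q_inj; rewrite !QP E0.
have ind : induced_cycle H s.
  apply: (induced_cycle_of_nth (x0 := R ord0)) => //.
  - exact: color_irr cP.
  - rewrite szs => i it; rewrite !nthE ?ltn_mod //.
    have [a iE] := idx _ it; case: iE it => -> it.
      by rewrite modn_small ?z_ev ?z_od ?ltn_Sdouble //; case: (fH a).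
    have -> : (a.*2.+2 %% t.+3.*2)%N = (ordS a).*2.
      by rewrite -doubleS -!muln2 -muln_modl.
    by rewrite z_ev z_od Hsym.
  rewrite szs => i j /andP[ij jt]; rewrite !nthE ?(ltn_trans ij) //.
  have [a iE] := idx _ (ltn_trans ij jt); have [b jE] := idx _ jt.
  case: iE jE ij jt => -> [] -> ij jt; rewrite ?z_ev ?z_od => h.
  - by move: (cP h); have [-> _ _] := fH a; have [-> _ _] := fH b.
  - case: (HRQ _ _ h) => [->|E0]; first by left.
    move: ij; rewrite E0 /= => ij.
    have := ltn_ord b; rewrite leq_eqVlt => /orP[/eqP bE|lt0].
      by right; rewrite bE modnn; split=> //; clear -bE; lia.
    by move: ij; rewrite modn_small //; clear; lia.
  - rewrite Hsym in h; case: (HRQ _ _ h) => E0; first by move: ij; rewrite E0; clear; lia.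
    left; have := ltn_ord a; rewrite leq_eqVlt => /orP[/eqP aE|lt0].
      by move: ij; rewrite E0 /= aE modnn.
    by rewrite E0 /= modn_small //; clear; lia.
  - by move: (cP h); have [_ /negPf-> _] := fH a; have [_ /negPf-> _] := fH b.
by have := maxk _ ind; rewrite szs leq_double leqNgt kt.
Qed.

(** Every generator but the one with both ends [None] has an end lying on no other edge, whose
    degree is the exponent. The total degree then fixes the last exponent. *)
Lemma edgeless_fibers u v : edgeless H -> vertex_deg ro co u = vertex_deg ro co v -> u = v.
Proof.
move=> noH uv; have [h1 h2] := (vertex_degP _ _ _ _).1 uv.
have row i x : ro i = Some x -> co i = None.
  move=> ri; case ci: (co i) => [y|] //; have := adj i; rewrite ri ci => /and3P[_ _].
  by rewrite (negPf (noH _ _)).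
have rowE w i x : ro i = Some x -> row_deg ro w (Some x) = w i.
  move=> ri; rewrite /row_deg (bigD1 i) ?ri //= big1 ?addn0 // => j /andP[/eqP rj ji].
  by case/eqP: ji; apply: ro_co_inj; [rewrite ri | rewrite (row _ _ rj) (row _ _ ri)].
have colE w i y : co i = Some y -> col_deg co w (Some y) = w i.
  have rN j : co j = Some y -> ro j = None.
    by move=> cj; case rj: (ro j) => [x|] //; rewrite (row _ _ rj) in cj.
  move=> ci; rewrite /col_deg (bigD1 i) ?ci //= big1 ?addn0 // => j /andP[/eqP cj ji].
  by case/eqP: ji; apply: ro_co_inj; [rewrite (rN _ ci) (rN _ cj) | rewrite ci].
have same i : ro i <> None \/ co i <> None -> u i = v i.
  case ri: (ro i) => [x|]; first by rewrite -(rowE u i x) // -(rowE v i x) // h1.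
  case ci: (co i) => [y|]; last by case.
  by rewrite -(colE u i y) // -(colE v i y) // h2.
apply/mnmP => i; case ri: (ro i) => [x|]; first by apply: same; rewrite ri; left.
case ci: (co i) => [y|]; first by apply: same; rewrite ci; right.
have := vertex_deg_mdeg uv; rewrite !mdegE (bigD1 i) //= [in RHS](bigD1 i) //=.
rewrite [X in (_ + X)%N = _](eq_bigr v) => [/eqP|j ji]; first by rewrite eqn_add2r => /eqP.
apply: same; case rj: (ro j) => [x|]; first by left.
case cj: (co j) => [y|]; first by right.
by case/eqP: ji; apply: ro_co_inj; rewrite ?ri ?rj ?ci ?cj.
Qed.

End ConeFibers.

(** * Degrees of generators and the final equivalences *)

Section Assembly.
Variables (K : fieldType) (n m : nat) (X Y : finType) (ro : 'I_m -> X) (co : 'I_m -> Y).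
Local Notation S := {mpoly K[m]}.
Variable I : set S.
Hypothesis fibI : fibered (vertex_deg ro co) I.

(** Connectivity is assumed for every ideal [J] so that it can be applied to the ideal generated by
    all fiber binomials of degree at most [k], a finite list. *)
Lemma fib_mu_is k :
  (forall u v, vertex_deg ro co u = vertex_deg ro co v ->
    forall J : set S, is_ideal J ->
    (forall u v, vertex_deg ro co u = vertex_deg ro co v -> (mdeg u <= k)%N -> J ('X_[u] -
      'X_[v])) ->
    J ('X_[u] - 'X_[v])) ->
  (forall B : seq S, ideal_gen [set` B] = I -> (0 < k)%N -> exists2 b, b \in B & (k <= tdeg b)%N) ->
  mu_is I k.
Proof.
move=> conn low.
pose B0 : seq S := [seq 'X_[val p.1] - 'X_[val p.2]
  | p <- enum {: 'X_{1..m < k.+1} * 'X_{1..m < k.+1}} &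
    (vertex_deg ro co (val p.1) == vertex_deg ro co (val p.2)) && (val p.1 != val p.2)].
have B0P f : f \in B0 -> exists u v, [/\ f = 'X_[u] - 'X_[v], u != v,
    vertex_deg ro co u = vertex_deg ro co v & (mdeg u <= k)%N].
  case/mapP => p; rewrite mem_filter => /andP[/andP[/eqP E0 neq] _] ->.
  by exists (val p.1), (val p.2); split=> //; rewrite -ltnS; apply: bmdeg.
apply: (mu_isP fibI (B0 := B0)) => //.
  move=> f /B0P[u [v [-> uv uvE uk]]]; split; first by exists u, v.
  by rewrite tdegX_sub // -(fib_deg fibI uvE) maxnn.
apply: (fib_gen fibI) => [f /= /B0P[u [v [-> _ uvE _]]]|u v uvE]; first exact: (fib_binom fibI).
apply: conn => //; first exact: ideal_gen_ideal.
move=> {u v uvE}u v uvE uk; have [->|uv] := eqVneq u v.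
  by rewrite subrr; case: (ideal_gen_ideal [set` B0]).
apply: ideal_gen_mem => /=; apply/mapP.
have ub : (mdeg u < k.+1)%N by [].
have vb : (mdeg v < k.+1)%N by rewrite -(fib_deg fibI uvE).
by exists (BMultinom ub, BMultinom vb) => //; rewrite mem_filter mem_enum /= uvE eqxx uv.
Qed.

(** Fibers in degree at most 1 are singletons, so a bound of 2 on the generators means degree
    exactly 2. *)
Lemma mu_le2_quadratic : (exists2 d, mu_is I d & (d <= 2)%N) -> gen_by_quadratic_binomials I.
Proof.
case=> d [[B mB] /(_ B mB) dE] d2; case: mB => bin gen _; exists B; split=> // f fB.
split; first exact: bin.
have If : I f by rewrite -gen; apply: ideal_gen_mem.
have [u [v [_ uv uvE fu]]] := fib_binom_homog fibI If (bin _ fB).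
apply/eqP; rewrite eqn_leq; apply/andP; split; last by rewrite fu;
  apply: (fib_msize_gt1 fibI uv uvE).
by apply: leq_trans d2; rewrite -dE (big_rem f) //= leq_maxl.
Qed.

End Assembly.

Theorem corollary3p4 (R : realType) (K : fieldType) (n : nat) (e : rel 'I_n)
    (e_sym : ssrbool.symmetric e) (e_irr : irreflexive e)
    (bip : bipartite (compl_graph e))
    (m : nat) (a : 'I_m -> 'rV[int]_n)
    (enum_a : lattice_enum (stable_set_polytope R e) a) :
  let H := compl_graph e in
  let I := toric_ideal K a in
  let mu_le2 := exists2 d, mu_is I d & (d <= 2)%N in
  [/\ edgeless H -> mu_is I 0,
      has_cycle H ->
        exists2 k, max_induced_cycle_length H (2 * k)%N & mu_is I k
    & ~ edgeless H -> ~ has_cycle H -> mu_is I 2]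
  /\
  [/\ mu_le2 <-> gen_by_quadratic_binomials I,
      mu_le2 <-> koszul (toric_ring K a) (toric_ring_deg K a),
      mu_le2 <-> has_quadratic_groebner_basis I
    & mu_le2 <-> (forall s, induced_cycle H s -> size s = 4%N)].
Proof.
case: bip => c cP H I mu_le2.
have Hsym : ssrbool.symmetric H by move=> x y; rewrite /H /compl_graph /= eq_sym e_sym.
pose ro := row_end c a; pose co := col_end c a.
have inj : forall i j, ro i = ro j -> co i = co j -> i = j := ends_inj cP enum_a.
have adj : forall i, cone_adj e c (ro i) (co i) := ends_adj cP enum_a.
have surj : forall r q, cone_adj e c r q -> exists i, ro i = r /\ co i = q :=
  cone_adj_ends e_sym cP enum_a.
have fibI : fibered (vertex_deg ro co) I.
  exact: (toric_ideal_fibered K (lattice_ends cP enum_a) (@row_end_side R n e c cP m a enum_a)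
    (@col_end_side R n e c cP m a enum_a) inj).
pose psi := toric_rmorphism K a.
have kerI f : I f <-> psi f = 0 by [].
have low d : coprime_two_fiber ro co d -> forall B : seq {mpoly K[m]},
    ideal_gen [set` B] = I -> exists2 b, b \in B & (d <= tdeg b)%N.
  by case=> u [v [<- [uv uvE] fibu cop]] B; apply: (two_fiber_mu_ge fibI uv uvE fibu cop).
have muk k : (2 <= k)%N -> (forall s, induced_cycle H s -> (size s <= k.*2)%N) ->
    coprime_two_fiber ro co k -> mu_is I k.
  move=> k2 maxk tfk; apply: (fib_mu_is fibI) => [u v uvE J idJ Jk|B gen _]; last exact: low gen.
  apply: (fiber_connected _ idJ Jk) uvE.
  exact: (cone_chord Hsym cP adj surj k2 maxk).
have mu0 : edgeless H -> mu_is I 0.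
  move=> noH; apply: (fib_mu_is fibI) => // u v uvE J [J0 _ _] _.
  by rewrite (edgeless_fibers inj adj noH uvE) subrr.
have muc : has_cycle H -> exists2 k, max_induced_cycle_length H (2 * k)%N & mu_is I k.
  move=> /(max_induced_cycle_exists Hsym cP)[l [[s is_ sl] maxl]].
  have [k [sk k2 tfk]] := two_fiber_of_induced_cycle Hsym cP inj adj surj is_.
  exists k; first by rewrite mul2n -sk sl; split=> //; exists s.
  by apply: muk => // s' /maxl; rewrite -sl sk.
have mu2 : ~ edgeless H -> ~ has_cycle H -> mu_is I 2.
  move=> edge nocyc; apply: muk => // [s /andP[gs _]|].
    by case: nocyc; exists s.
  have [x [y xy]] : exists x y, H x y.
    by apply: contrapT => no; apply: edge => x y; apply/negP => xy; apply: no; exists x, y.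
  exact: (two_fiber_of_edge Hsym cP inj adj surj xy).
split; first by split.
(* Induced cycles have length [2 * k] with [k] at least 2, so a maximum of at most 4 means that all
   have length 4. Without cycles both sides hold. *)
have mu4 : mu_le2 <-> induced4 H.
  have [cyc|nocyc] := pselect (has_cycle H).
    have [k [[s is_ sk] maxk] mk] := muc cyc.
    have [k' [sk' k2' _]] := two_fiber_of_induced_cycle Hsym cP inj adj surj is_.
    split=> [[d md d2]|H4]; last first.
      by exists k => //; have := H4 _ is_; rewrite sk; clear; lia.
    have kd := mu_is_unique mk md.
    move=> s' is'; have [k1 [s1 k12 _]] := two_fiber_of_induced_cycle Hsym cP inj adj surj is'.
    by have := maxk _ is'; rewrite s1 kd; move: k12 d2; clear; lia.
  split=> _; first by move=> s /andP[gs _]; case: nocyc; exists s.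
  have [noH|edge] := pselect (edgeless H); first by exists 0%N => //; apply: mu0.
  by exists 2%N => //; apply: mu2.
have not4 : ~ induced4 H -> exists2 d, (2 < d)%N & coprime_two_fiber ro co d.
  move=> n4; apply: contrapT => no; apply: n4 => s is_.
  have [k [sk k2 tfk]] := two_fiber_of_induced_cycle Hsym cP inj adj surj is_.
  rewrite sk; have [k3|k3] := ltnP 2 k; first by case: no; exists k.
  by move: k2 k3; clear; lia.
have peo : induced4 H -> exists2 key : 'I_m -> nat, injective key &
    forall i j k, corner ro co key i j k ->
    exists h, [/\ ro h = ro k, co h = co j & (key i < key h)%N].
  by move=> H4; apply: cone_elimination_key Hsym cP H4 inj adj surj.
(* Each remaining condition is compared with the induced cycle condition: an induced cycle of
   another length yields a coprime two-element fiber of degree above 2, against the condition. *)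
split=> //; rewrite mu4; split=> [H4|P].
- by apply: (mu_le2_quadratic fibI); apply/mu4.
- apply: contrapT => /not4[d d2 [u [v [du [uv uvE] fibu cop]]]].
  by apply: (two_fiber_not_quadratic fibI uv uvE fibu cop) P; rewrite du.
- have [key key_inj fill] := peo H4.
  exact: (peo_koszul inj fibI key_inj fill (psi := psi) kerI).
- apply: contrapT => /not4[d d2 [u [v [du [uv uvE] fibu cop]]]].
  apply: (two_fiber_not_koszul fibI (psi := psi) kerI uv uvE fibu cop); first by rewrite du.
  exact: P.
- have [key key_inj fill] := peo H4.
  exact: (peo_groebner inj fibI key_inj fill).
- apply: contrapT => /not4[d d2 [u [v [du [uv uvE] fibu cop]]]].
  by apply: (two_fiber_not_gb fibI uv uvE fibu cop) P; rewrite du.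
Qed.
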